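(* Let $\tau>0$ and $\xi>0$. Suppose that the following hold. (1) $\phi$ is smooth, $\int_{\mathcal X} e^{-\phi(x)}\,dx=1$, and for any time $\tau>0$ there is a constant $C^{\mathrm{Lions}}_\tau>0$ such that for all $g\in \mathrm L^2(\mathrm U_\tau\otimes\mu)$ $$\Big\|g-\iint_{[0,\tau]\times\mathcal X} g\,d\mathrm U_\tau\,d\mu\Big\|^2_{\mathrm L^2(\mathrm U_\tau\otimes\mu)}\le C^{\mathrm{Lions}}_\tau\,\|\nabla_{t,x}g\|^2_{\mathrm H^{-1}(\mathrm U_\tau\otimes\mu)}.$$ (2) $\psi$ is smooth, $\int_{\mathcal V}e^{-\psi(v)}\,dv=1$, $\int_{\mathcal V}|\nabla_v\psi|^4\,d\gamma+\int_{\mathcal V}|\nabla_v^2\psi|^2\,d\gamma<+\infty$, $\limsup_{R\to\infty}\int_{\mathcal V\setminus B(0,R)}|\nabla\psi|^{-2}\,d\gamma=0$, and the symmetric positive matrix $\mathscr M=\int_{\mathcal V}\nabla_v\psi\otimes\nabla_v\psi\,d\gamma$ is definite. (3) The Lie algebra generated by $\nabla_v$ and $\nabla_v\psi\cdot\nabla_x-\nabla_x\phi\cdot\nabla_v$ is of dimension $2d$ at all points $(x,v)\in\mathcal X\times\mathcal V$. (4) There is a constant $L_\phi\in\mathbb R_+$ such that $\|z\,\nabla_x\phi\|_{\mathrm L^2(\mu)}\le L_\phi\|z\|_{\mathrm H^1(\mu)}$ for all $z\in\mathrm H^1(\mu)$. (5) There is $c_\psi>0$ such that $\|g\|_{\mathrm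 L^2(\gamma)}\le c_\psi^{-1/2}\|\nabla_vg\|_{\mathrm L^2(\gamma)}$ for all $g\in\mathrm H^1(\gamma)\cap\mathrm L^2_0(\gamma)$. Then there exists a constant $\lambda>0$ such that all functions $h$ solving (VOU) with initial condition $h_0\in\mathrm L^2_0(\Theta)$ satisfy $$\forall t\ge0,\qquad \mathscr H_\tau(t)\le e^{-2\lambda t}\,\mathscr H_\tau(0).$$ Moreover, $$\lambda\ \ge\ \bar\lambda:=\frac{1}{1+C^{\mathrm{Lions}}_\tau K_{\mathrm{avg}}}\left(\frac1{\xi c_\psi}+\xi\right)^{-1},$$ where $K_{\mathrm{avg}}$ is the averaging constant defined in the context.
   Context: $\mathcal X$ is the position space and $\mathcal V$ the velocity space, both of dimension $d$; typical choices are $\mathcal X=\mathbb R^d$ or $\mathcal X=(L\mathbb T)^d$ with $L>0$ and $\mathbb T=\mathbb R/\mathbb Z$, and $\mathcal V=\mathbb R^d$ or $\mathcal V=\mathbb T^d$. Given $\phi:\mathcal X\to\mathbb R$ and $\psi:\mathcal V\to\mathbb R$, set $\mu(dx)=e^{-\phi(x)}dx$, $\gamma(dv)=e^{-\psi(v)}dv$, $\Theta(dx\,dv)=\mu(dx)\,\gamma(dv)$ (probability measures). A subscript $0$, as in $\mathrm L^2_0(\Theta)$ or $\mathrm L^2_0(\gamma)$, denotes the subspace of functions with average $0$ for the indicated measure. $\mathrm U_\tau(dt)=\tau^{-1}\mathbf 1_{[0,\tau]}(t)\,dt$. $\mathrm H^1_{\mathrm{DC}}(\mathrm U_\tau\otimes\mu)=\{z\in\mathrm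 H^1(\mathrm U_\tau\otimes\mu): z(0,\cdot)=z(\tau,\cdot)=0\}$, and $\mathrm H^{-1}(\mathrm U_\tau\otimes\mu)$ is its dual with the dual norm (for vector-valued functions, that of the dual of $\mathrm H^1_{\mathrm{DC}}(\mathrm U_\tau\otimes\mu)^{d+1}$). $\mathrm H^{-1}(\gamma)$ is the dual of $\mathrm H^1(\gamma)$. Equation (VOU), with $\xi>0$, is $$\partial_th+\nabla_v\psi\cdot\nabla_xh-\nabla_x\phi\cdot\nabla_vh=-\xi\,\nabla_v^\star\nabla_vh,\qquad h(0,\cdot,\cdot)=h_0\in\mathrm L^2(\Theta),$$ where $\star$ denotes adjoints in $\mathrm L^2(\Theta)$, so $-\nabla_v^\star\nabla_v=\Delta_v-\nabla_v\psi\cdot\nabla_v$. Solutions live in $\mathrm L^\infty(0,\infty;\mathrm L^2(\Theta))$, have $\nabla_vh\in\mathrm L^2(0,\infty;\mathrm L^2(\Theta))$, and satisfy the energy identity $\frac{d}{dt}\|h(t)\|^2_{\mathrm L^2(\Theta)}=-2\xi\|\nabla_vh(t)\|^2_{\mathrm L^2(\Theta)}$. For a solution $h$, $\mathscr H_\tau(t)=\int_t^{t+\tau}\|h(s,\cdot,\cdot)\|^2_{\mathrm L^2(\Theta)}\,ds$. Let $T=\nabla_v\psi\cdot\nabla_x-\nabla_x\phi\cdot\nabla_v$, $\Pi h=\int_{\mathcal V}h(\cdot,\cdot,v)\,\gamma(dv)$, and $\mathrm H^1_{\mathrm{kin}}=\{h\in\mathrm L^2(\mathrm U_\tau\otimes\mu,\mathrm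 H^1(\gamma)):(\partial_t+T)h\in\mathrm L^2(\mathrm U_\tau\otimes\mu,\mathrm H^{-1}(\gamma))\}$. $K_{\mathrm{avg}}\in\mathbb R_+$ is a constant (which exists under hypotheses (1), (2), (4)) such that for all $h\in\mathrm H^1_{\mathrm{kin}}$ $$\|\nabla_{t,x}\Pi h\|^2_{\mathrm H^{-1}(\mathrm U_\tau\otimes\mu)}\le K_{\mathrm{avg}}\left(\|(\mathrm{Id}-\Pi)h\|^2_{\mathrm L^2(\mathrm U_\tau\otimes\Theta)}+\|(\partial_t+T)h\|^2_{\mathrm L^2(\mathrm U_\tau\otimes\mu,\mathrm H^{-1}(\gamma))}\right).$$ *)

(* Defs.v *)
From HB Require Import structures.
From mathcomp Require Import all_boot all_order all_algebra.
From mathcomp Require Import all_classical all_reals all_analysis.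
Set Implicit Arguments.
Unset Strict Implicit.
Unset Printing Implicit Defensive.
Import Order.TTheory GRing.Theory Num.Theory.
Import numFieldNormedType.Exports.
Local Open Scope classical_set_scope.
Local Open Scope ring_scope.

Section row_measurable.
Variables (R : realType) (d : nat).

Let coor (i : 'I_d) (x : 'rV[R]_d) : R := x 0 i.

Let row_set0 : g_sigma_preimage coor set0.
Proof. exact: sigma_algebra0. Qed.

Let row_setC A : g_sigma_preimage coor A -> g_sigma_preimage coor (~` A).
Proof. exact: sigma_algebraC. Qed.

Let row_bigcup (F : (set 'rV[R]_d)^nat) :
  (forall i, g_sigma_preimage coor (F i)) ->
  g_sigma_preimage coor (\bigcup_i (F i)).
Proof. exact: sigma_algebra_bigcup. Qed.

HB.instance Definition _ := @isMeasurable.Build default_measure_display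
  'rV[R]_d (g_sigma_preimage coor) row_set0 row_setC row_bigcup.

Lemma measurable_coor (i : 'I_d) :
  measurable_fun [set: 'rV[R]_d] (fun x : 'rV[R]_d => x 0 i).
Proof.
move=> _ Y mY; rewrite setTI; apply: sub_sigma_algebra => /=.
rewrite -bigcup_seq/=; exists i => /=; first by rewrite mem_index_enum.
by exists Y => //; rewrite setTI.
Qed.

Lemma measurable_fun_rowP d1 (T : measurableType d1) (f : T -> 'rV[R]_d) :
  (forall i, measurable_fun [set: T] (fun t => f t 0 i)) ->
  measurable_fun [set: T] f.
Proof.
move=> mf; suff H : g_sigma_preimage (fun i => coor i \o f) `<=` measurable.
  move=> _ A mA; rewrite setTI; apply: H.
  by rewrite g_sigma_preimage_comp; exists A => //; rewrite setTI.
apply: smallest_sub; first exact: sigma_algebra_measurable.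
rewrite -bigcup_seq; apply: bigcup_sub => i Ii.
by move=> A [B mB <-]; exact: mf.
Qed.

End row_measurable.

Section row_lebesgue.
Variable R : realType.

Definition consrow d (p : R * 'rV[R]_d) : 'rV[R]_d.+1 :=
  \row_i (if unlift ord0 i is Some j then p.2 0 j else p.1).

Definition unconsrow d (x : 'rV[R]_d.+1) : R * 'rV[R]_d :=
  (x 0 ord0, \row_j x 0 (lift ord0 j)).

Lemma consrow0 d (p : R * 'rV[R]_d) : consrow p 0 ord0 = p.1.
Proof. by rewrite mxE unlift_none. Qed.

Lemma consrow_lift d (p : R * 'rV[R]_d) (j : 'I_d) :
  consrow p 0 (lift ord0 j) = p.2 0 j.
Proof. by rewrite mxE liftK. Qed.

Lemma consrowK d : cancel (@consrow d) (@unconsrow d).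
Proof.
move=> [s x]; rewrite /unconsrow consrow0; congr pair.
by apply/rowP => j; rewrite mxE consrow_lift.
Qed.

Lemma measurable_consrow d : measurable_fun [set: R * 'rV[R]_d] (@consrow d).
Proof.
apply: measurable_fun_rowP => i; case: (unliftP ord0 i) => [j|] ->.
  under eq_fun do rewrite consrow_lift.
  exact: (measurableT_comp (@measurable_coor R d j) measurable_snd).
under eq_fun do rewrite consrow0.
exact: measurable_fst.
Qed.

Lemma measurable_unconsrow d :
  measurable_fun [set: 'rV[R]_d.+1] (@unconsrow d).
Proof.
apply: measurable_fun_pair; first exact: measurable_coor.
apply: measurable_fun_rowP => i; under eq_fun do rewrite mxE.
exact: measurable_coor.
Qed.

Section cons_measure.
Variables (d : nat) (m : {sigma_finite_measure set 'rV[R]_d -> \bar R}).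

Definition cons_lebesgue : set 'rV[R]_d.+1 -> \bar R :=
  pushforward (@lebesgue_measure R \x m)%E (@consrow d).

Local Open Scope ereal_scope.

Let cons0 : cons_lebesgue set0 = 0.
Proof. by rewrite /cons_lebesgue /pushforward preimage_set0 measure0. Qed.

Let cons_ge0 A : 0 <= cons_lebesgue A.
Proof. by rewrite /cons_lebesgue /pushforward; exact: measure_ge0. Qed.

Let cons_sigma_additive : semi_sigma_additive cons_lebesgue.
Proof.
move=> F mF tF mUF; rewrite /cons_lebesgue /pushforward preimage_bigcup.
have mc A : measurable A -> measurable (@consrow d @^-1` A).
  by move=> mA; rewrite -[X in measurable X]setTI; exact: measurable_consrow.
apply: measure_semi_sigma_additive.
- by move=> n; exact: mc.
- apply/trivIsetP => /= i j _ _ ij; rewrite -preimage_setI.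
  by move/trivIsetP : tF => /(_ _ _ _ _ ij) ->//; rewrite preimage_set0.
- by rewrite -preimage_bigcup; exact: mc.
Qed.

HB.instance Definition _ := isMeasure.Build _ _ _ cons_lebesgue
  cons0 cons_ge0 cons_sigma_additive.

Let cons_sigma_finite : sigma_finite setT cons_lebesgue.
Proof.
have /sigma_finiteP[F [TF ndF Foo]] := sigma_finiteT (@lebesgue_measure R).
have /sigma_finiteP[G [TG ndG Goo]] := sigma_finiteT m.
exists (fun n => @unconsrow d @^-1` (F n `*` G n)).
  rewrite -preimage_bigcup (_ : \bigcup_n _ = setT) ?preimage_setT//.
  apply/seteqP; split => // -[s x] _.
  have [n _ Fns] : (\bigcup_n F n) s by rewrite -TF.
  have [k _ Gkx] : (\bigcup_n G n) x by rewrite -TG.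
  exists (maxn n k) => //; split.
    by move: (s) Fns; exact/subsetPset/ndF/leq_maxl.
  by move: (x) Gkx; exact/subsetPset/ndG/leq_maxr.
move=> n; have [mF Fnoo] := Foo n; have [mG Gnoo] := Goo n; split.
  rewrite -[X in measurable X]setTI; apply: measurable_unconsrow => //.
  exact: measurableX.
rewrite /cons_lebesgue /pushforward -comp_preimage.
rewrite (_ : @unconsrow d \o @consrow d = id); last first.
  by apply/funext => p /=; rewrite consrowK.
rewrite preimage_id product_measure1E// lte_mul_pinfty//.
by rewrite ge0_fin_numE.
Qed.

HB.instance Definition _ := Measure_isSigmaFinite.Build _ _ _ cons_lebesgue
  cons_sigma_finite.
End cons_measure.

Fixpoint lebesgue_row (d : nat) : {sigma_finite_measure set 'rV[R]_d -> \bar R} :=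
  if d is d'.+1 then cons_lebesgue (lebesgue_row d') else \d_(0 : 'rV[R]_0).

End row_lebesgue.

Section spaces.
Variables (R : realType) (d : nat).
Local Notation E := 'rV[R]_d.

(* The space (L T)^d is represented by R^d, its functions being the ones that
   are L-periodic in each coordinate and integrals being over `[0, L[^d. *)
Inductive base_space := Euclidean | Torus of {posnum R}.

Definition cell (S : base_space) : set E :=
  if S is Torus L then [set x | forall i, 0 <= x 0 i < L%:num] else setT.

Definition well_defined_on (S : base_space) (f : E -> R) :=
  if S is Torus L then
    forall (i : 'I_d) x, f (x + L%:num *: delta_mx 0 i) = f x
  else True.

Definition dot (u v : E) : R := \sum_i u 0 i * v 0 i.

(* The library norm on row vectors is the sup norm. *)
Definition enorm (u : E) : R := Num.sqrt (dot u u).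

Definition in_ball (S : base_space) (r : R) (x : E) : Prop :=
  if S is Euclidean then enorm x <= r else True.

Definition grad (f : E -> R) (x : E) : E := \row_i 'D_(delta_mx 0 i) f x.

Definition hess2 (f : E -> R) (x : E) : R :=
  \sum_i \sum_j (grad (fun y => grad f y 0 i) x 0 j) ^+ 2.

Definition smooth (W : normedModType R) (f : W -> R) :=
  forall s : seq W, let g := foldr (fun w g => 'D_w g) f s in
    continuous g /\ forall x w, derivable g x w.

Definition gibbs_measure (S : base_space) (phi : E -> R)
    (m : set E -> \bar R) :=
  forall A, measurable A ->
    m A = (\int[@lebesgue_row R d]_(x in A `&` cell S) (expR (- phi x))%:E)%E.

(* C^oo functions with compact support in S, resp. J x S and J x X x V;
   periodicity replaces decay in the torus directions. *)
Definition test_fun (S : base_space) (f : E -> R) :=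
  [/\ smooth f, well_defined_on S f &
      exists r, forall x, f x != 0 -> in_ball S r x].

Definition test_fun_tx (J : interval R) (S : base_space) (f : R * E -> R) :=
  [/\ smooth f, forall t, well_defined_on S (fun x => f (t, x)) &
      exists a b r, `[a, b] `<=` [set` J] /\
        forall t x, f (t, x) != 0 -> a <= t <= b /\ in_ball S r x].

Definition test_fun_txv (J : interval R) (X V : base_space)
    (f : R * (E * E) -> R) :=
  [/\ smooth f,
      forall t v, well_defined_on X (fun x => f (t, (x, v))),
      forall t x, well_defined_on V (fun v => f (t, (x, v))) &
      exists a b r, `[a, b] `<=` [set` J] /\
        forall t x v, f (t, (x, v)) != 0 ->
          [/\ a <= t <= b, in_ball X r x & in_ball V r v]].

Definition dt (T : Type) (f : R * T -> R) (p : R * T) : R :=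
  'D_1 (fun s => f (s, p.2)) p.1.

Definition grad_x (f : R * (E * E) -> R) (p : R * (E * E)) : E :=
  grad (fun y => f (p.1, (y, p.2.2))) p.2.1.

Definition grad_v (f : R * (E * E) -> R) (p : R * (E * E)) : E :=
  grad (fun w => f (p.1, (p.2.1, w))) p.2.2.

Definition transport (phi psi : E -> R) (f : R * (E * E) -> R)
    (p : R * (E * E)) : R :=
  dot (grad psi p.2.2) (grad_x f p) - dot (grad phi p.2.1) (grad_v f p).

End spaces.
Arguments Euclidean {R}.

Section L2.
Context d0 (T : measurableType d0) (R : realType) (d : nat).
Variable m : {measure set T -> \bar R}.

Definition L2norm (f : T -> R) : \bar R := 'N[m]_2%:E[EFin \o f]%E.

Definition L2vec (G : T -> 'rV[R]_d) :=
  forall i, (fun x => G x 0 i) \in Lfun m 2%:E.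

Definition L2vnorm (G : T -> 'rV[R]_d) : \bar R := L2norm (fun x => enorm (G x)).
End L2.

Section sobolev.
Variables (R : realType) (d : nat).
Local Notation E := 'rV[R]_d.
Local Notation leb := (@lebesgue_measure R).
Local Notation lebE := (@lebesgue_row R d).

Definition weak_grad (S : base_space R) (g : E -> R) (G : E -> E) :=
  forall f, test_fun S f -> forall i,
    \int[lebE]_(x in cell S) (g x * grad f x 0 i) =
    - (\int[lebE]_(x in cell S) (G x 0 i * f x)).

(* An element of H^1 is encoded as the pair of a function and its weak
   gradient. *)
Definition H1 (S : base_space R) (m : {measure set E -> \bar R}) (g : E -> R)
    (G : E -> E) :=
  [/\ g \in Lfun m 2%:E, L2vec m G & weak_grad S g G].

Definition H1norm (m : {measure set E -> \bar R}) (g : E -> R) (G : E -> E)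
    : \bar R :=
  sqrte (L2norm m g ^+ 2 + L2vnorm m G ^+ 2)%E.

Definition linear_on_H1 (S : base_space R) (m : {measure set E -> \bar R})
    (F : (E -> R) -> (E -> E) -> R) :=
  forall (a : R) g1 G1 g2 G2, H1 S m g1 G1 -> H1 S m g2 G2 ->
    F (fun v => a * g1 v + g2 v) (fun v => a *: G1 v + G2 v) =
    a * F g1 G1 + F g2 G2.

Definition Hm1norm (S : base_space R) (m : {measure set E -> \bar R})
    (F : (E -> R) -> (E -> E) -> R) : \bar R :=
  ereal_sup [set e | exists g G,
    [/\ H1 S m g G, (H1norm m g G <= 1)%E & e = `|F g G|%:E]].

Definition in_Hm1 S m F := linear_on_H1 S m F /\ (Hm1norm S m F < +oo)%E.

Section time_space.
Variables (X : base_space R) (phi : E -> R) (mu : probability E R).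
Variables (tau : R) (tau0 : 0 < tau).

Definition Umu : probability (measurableTypeR R * E)%type R :=
  (uniform_prob tau0 \x mu)%E.

Definition weak_grad_tx (z zt : R * E -> R) (zx : R * E -> E) :=
  forall f, test_fun_tx `]0, tau[ X f ->
    (\int[(leb \x lebE)%E]_(p in `]0, tau[ `*` cell X) (z p * dt f p) =
     - (\int[(leb \x lebE)%E]_(p in `]0, tau[ `*` cell X) (zt p * f p))) /\
    (forall i,
     \int[(leb \x lebE)%E]_(p in `]0, tau[ `*` cell X)
       (z p * grad (fun y => f (p.1, y)) p.2 0 i) =
     - (\int[(leb \x lebE)%E]_(p in `]0, tau[ `*` cell X) (zx p 0 i * f p))).

Definition has_time_trace (z : R * E -> R) (s : R) (w : E -> R) :=
  exists zc : R * E -> R,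
    [/\ {ae Umu, forall p, zc p = z p},
        forall t, 0 <= t <= tau -> (fun x => zc (t, x)) \in Lfun mu 2%:E,
        forall t0, 0 <= t0 <= tau ->
          L2norm mu (fun x => zc (t, x) - zc (t0, x))
            @[t --> within `[0, tau] (nbhs t0)] --> 0%E &
        {ae mu, forall x, zc (s, x) = w x}].

Definition H1DC (z zt : R * E -> R) (zx : R * E -> E) :=
  [/\ z \in Lfun Umu 2%:E, zt \in Lfun Umu 2%:E, L2vec Umu zx &
      weak_grad_tx z zt zx] /\
  has_time_trace z 0 (cst 0) /\ has_time_trace z tau (cst 0).

(* For Z = (Z_0, ..., Z_d), this is <nabla_{t,x} g, Z> = <g, nabla_{t,x}^* Z>,
   the adjoint nabla_{t,x}^* in L^2(U_tau (x) mu) being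
   Z |-> - dt Z_0 + sum_i (- d_i Z_i + d_i phi Z_i). *)
Definition grad_tx_pairing (g : R * E -> R) (Z Zt : 'I_d.+1 -> R * E -> R)
    (Zx : 'I_d.+1 -> R * E -> E) : R :=
  \int[Umu]_p (g p * (- Zt ord0 p +
    \sum_(i < d) (- Zx (lift ord0 i) p 0 i
                  + grad phi p.2 0 i * Z (lift ord0 i) p))).

Definition grad_tx_Hm1norm (g : R * E -> R) : \bar R :=
  ereal_sup [set e | exists Z Zt Zx,
    [/\ forall k : 'I_d.+1, H1DC (Z k) (Zt k) (Zx k),
        (sqrte (\sum_(k < d.+1) (L2norm Umu (Z k) ^+ 2
           + L2norm Umu (Zt k) ^+ 2 + L2vnorm Umu (Zx k) ^+ 2)) <= 1)%E &
        e = `|grad_tx_pairing g Z Zt Zx|%:E]].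

End time_space.
End sobolev.

Section kinetic.
Variables (R : realType) (d : nat).
Local Notation E := 'rV[R]_d.
Local Notation leb := (@lebesgue_measure R).
Variables (X V : base_space R) (phi psi : E -> R) (mu gamma : probability E R).

Definition ThetaXV : probability (E * E)%type R := (mu \x gamma)%E.

Definition lions_inequality (C : R -> R) :=
  forall (tau : R) (tau0 : 0 < tau), 0 < C tau /\
    forall g : R * E -> R, g \in Lfun (Umu mu tau0) 2%:E ->
      (L2norm (Umu mu tau0) (fun p => (g p - \int[Umu mu tau0]_q g q)%R) ^+ 2
       <= (C tau)%:E * grad_tx_Hm1norm X phi mu tau0 g ^+ 2)%E.

Definition position_hypotheses (C : R -> R) :=
  [/\ smooth phi /\ well_defined_on X phi,
      (\int[@lebesgue_row R d]_(x in cell X) (expR (- phi x))%:E = 1)%E &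
      lions_inequality C].

Definition psi_matrix : 'M[R]_d :=
  \matrix_(i, j) \int[gamma]_v (grad psi v 0 i * grad psi v 0 j).

(* The inverse is taken in \bar R, where 0^-1 = +oo. *)
Definition velocity_hypotheses :=
  [/\ smooth psi /\ well_defined_on V psi,
      (\int[@lebesgue_row R d]_(v in cell V) (expR (- psi v))%:E = 1)%E,
      ((\int[gamma]_v (enorm (grad psi v) ^+ 4)%:E)
       + (\int[gamma]_v (hess2 psi v)%:E) < +oo)%E,
      limf_esup (fun r : R => \int[gamma]_(v in [set v | (r <= enorm v)%R])
        ((enorm (grad psi v) ^+ 2)%:E)^-1)%E (pinfty_nbhs R) = 0%E &
      forall w : E, w != 0 -> 0 < (w *m psi_matrix *m w^T) 0 0].

Inductive lie_algebra (G : set (E * E -> E * E)) : set (E * E -> E * E) :=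
| lie_gen A of G A : lie_algebra G A
| lie_comb (a : R) A B of lie_algebra G A & lie_algebra G B :
    lie_algebra G (fun z => a *: A z + B z)
| lie_bracket A B of lie_algebra G A & lie_algebra G B :
    lie_algebra G (fun z => 'D_(A z) B z - 'D_(B z) A z).

Definition kinetic_fields : set (E * E -> E * E) :=
  [set A | (exists i, A = fun=> (0, delta_mx 0 i)) \/
           A = fun z => (grad psi z.2, - grad phi z.1)].

Definition hoermander_condition :=
  forall z : E * E, exists A : 'I_(d + d) -> E * E -> E * E,
    (forall k, lie_algebra kinetic_fields (A k)) /\
    \rank (\matrix_(k < d + d) row_mx (A k z).1 (A k z).2) = (d + d)%N.

Definition grad_phi_bounded (L : R) :=
  forall z Z, H1 X mu z Z ->
    (L2vnorm mu (fun x => z x *: grad phi x) <= L%:E * H1norm mu z Z)%E.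

Definition poincare_inequality (c : R) :=
  forall g G, H1 V gamma g G -> \int[gamma]_v g v = 0 ->
    (L2norm gamma g <= (c `^ (- 2^-1))%:E * L2vnorm gamma G)%E.

Definition vavg (h : R * (E * E) -> R) (p : R * E) : R :=
  \int[gamma]_v h (p.1, (p.2, v)).

(* F is (dt + T) h as an element of L^2(U_tau (x) mu, H^{-1}(gamma)): its
   measurability is the weak one, equivalent to the strong one as H^1(gamma) is
   separable, and the last clause identifies it in the sense of distributions,
   T being antisymmetric in L^2(Theta). *)
Definition H1kin (tau : R) (tau0 : 0 < tau) (h : R * (E * E) -> R)
    (F : R * E -> (E -> R) -> (E -> E) -> R) :=
  [/\ h \in Lfun (uniform_prob tau0 \x ThetaXV)%E 2%:E,
      exists G : R * (E * E) -> E, L2vec (uniform_prob tau0 \x ThetaXV)%E G /\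
        {ae Umu mu tau0, forall p, weak_grad V
          (fun v => h (p.1, (p.2, v))) (fun v => G (p.1, (p.2, v)))},
      {ae Umu mu tau0, forall p, in_Hm1 V gamma (F p)} /\
      forall g G, H1 V gamma g G -> measurable_fun setT (fun p => F p g G),
      (\int[Umu mu tau0]_p Hm1norm V gamma (F p) ^+ 2 < +oo)%E &
      forall f, test_fun_txv `]0, tau[ X V f ->
        \int[Umu mu tau0]_p F p (fun v => f (p.1, (p.2, v)))
                             (fun v => grad_v f (p.1, (p.2, v))) =
        - (\int[(uniform_prob tau0 \x ThetaXV)%E]_p
             (h p * (dt f p + transport phi psi f p)))].

Definition averaging_inequality (tau : R) (tau0 : 0 < tau) (K : R) :=
  forall h F, H1kin tau0 h F ->
    (grad_tx_Hm1norm X phi mu tau0 (vavg h) ^+ 2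
     <= K%:E *
        (L2norm (uniform_prob tau0 \x ThetaXV)
           (fun p => (h p - vavg h (p.1, p.2.1))%R) ^+ 2
         + (\int[Umu mu tau0]_p Hm1norm V gamma (F p) ^+ 2)))%E.

(* Weak formulation on [0, +oo[ with initial datum h0. The last clause is
   d/dt ||h||^2 = - 2 xi ||nabla_v h||^2 in integrated form, as ||nabla_v h||^2
   is only integrable in time. *)
Definition VOU_solution (xi : R) (h0 : E * E -> R) (h : R * (E * E) -> R) :=
  measurable_fun setT h /\
  (exists M : R, {ae leb, forall t, 0 <= t ->
    (L2norm ThetaXV (fun z => h (t, z)) <= M%:E)%E}) /\
  exists G : R * (E * E) -> E,
  [/\ measurable_fun setT G,
      {ae (leb \x mu)%E, forall p, 0 <= p.1 -> weak_grad V
        (fun v => h (p.1, (p.2, v))) (fun v => G (p.1, (p.2, v)))},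
      (\int[leb]_(t in `[0%R, +oo[)
         L2vnorm ThetaXV (fun z => G (t, z)) ^+ 2 < +oo)%E,
      forall f, test_fun_txv `]-oo, +oo[ X V f ->
        (\int[(leb \x ThetaXV)%E]_(p in `[0%R, +oo[ `*` setT)
           (h p * (dt f p + transport phi psi f p)
            - xi * dot (G p) (grad_v f p)))
        + (\int[ThetaXV]_z (h0 z * f (0, z))) = 0 &
      {ae leb, forall t, 0 <= t ->
        (L2norm ThetaXV (fun z => h (t, z)) ^+ 2 =
         L2norm ThetaXV h0 ^+ 2
         - (2 * xi)%:E * (\int[leb]_(s in `[0%R, t])
             L2vnorm ThetaXV (fun z => G (s, z)) ^+ 2))%E}].

Definition Htau (tau : R) (h : R * (E * E) -> R) (t : R) : \bar R :=
  (\int[leb]_(s in `[t, (t + tau)%R]) L2norm ThetaXV (fun z => h (s, z)) ^+ 2)%E.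

End kinetic.

(* Main.v *)
(* Since the mass of h is conserved, Pi h has zero mean on every window
   [t, t + tau], and Lions' inequality followed by the averaging inequality
   bounds the norm of Pi h there by that of (Id - Pi) h and of
   (dt + T) h = - xi grad_v^* grad_v h in H^{-1}(gamma); the first is at most
   c_psi^{-1/2} |grad_v h| by Poincare and the second at most xi |grad_v h|.
   Hence the window integral of |h|^2 is at most
   (1 + C K) (1 / c_psi + xi^2) times that of |grad_v h|^2, and as its derivative
   in t is - 2 xi times the latter, Gronwall's lemma concludes. The weak
   formulation is tested against products of cutoffs, the gradients of phi and
   psi being square integrable by (4) with z = 1 and by (2). *)
From HB Require Import structures.
From mathcomp Require Import all_boot all_order all_algebra.
From mathcomp Require Import all_classical all_reals all_analysis.
From mathcomp Require Import measurable_realfun ring lra.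
Require Import Defs.
Set Implicit Arguments.
Unset Strict Implicit.
Unset Printing Implicit Defensive.
Import Order.TTheory GRing.Theory Num.Theory.
Import numFieldNormedType.Exports.
Local Open Scope classical_set_scope.
Local Open Scope ring_scope.

(** Test functions have bounded support in time and in the Euclidean directions, so constants are
    not admissible in the weak formulation: mass conservation is a limit over cutoffs. The
    derivative of their time factor tends to -1 on [[0, T[], so the limit says that the integral of
    [h] over [[0, T[] times phase space vanishes, rather than its mass at each time. Lions'
    inequality involves only the mean over a window, for which this suffices. Integrability and
    domination both come from one function, [weight]. The hypotheses live on [[0, tau]] with the
    uniform law, so a solution is translated by [t] before they apply; the factor [tau^-1] cancels
    at the end. The energy identity holds only at almost every time, hence Gronwall's argument runs
    on primitives, which are differentiable, and not on the norm of [h] itself. With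
    [kappa = (1 + C K) (1 / c_psi + xi ^ 2)], the rate [2 xi / kappa] is exactly twice the announced
    lower bound, so that bound itself is taken as [lambda]. *)

Section integral_generalities.
Context d (T : measurableType d) (R : realType).
Implicit Types m : {measure set T -> \bar R}.
Import HBNNSimple.

(** The integral of a nonnegative function is a supremum over the simple functions below it, so
    domination passes to it with no measurability. This is what allows bounds on the integral of
    [Hm1norm V gamma (F p)], a supremum over an uncountable family. *)
Lemma le_integral_no_meas m (D : set T) (f g : T -> \bar R) :
  (forall x, D x -> (0 <= f x)%E) -> (forall x, D x -> (f x <= g x)%E) ->
  (\int[m]_(x in D) f x <= \int[m]_(x in D) g x)%E.
Proof.
move=> f0 fg; have g0 x : D x -> (0 <= g x)%E.
  by move=> Dx; exact: le_trans (f0 _ Dx) (fg _ Dx).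
rewrite !ge0_integralE//; apply: le_ereal_sup => /= _ [h hf <-].
exists h => //= x; apply: le_trans (hf x) _.
rewrite /patch; case: ifPn => // xD; exact/fg/set_mem.
Qed.

(** A simple function below [f] extended by 0 takes its nonzero values inside [D], so comparing the
    measures on subsets of [D] is enough. *)
Lemma le_measure_integral m1 m2 (D : set T) (f : T -> \bar R) :
  (forall A, measurable A -> A `<=` D -> (m1 A <= m2 A)%E) ->
  (forall x, D x -> (0 <= f x)%E) ->
  (\int[m1]_(x in D) f x <= \int[m2]_(x in D) f x)%E.
Proof.
move=> m12 f0; rewrite !ge0_integralE//; apply/ereal_supP => /= _ [h hf <-].
apply: (@le_trans _ _ (sintegral m2 h)).
  rewrite !sintegralE; apply: lee_fsum; first exact: fimfunP.
  move=> r [x _ <-]; have [->|h0] := eqVneq (h x) 0; first by rewrite !mul0e.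
  apply: lee_wpmul2l; first by rewrite lee_fin.
  apply: m12 => // y /= hyx; have := hf y; rewrite hyx /patch.
  case: ifPn => [/set_mem//|_]; rewrite lee_fin => hx0.
  by exfalso; move/negP : h0; apply; rewrite eq_le hx0/= fun_ge0.
by apply: ereal_sup_ubound; exists h.
Qed.

(* Reduces an identity of integrals of integrable functions to nonnegative ones. *)
Lemma integral_transfer d' (T' : measurableType d') (m' : {measure set T' -> \bar R})
    m (D : set T) (D' : set T') (k : R) (s : T' -> T) (f : T -> \bar R) :
  measurable_fun setT f ->
  (forall g : T -> \bar R, measurable_fun setT g -> (forall x, 0 <= g x)%E ->
    (\int[m']_(x in D') g (s x) = k%:E * \int[m]_(x in D) g x)%E) ->
  m.-integrable D f -> measurable D ->
  (\int[m']_(x in D') f (s x) = k%:E * \int[m]_(x in D) f x)%E.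
Proof.
move=> mf H fi mD.
rewrite integralE [in RHS]integralE muleBr//; last exact: integrable_add_def.
have := H _ (measurable_funepos mf) (funepos_ge0 f).
have := H _ (measurable_funeneg mf) (funeneg_ge0 f).
move=> <- <-; congr (_ - _)%E; apply: eq_integral => x _.
  by rewrite !funeposE.
by rewrite !funenegE.
Qed.

End integral_generalities.

(** * Square integrable functions and the Euclidean inner product *)

Section L2_generalities.
Context d (T : measurableType d) (R : realType).
Variable m : {measure set T -> \bar R}.

Lemma L2norm_sqr (f : T -> R) :
  (L2norm m f ^+ 2 = \int[m]_x (f x ^+ 2)%:E)%E.
Proof.
rewrite /L2norm unlock poweR12_sqrt; last first.
  by apply: integral_ge0 => x _; exact: poweR_ge0.
rewrite sqr_sqrte; last by apply: integral_ge0 => x _; exact: poweR_ge0.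
apply: eq_integral => x _ /=.
by rewrite powR_mulrn// real_normK// num_real.
Qed.

Lemma Lfun2P (f : T -> R) : f \in Lfun m 2%:E <->
  measurable_fun setT f /\ (\int[m]_x (f x ^+ 2)%:E < +oo)%E.
Proof.
rewrite -L2norm_sqr; split.
  move=> /andP[]; rewrite !inE/= => mf ff; split => //.
  by rewrite /L2norm lte_mul_pinfty ?Lnorm_ge0// ge0_fin_numE ?Lnorm_ge0.
move=> [mf ff]; apply/andP; split; rewrite inE//=.
rewrite /finite_norm ltey; apply/eqP => E.
by move: ff; rewrite /L2norm E expe2 mulyy ltxx.
Qed.

Lemma Lfun2_meas (f : T -> R) : f \in Lfun m 2%:E -> measurable_fun setT f.
Proof. by move=> /Lfun2P[]. Qed.

End L2_generalities.

Section vectors.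
Context (R : realType) (n : nat).
Implicit Types u v : 'rV[R]_n.

Lemma dot_ge0 u : 0 <= dot u u.
Proof. by apply: sumr_ge0 => i _; rewrite -expr2 sqr_ge0. Qed.

Lemma enorm_sqr u : enorm u ^+ 2 = dot u u.
Proof. by rewrite /enorm sqr_sqrtr// dot_ge0. Qed.

Lemma enorm_ge0 u : 0 <= enorm u.
Proof. exact: sqrtr_ge0. Qed.

Lemma sqr_coor_le u i : u 0 i ^+ 2 <= dot u u.
Proof.
rewrite /dot (bigD1 i)//= -expr2 lerDl.
by apply: sumr_ge0 => j _; rewrite -expr2 sqr_ge0.
Qed.

Lemma coor_le_enorm u i : `|u 0 i| <= enorm u.
Proof.
rewrite -(ler_pXn2r (ltn0Sn 1)) ?nnegrE ?enorm_ge0//.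
by rewrite enorm_sqr real_normK ?num_real// sqr_coor_le.
Qed.

Lemma dot_addl u v w : dot (u + v) w = dot u w + dot v w.
Proof. by rewrite /dot -big_split; apply: eq_bigr => i _; rewrite mxE mulrDl. Qed.

Lemma dot_scalel a u w : dot (a *: u) w = a * dot u w.
Proof. by rewrite /dot mulr_sumr; apply: eq_bigr => i _; rewrite mxE mulrA. Qed.

Lemma dotC u v : dot u v = dot v u.
Proof. by apply: eq_bigr => i _; rewrite mulrC. Qed.

Lemma dot_addr u v w : dot w (u + v) = dot w u + dot w v.
Proof. by rewrite !(dotC w) dot_addl. Qed.

Lemma dot_scaler a u w : dot w (a *: u) = a * dot w u.
Proof. by rewrite !(dotC w) dot_scalel. Qed.

(** Expansion of the square of [a *: u - s *: v] for [s = 1] and [s = -1], treated together through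
    [s ^+ 2 = 1]. *)
Lemma dot_young a u v : 0 < a ->
  `|dot u v| <= (a / 2) * dot u u + (2 * a)^-1 * dot v v.
Proof.
move=> a0; have H (s : R) : `|s| = 1 -> 0 <= a / 2 * dot u u + (2 * a)^-1 * dot v v - s * dot u v.
  move=> s1; have : 0 <= dot (a *: u - s *: v) (a *: u - s *: v) by exact: dot_ge0.
  rewrite -scaleNr dot_addl !dot_addr !dot_scalel !dot_scaler (dotC v u) => E.
  have s2 : s ^+ 2 = 1 by rewrite -real_normK ?num_real// s1 expr1n.
  have -> : a / 2 * dot u u + (2 * a)^-1 * dot v v - s * dot u v =
     (2 * a)^-1 * (a * (a * dot u u) + a * (- s * dot u v) +
      (- s * (a * dot u v) + s ^+ 2 * dot v v)).
    by rewrite s2; field; rewrite gt_eqF.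
  apply: mulr_ge0; first by rewrite invr_ge0 mulr_ge0// ltW.
  by apply: le_trans E _; rewrite le_eqVlt; apply/orP; left; apply/eqP; ring.
have H1 := H 1 (normr1 _); have H2 := H (-1).
rewrite normrN normr1 in H2; have {}H2 := H2 erefl.
by rewrite ler_norml; apply/andP; split; lra.
Qed.

(** The square of [dot v v *: u - dot u v *: v] is [dot v v] times the difference of the two
    sides. *)
Lemma dot_cauchy u v : dot u v ^+ 2 <= dot u u * dot v v.
Proof.
have [/eqP v0|v0] := boolP (dot v v == 0).
  have := @dot_young; rewrite v0 mulr0.
  have vE : v = 0.
    apply/rowP => i; rewrite mxE; apply/eqP; rewrite -sqrf_eq0 eq_le sqr_ge0 andbT.
    by rewrite -v0 sqr_coor_le.
  move=> _; rewrite vE (_ : dot u 0 = 0) ?expr0n//=.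
  by rewrite /dot big1// => i _; rewrite mxE mulr0.
have vp : 0 < dot v v by rewrite lt_def v0 dot_ge0.
have : 0 <= dot (dot v v *: u - dot u v *: v) (dot v v *: u - dot u v *: v) by exact: dot_ge0.
rewrite -scaleNr dot_addl !dot_addr !dot_scalel !dot_scaler (dotC v u) => E.
rewrite -subr_ge0 -(pmulr_rge0 _ vp); apply: le_trans E _.
by rewrite le_eqVlt; apply/orP; left; apply/eqP; ring.
Qed.

End vectors.

Section L2_vector.
Context d (T : measurableType d) (R : realType) (n : nat).
Variable m : {measure set T -> \bar R}.

Lemma L2vnorm_sqr (G : T -> 'rV[R]_n) :
  (L2vnorm m G ^+ 2 = \int[m]_x (dot (G x) (G x))%:E)%E.
Proof. by rewrite /L2vnorm L2norm_sqr; under eq_integral do rewrite enorm_sqr. Qed.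

Lemma measurable_dot (G F : T -> 'rV[R]_n) :
  (forall i, measurable_fun setT (fun x => G x 0 i)) ->
  (forall i, measurable_fun setT (fun x => F x 0 i)) ->
  measurable_fun setT (fun x => dot (G x) (F x)).
Proof. by move=> mG mF; apply: measurable_sum => i; exact: measurable_funM. Qed.

Lemma L2vecP (G : T -> 'rV[R]_n) : L2vec m G <->
  (forall i, measurable_fun setT (fun x => G x 0 i)) /\
  (\int[m]_x (dot (G x) (G x))%:E < +oo)%E.
Proof.
split => [H|[mG Gi] i]; last first.
  apply/Lfun2P; split => //; apply: le_lt_trans Gi.
  apply: le_integral_no_meas => x _; rewrite lee_fin ?sqr_ge0//.
  exact: sqr_coor_le.
have mG i : measurable_fun setT (fun x => G x 0 i) by have /Lfun2P[] := H i.
split => //; rewrite /dot; under eq_integral do rewrite -sumEFin.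
rewrite ge0_integral_sum//.
- apply: lte_sum_pinfty => i _; have /Lfun2P[_] := H i.
  by under eq_integral do rewrite expr2.
- by move=> i; apply/measurable_EFinP; apply: measurable_funM.
- by move=> i x _; rewrite lee_fin -expr2 sqr_ge0.
Qed.

End L2_vector.

Lemma measurable_row d (T : measurableType d) (R : realType) n
    (G : T -> 'rV[R]_n) (i : 'I_n) :
  measurable_fun setT G -> measurable_fun setT (fun x => G x 0 i).
Proof. exact: (measurableT_comp (@measurable_coor R n i)). Qed.

(** * Time windows, translation in time and the uniform law *)

Section strip.
Context d (T : measurableType d) (R : realType).
Variable m : {sigma_finite_measure set T -> \bar R}.
Local Notation leb := (@lebesgue_measure R).
Local Notation lebm := (leb \x m)%E.

Lemma measurable_strip (A : set R) : measurable A ->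
  measurable (A `*` [set: T] : set (measurableTypeR R * T)).
Proof. by move=> mA; exact: measurableX. Qed.

Lemma ge0_integral_strip (A : set R) (f : R * T -> \bar R) :
  measurable A -> measurable_fun setT f -> (forall p, (0 <= f p)%E) ->
  (\int[lebm]_(p in A `*` setT) f p =
   \int[leb]_(s in A) \int[m]_z f (s, z))%E.
Proof.
move=> mA mf f0; rewrite integral_mkcond.
rewrite (@fubini_tonelli1 _ _ (measurableTypeR R) T R leb m).
- rewrite [RHS]integral_mkcond; apply: eq_integral => s _.
  rewrite /fubini_F /patch; case: ifPn => sA.
    by apply: eq_integral => z _; rewrite ifT// inE/=; split => //; exact/set_mem.
  rewrite integral0_eq// => z _; rewrite ifF//.
  apply/negbTE; apply: contra sA => /set_mem[/= As _]; exact/mem_set.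
- apply/(measurable_restrictT f (measurable_strip mA)).
  exact: measurable_funS mf.
- by move=> p; rewrite /patch; case: ifPn.
Qed.

(** Lebesgue measure is characterised by its values on half-open intervals, which the translation
    preserves. *)
Lemma lebesgue_shift (t : R) (A : set R) : measurable A ->
  pushforward leb (fun s : R => s + t : measurableTypeR R) A = leb A.
Proof.
move=> mA; apply/esym/lebesgue_measure_unique => //=.
  exact: measurable_funD.
move=> _ _ [[a b]] _ <-; rewrite /pushforward/=.
have -> : (fun s : R => s + t) @^-1` `]a, b]%classic = `]a - t, b - t]%classic.
  by apply/seteqP; split => x /=; rewrite !in_itv/= ltrBlDr lerBrDr.
by rewrite !lebesgue_measure_itv/= !lte_fin ltrD2r; case: ifPn => // _;
  rewrite -!EFinD; congr EFin; ring.
Qed.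

Lemma ge0_integral_shift (t a b : R) (f : R -> \bar R) :
  measurable_fun setT f -> (forall s, (0 <= f s)%E) ->
  (\int[leb]_(s in `[a, b]) f (s + t)%R = \int[leb]_(s in `[(a + t)%R, (b + t)%R]) f s)%E.
Proof.
move=> mf f0; pose sh s : measurableTypeR R := s + t.
have msh : measurable_fun [set: R] sh by exact: measurable_funD.
transitivity (\int[pushforward leb sh]_(s in `[(a + t)%R, (b + t)%R]) f s)%E; last first.
  by apply: eq_measure_integral => A mA _; exact: lebesgue_shift.
rewrite ge0_integral_pushforward//; last exact: measurable_funS mf.
congr (integral _ _ _); apply/seteqP; split => x /=; rewrite !in_itv/= /sh; lra.
Qed.

Variables (t tau : R) (tau0 : 0 < tau).

(** Bridge between the two settings: the inequalities of Lions and of averaging use the uniform law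
    on [[0, tau]], the energy uses Lebesgue measure on [[t, t + tau]]. *)
Lemma ge0_integral_uniform_prod (f : R * T -> \bar R) :
  measurable_fun setT f -> (forall p, (0 <= f p)%E) ->
  (\int[(uniform_prob tau0 \x m)%E]_p f ((p.1 + t)%R, p.2) =
   (tau^-1)%:E * \int[lebm]_(p in `[t, (t + tau)%R]%classic `*` setT) f p)%E.
Proof.
move=> mf f0.
have mft : measurable_fun setT (fun p : R * T => f ((p.1 + t)%R, p.2)).
  apply: (measurableT_comp mf); apply: measurable_fun_pair => //.
  by apply: measurable_funD => //; exact: measurable_fst.
rewrite (@fubini_tonelli1 _ _ (measurableTypeR R) T R (uniform_prob tau0) m)//.
rewrite integral_uniform; [|exact: (measurable_fun_fubini_tonelli_F (T1 := measurableTypeR R))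
  |by move=> x; apply: integral_ge0].
rewrite subr0 ge0_integral_strip//; congr (_ * _)%E.
have -> : `[t, (t + tau)]%classic = `[0 + t, tau + t]%classic.
  by rewrite add0r addrC.
rewrite -ge0_integral_shift//.
  exact: (measurable_fun_fubini_tonelli_F (T1 := measurableTypeR R)).
by move=> s; apply: integral_ge0.
Qed.

Lemma integral_uniform_prod (f : R * T -> R) : measurable_fun setT f ->
  lebm.-integrable (`[t, t + tau]%classic `*` setT) (EFin \o f) ->
  \int[(uniform_prob tau0 \x m)%E]_p f (p.1 + t, p.2) =
  tau^-1 * \int[lebm]_(p in `[t, t + tau]%classic `*` setT) f p.
Proof.
move=> mf fi; rewrite /Rintegral.
have mS : measurable (`[t, t + tau]%classic `*` setT : set (measurableTypeR R * T)).
  exact: measurable_strip.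
have mf' : measurable_fun setT (EFin \o f) by exact/measurable_EFinP.
rewrite (@integral_transfer _ (measurableTypeR R * T)%type R _
  (measurableTypeR R * T)%type (uniform_prob tau0 \x m)%E lebm
  (`[t, t + tau]%classic `*` setT) setT (tau^-1) (fun p => (p.1 + t, p.2))
  (EFin \o f) mf' ge0_integral_uniform_prod fi mS).
by rewrite fineM//; exact: (integrable_fin_num mS fi).
Qed.

Lemma ae_uniform_prod (Q : R * T -> Prop) : 0 <= t ->
  {ae lebm, forall p, 0 <= p.1 -> Q p} ->
  {ae (uniform_prob tau0 \x m)%E, forall p, Q (p.1 + t, p.2)}.
Proof.
move=> t0 [N [mN N0 QN]].
pose sh (p : R * T) := (p.1 + t, p.2).
have msh : measurable_fun setT sh.
  apply: measurable_fun_pair => //.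
  by apply: measurable_funD => //; exact: measurable_fst.
have mNt : measurable (sh @^-1` N) by rewrite -[X in measurable X]setTI; exact: msh.
have m0 : (uniform_prob tau0 \x m)%E (sh @^-1` N) = 0%E.
  have mN1 : measurable_fun setT (fun p : R * T => (\1_N p : R)%:E).
    by apply/measurable_EFinP; exact: measurable_indic.
  have N1 (p : R * T) : (0 <= (\1_N p : R)%:E)%E by rewrite lee_fin.
  have := ge0_integral_uniform_prod mN1 N1.
  rewrite (_ : integral (uniform_prob tau0 \x m)%E _ _ =
    integral (uniform_prob tau0 \x m)%E setT (fun p => (\1_(sh @^-1` N) p)%:E))//.
  rewrite integral_indic// integral_indic//; last exact: measurable_strip.
  rewrite setIT => ->.
  rewrite [X in (_ * X)%E](_ : _ = 0%E) ?mule0//; apply/eqP; rewrite eq_le measure_ge0 andbT.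
  rewrite -N0; apply: le_measure; rewrite ?inE//.
  by apply: measurableI => //; exact: measurable_strip.
(* Outside [[0, tau]] the translated time may be negative, where [Q] is not known; these times are
   put into the exceptional set, and the uniform law does not charge them. *)
pose S : set (R * T) := (~` `[0, tau]%classic) `*` setT.
have mS : measurable (S : set (measurableTypeR R * T)) by apply: measurable_strip; exact: measurableC.
have u0 : uniform_prob tau0 (~` `[0, tau]%classic) = 0%E.
  rewrite /uniform_prob integral_uniform_pdf (_ : _ `&` _ = set0) ?integral_set0//.
  by rewrite setIC setICr.
have mS0 : (uniform_prob tau0 \x m)%E S = 0%E.
  rewrite /S (@product_measure1E _ _ (measurableTypeR R) T R (uniform_prob tau0) m)//.
    by rewrite [X in (X * _)%E]u0 mul0e.
  exact: measurableC.
exists (sh @^-1` N `|` S); split.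
- exact: measurableU.
- apply/eqP; rewrite eq_le measure_ge0 andbT.
  rewrite (le_trans (measureU2 _ _ _))//.
  by rewrite [X in (X + _)%E]m0 [X in (_ + X)%E]mS0 adde0.
- move=> p /= nQ; have [p0|p0] := boolP (p.1 \in `[0, tau]); [left|right].
    apply: QN => /= H; apply: nQ; apply: H.
    by move: p0; rewrite in_itv/= => /andP[p0 _]; exact: addr_ge0.
  by split => //=; apply/negP.
Qed.

End strip.


(** * Iterated integrals over time, position and velocity *)

Section iterated.
Context d1 d2 d3 (T1 : measurableType d1) (T2 : measurableType d2)
  (T3 : measurableType d3) (R : realType).
Variables (m1 : {sigma_finite_measure set T1 -> \bar R})
  (m2 : probability T2 R) (m3 : probability T3 R).

Lemma measurable_prodA :
  measurable_fun setT (fun q : (T1 * T2) * T3 => (q.1.1, (q.1.2, q.2))).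
Proof.
apply: measurable_fun_pair; first exact: measurableT_comp measurable_fst measurable_fst.
apply: measurable_fun_pair; last exact: measurable_snd.
exact: measurableT_comp measurable_snd measurable_fst.
Qed.

(** Tonelli used on both sides. It isolates velocity as the innermost variable, so that averages and
    norms in velocity alone appear as inner integrals. *)
Lemma ge0_integral_prodA (f : T1 * (T2 * T3) -> \bar R) :
  measurable_fun setT f -> (forall p, (0 <= f p)%E) ->
  (\int[m1 \x (m2 \x m3)]_p f p =
   \int[m1 \x m2]_p \int[m3]_v f (p.1, (p.2, v)))%E.
Proof.
move=> mf f0.
pose m23 : probability (T2 * T3)%type R := (m2 \x m3)%E.
rewrite [LHS](@fubini_tonelli1 _ _ T1 (T2 * T3)%type R m1 m23 f)//.
pose g (q : (T1 * T2) * T3) := f (q.1.1, (q.1.2, q.2)).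
have mg : measurable_fun setT g by apply: (measurableT_comp mf); exact: measurable_prodA.
have mG : measurable_fun setT (fubini_F m3 g).
  apply: (@measurable_fun_fubini_tonelli_F _ _ (T1 * T2)%type T3 R m3 g) => //.
  by move=> x; exact: f0.
rewrite (@fubini_tonelli1 _ _ T1 T2 R m1 m2 (fubini_F m3 g))//; last first.
  by move=> x; apply: integral_ge0 => *; exact: f0.
apply: eq_integral => x _; rewrite /fubini_F.
rewrite (@fubini_tonelli1 _ _ T2 T3 R m2 m3 (fun z => f (x, z)))//.
exact: (measurableT_comp mf (measurable_pair1 x)).
Qed.

End iterated.

Section partial_integral.
Context d1 d2 (T1 : measurableType d1) (T2 : measurableType d2) (R : realType).
Variable m2 : {sigma_finite_measure set T2 -> \bar R}.

(** The integral is by definition the difference of the integrals of the positive and negative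
    parts, and each of these is measurable by Tonelli; no integrability enters. *)
Lemma measurable_partial_integral (f : T1 * T2 -> \bar R) :
  measurable_fun setT f -> measurable_fun setT (fun x => \int[m2]_y f (x, y))%E.
Proof.
move=> mf.
rewrite (_ : (fun x => _) = fun x => (fubini_F m2 f^\+ x - fubini_F m2 f^\- x)%E); last first.
  apply/funext => x; rewrite integralE; congr (_ - _)%E.
    by apply: eq_integral => y _; rewrite !funeposE.
  by apply: eq_integral => y _; rewrite !funenegE.
apply: emeasurable_funB.
  apply: (@measurable_fun_fubini_tonelli_F _ _ T1 T2 R m2 f^\+%E) => //.
  exact: measurable_funepos.
apply: (@measurable_fun_fubini_tonelli_F _ _ T1 T2 R m2 f^\-%E) => //.
exact: measurable_funeneg.
Qed.

Lemma measurable_partial_Rintegral (f : T1 * T2 -> R) :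
  measurable_fun setT f -> measurable_fun setT (fun x => \int[m2]_y f (x, y)).
Proof.
move=> mf; apply: (measurableT_comp (@fine_measurable R setT measurableT)) => //.
by apply: (@measurable_partial_integral (EFin \o f)); exact/measurable_EFinP.
Qed.

End partial_integral.

(** * Measurability of continuous functions *)

Section discretization.
Context d (T : measurableType d) (R : realType).

(* On 'rV[R]_d the sigma-algebra is generated by the coordinates and not by the
   topology, so that continuous functions are reached as limits of functions of
   countably many values. *)
Lemma measurable_fun_discretize (C : countType) (c : nat -> T -> C)
    (e : nat -> C -> T) (f : T -> R) :
  (forall n k, measurable (c n @^-1` [set k])) ->
  (forall x, f (e n (c n x)) @[n --> \oo] --> f x) -> measurable_fun setT f.
Proof.
move=> mc cf; apply: (@measurable_fun_cvg _ _ _ _ (fun n x => f (e n (c n x)))) => //.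
move=> n _ Y mY; rewrite setTI.
rewrite (_ : _ @^-1` Y = \bigcup_i (if unpickle i is Some k then
    if f (e n k) \in Y then c n @^-1` [set k] else set0 else set0)); last first.
  apply/seteqP; split=> [x /= Yx|x [i _]].
    by exists (pickle (c n x)) => //; rewrite pickleK mem_set.
  by case: unpickle => // k; case: ifPn => // /set_mem Yk /= ->.
apply: bigcupT_measurable => i; case: unpickle => // k.
by case: ifPn.
Qed.

End discretization.

Section continuous_measurable.
Context (R : realType).

(** Rounding down to the mesh of step [1 / (n + 1)], with the integer index kept apart from the
    point [ungrid] so that the values are countably many. *)
Definition grid (n : nat) (x : R) : int := Num.floor (x * n.+1%:R).
Definition ungrid (n : nat) (k : int) : R := k%:~R / n.+1%:R.

Lemma measurable_grid n k : measurable (grid n @^-1` [set k]).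
Proof.
rewrite (_ : _ @^-1` _ = `[k%:~R / n.+1%:R, (k + 1)%:~R / n.+1%:R[%classic).
  exact: measurable_itv.
apply/seteqP; split => x /=; rewrite in_itv/= ler_pdivrMr// ltr_pdivlMr//.
  by move=> <-; exact: floor_itv.
by move=> xk; exact: floor_def.
Qed.

Lemma ball_ungrid n (x : R) e : n.+1%:R^-1 < e -> ball x e (ungrid n (grid n x)).
Proof.
move=> ne; rewrite /ball/= /ungrid /grid.
have n0 : 0 < n.+1%:R :> R by [].
have /andP[h1 h2] := floor_itv (x * n.+1%:R).
have -> : x - (Num.floor (x * n.+1%:R))%:~R / n.+1%:R =
    (x * n.+1%:R - (Num.floor (x * n.+1%:R))%:~R) / n.+1%:R.
  by rewrite mulrBl mulfK// gt_eqF.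
rewrite ger0_norm; last by rewrite divr_ge0// subr_ge0.
apply: lt_trans ne; rewrite ltr_pdivrMr// mulVf ?gt_eqF//.
by rewrite ltrBlDr addrC -intrD1.
Qed.

Variable d : nat.
Local Notation E := 'rV[R]_d.

Let c n (p : R * (E * E)) : int * ('rV[int]_d * 'rV[int]_d) :=
  (grid n p.1, (map_mx (grid n) p.2.1, map_mx (grid n) p.2.2)).
Let e n (k : int * ('rV[int]_d * 'rV[int]_d)) : R * (E * E) :=
  (ungrid n k.1, (map_mx (ungrid n) k.2.1, map_mx (ungrid n) k.2.2)).

Let measurable_rgrid n (k : 'rV[int]_d) :
  measurable ((fun x : E => map_mx (grid n) x) @^-1` [set k]).
Proof.
rewrite (_ : _ @^-1` _ = \bigcap_(i in [set: 'I_d])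
    ((fun x : E => x 0 i) @^-1` (grid n @^-1` [set k 0 i]))); last first.
  apply/seteqP; split=> x /=; first by move=> <- i _ /=; rewrite mxE.
  by move=> H; apply/rowP => i; rewrite mxE; exact: H.
apply: fin_bigcap_measurable; first exact: finite_finset.
move=> i _; rewrite -[X in measurable X]setTI.
by apply: measurable_coor => //; exact: measurable_grid.
Qed.

Lemma continuous_measurable_txv (f : R * (E * E) -> R) :
  continuous f -> measurable_fun setT f.
Proof.
move=> cf; apply: (measurable_fun_discretize (c := c) (e := e)).
  move=> n [k [k1 k2]].
  rewrite (_ : c n @^-1` _ = (grid n @^-1` [set k]) `*`
     (((fun x : E => map_mx (grid n) x) @^-1` [set k1]) `*`
      ((fun x : E => map_mx (grid n) x) @^-1` [set k2]))); last first.
    by apply/seteqP; split=> -[s [x v]] /=; rewrite /c/= => -[] <- [<- <-].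
  apply: measurableX; first exact: measurable_grid.
  by apply: measurableX; exact: measurable_rgrid.
move=> x; have : (fun n => e n (c n x)) @ \oo --> x; last by move=> H; exact: (cvg_comp _ _ H (cf x)).
apply/(@cvg_ballP R (R * (E * E))%type) => eps eps0; near=> n.
have nn : n.+1%:R^-1 < eps :> R by near: n; exact: (near_infty_natSinv_lt (PosNum eps0)).
split; first exact: ball_ungrid.
by split; (split => // i j; rewrite !mxE; exact: ball_ungrid).
Unshelve. all: by end_near. Qed.

(** The function is read as one of time, position and velocity that depends on position alone. *)
Lemma continuous_measurable_row (f : E -> R) : continuous f -> measurable_fun setT f.
Proof.
move=> cf.
have mf : measurable_fun setT (fun p : R * (E * E) => f p.2.1).
  apply: continuous_measurable_txv => -[s [x v]].
  have c1 : {for (s, (x, v)), continuous (fun p : R * (E * E) => p.2)} by exact: cvg_snd.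
  have c2 : {for (x, v), continuous (fun p : E * E => p.1)} by exact: cvg_fst.
  exact: (cvg_comp _ _ c1 (cvg_comp _ _ c2 (cf x))).
have mi : measurable_fun setT (fun x : E => ((0, (x, 0)) : R * (E * E))).
  by apply: measurable_fun_pair => //; exact: measurable_fun_pair.
exact: (measurableT_comp mf mi).
Qed.

End continuous_measurable.

(** * Directional derivatives and closure properties of smooth functions *)

Section directional_derivative.
Context (R : realType) (W : normedModType R).
Implicit Types (f g : W -> R) (x w : W).

(** Along the line through [x] in direction [w] the difference quotients are the same, which reduces
    the chain rule for directional derivatives to the one-variable rule. *)
Lemma is_derive_line f x w (l : R) :
  is_derive x w f l <-> is_derive (0 : R) (1 : R) (fun h : R => f (h *: w + x)) l.
Proof.
set g := fun h : R => f (h *: w + x).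
have E : 'D_1 g (0 : R) = 'D_w f x.
  have E0 : (fun h : R => h^-1 *: ((g \o shift 0) (h *: (1 : R)) - g 0)) =
      (fun h : R => h^-1 *: ((f \o shift x) (h *: w) - f x)).
    apply/funext => h; congr (_ *: (_ - _)); rewrite /g/=; last by rewrite scale0r add0r.
    by rewrite /GRing.scale/= mulr1 addr0.
  by rewrite /derive E0.
split=> -[d <-].
  by rewrite -E; exact: (derivableP ((derivable1P f x w).1 d)).
by rewrite E; exact: (derivableP ((derivable1P f x w).2 d)).
Qed.

Lemma is_derive_comp1 (phi : R -> R) f x w (a b : R) :
  is_derive (f x) (1 : R) phi b -> is_derive x w f a ->
  is_derive x w (phi \o f) (b * a).
Proof.
move=> dphi /is_derive_line df; apply/is_derive_line.
apply: (@is_derive1_comp R phi (fun h : R => f (h *: w + x))) => //.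
by rewrite scale0r add0r.
Qed.

Lemma is_deriveM1 f g x w (a b : R) : is_derive x w f a -> is_derive x w g b ->
  is_derive x w (fun y => f y * g y) (a * g x + f x * b).
Proof.
move=> df dg; have := is_deriveM df dg.
by rewrite (_ : _ + _ = a * g x + f x * b)// addrC /GRing.scale/= [g x * a]mulrC.
Qed.

Lemma is_deriveD1 f g x w (a b : R) : is_derive x w f a -> is_derive x w g b ->
  is_derive x w (fun y => f y + g y) (a + b).
Proof. by move=> df dg; exact: is_deriveD. Qed.

End directional_derivative.

Lemma is_derive_dir1 (R : realType) (phi : R -> R) (x w b : R) :
  is_derive x (1 : R) phi b -> is_derive x w phi (b * w).
Proof.
move=> dphi. apply/(@is_derive_line R _ phi x w (b * w)).
apply: (@is_derive1_comp R phi (fun h : R => h *: w + x)).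
  by rewrite scale0r add0r.
rewrite -[X in is_derive _ _ _ X](mul1r w) -[X in is_derive _ _ _ X]addr0.
apply: (@is_deriveD1 _ _ (fun h : R => h * w) (cst x)).
rewrite -[X in is_derive _ _ _ X]addr0 -[X in _ + X](mulr0 (0 : R)).
exact: (@is_deriveM1 _ _ id (cst w)).
Qed.

Section smooth_closure.
Context (R : realType).

Section smooth_class.
Context (W : normedModType R).
Implicit Types (f g : W -> R).

(** By induction on the list of directions every iterated derivative stays in [C]. Proving
    smoothness thus amounts to exhibiting a class that is stable under differentiation. *)
Lemma smooth_coind (C : (W -> R) -> Prop) :
  (forall f, C f -> [/\ continuous f, forall x w, derivable f x w &
    forall w, C (fun x => 'D_w f x)]) ->
  forall f, C f -> smooth f.
Proof.
move=> H f Cf s /=; suff Cs : C (foldr (fun w g => 'D_w g) f s).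
  by have [] := H _ Cs.
by elim: s => //= w s /H[_ _]; exact.
Qed.

Lemma smooth_continuous f : smooth f -> continuous f.
Proof. by move=> /(_ [::])[]. Qed.

Lemma smooth_derivable f x w : smooth f -> derivable f x w.
Proof. by move=> /(_ [::])[_]; exact. Qed.

Lemma smooth_is_derive f x w : smooth f -> is_derive x w f ('D_w f x).
Proof. by move=> sf; apply: derivableP; exact: smooth_derivable. Qed.

Lemma smooth_derive f w : smooth f -> smooth (fun x => 'D_w f x).
Proof. by move=> sf s; have := sf (rcons s w); rewrite foldr_rcons. Qed.

Lemma derive_fun f w (df : W -> R) :
  (forall x, is_derive x w f (df x)) -> (fun x => 'D_w f x) = df.
Proof. by move=> H; apply/funext => x; rewrite derive_val. Qed.

Lemma smooth_cst (a : R) : smooth (fun _ : W => a).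
Proof.
apply: (@smooth_coind (fun f => exists a, f = cst a)); last by exists a.
move=> _ [b ->]; split => [||w]; [exact: cst_continuous|by []|].
exists 0; apply: derive_fun => x; exact: is_derive_cst.
Qed.

Lemma smooth_add f g : smooth f -> smooth g -> smooth (fun x => f x + g x).
Proof.
move=> sf sg; apply: (@smooth_coind (fun k => exists f g,
  [/\ smooth f, smooth g & k = fun x => f x + g x])); last by exists f, g.
move=> _ [h [k [sh sk ->]]]; split => [x|x w|w].
- by apply: continuousD; exact: smooth_continuous.
- by apply: derivableD; exact: smooth_derivable.
- exists (fun x => 'D_w h x), (fun x => 'D_w k x); split; try exact: smooth_derive.
  by apply: derive_fun => x; apply: is_deriveD1; exact: smooth_is_derive.
Qed.

(** Leibniz's rule turns one product into a sum of two, so the stable class must contain sums. *)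
Inductive sum_of_products : (W -> R) -> Prop :=
| prod_term f g of smooth f & smooth g : sum_of_products (fun x => f x * g x)
| prod_sum f g of sum_of_products f & sum_of_products g :
    sum_of_products (fun x => f x + g x).

Lemma smooth_mul f g : smooth f -> smooth g -> smooth (fun x => f x * g x).
Proof.
move=> sf sg; apply: (smooth_coind (C := sum_of_products)); last exact: prod_term.
move=> k; elim=> {f g sf sg} [f g sf sg|f g _ [cf df Cf] _ [cg dg Cg]]; split => [x|x w|w].
- by apply: continuousM; exact: smooth_continuous.
- by apply: derivableM; exact: smooth_derivable.
- have D x : is_derive x w (fun x => f x * g x) ('D_w f x * g x + f x * 'D_w g x).
    by apply: is_deriveM1; exact: smooth_is_derive.
  rewrite (derive_fun D); apply: prod_sum; apply: prod_term.
  + exact: (smooth_derive _ sf).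
  + exact: sg.
  + exact: sf.
  + exact: (smooth_derive _ sg).
- by apply: continuousD; [exact: cf|exact: cg].
- by apply: derivableD; [exact: df|exact: dg].
- have D x : is_derive x w (fun x => f x + g x) ('D_w f x + 'D_w g x).
    by apply: is_deriveD1; apply: derivableP; [exact: df|exact: dg].
  by rewrite (derive_fun D); exact: prod_sum.
Qed.

Lemma smooth_sum (I : Type) (s : seq I) (F : I -> W -> R) :
  (forall i, smooth (F i)) -> smooth (fun x => \sum_(i <- s) F i x).
Proof.
move=> sF; elim: s => [|i s IH].
  rewrite (_ : (fun x => _) = fun=> 0); first exact: smooth_cst.
  by apply/funext => x; rewrite big_nil.
rewrite (_ : (fun x => _) = fun x => F i x + \sum_(i <- s) F i x).
  exact: (smooth_add (sF i) IH).
by apply/funext => x; rewrite big_cons.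
Qed.

End smooth_class.

Section smooth_composition.
Context (W : normedModType R).
Implicit Types (f g : W -> R).

(** The derivative of [phi (u x) * g x] is a sum of two terms of the same form, one with the outer
    function [phi'] and one with [phi]; the factor [g] collects the derivatives of [u]. *)
Inductive sum_of_compositions (u : W -> R) : (W -> R) -> Prop :=
| comp_term (phi : R -> R) g of smooth phi & smooth g :
    sum_of_compositions u (fun x => phi (u x) * g x)
| comp_sum f g of sum_of_compositions u f & sum_of_compositions u g :
    sum_of_compositions u (fun x => f x + g x).

Lemma smooth_comp (phi : R -> R) (u : W -> R) : smooth phi -> smooth u ->
  smooth (fun x => phi (u x)).
Proof.
move=> sphi su; apply: (smooth_coind (C := sum_of_compositions u)); last first.
  have -> : (fun x => phi (u x)) = (fun x => phi (u x) * 1) by apply/funext => x; rewrite mulr1.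
  exact: (@comp_term u phi (fun=> 1) sphi (@smooth_cst W 1)).
move=> k; elim=> {phi sphi} [phi g sphi sg|f g _ [cf df Cf] _ [cg dg Cg]].
  have D x w : is_derive x w (fun x => phi (u x) * g x)
      (('D_1 phi (u x) * 'D_w u x) * g x + phi (u x) * 'D_w g x).
    apply: is_deriveM1; last exact: smooth_is_derive.
    apply: (is_derive_comp1 (phi := phi) (f := u)).
      exact: (@smooth_is_derive _ phi (u x) 1 sphi).
    exact: (@smooth_is_derive _ u x w su).
  split => [x|x w|w].
  - apply: continuousM; last exact: smooth_continuous.
    by apply: continuous_comp; exact: smooth_continuous.
  - by have [] := D x w.
  - rewrite (derive_fun (D^~ w)) (_ : (fun x => _) = fun x =>
        'D_1 phi (u x) * ('D_w u x * g x) + phi (u x) * 'D_w g x); last first.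
      by apply/funext => x; rewrite mulrA.
    apply: comp_sum.
      apply: (@comp_term u (fun y : R => 'D_1 phi y) (fun x => 'D_w u x * g x)).
        exact: (@smooth_derive R phi 1 sphi).
      apply: (@smooth_mul W (fun x => 'D_w u x) g _ sg).
      exact: (@smooth_derive W u w su).
    apply: (@comp_term u phi (fun x => 'D_w g x) sphi).
    exact: (@smooth_derive W g w sg).
split => [x|x w|w].
- by apply: continuousD; [exact: cf|exact: cg].
- by apply: derivableD; [exact: df|exact: dg].
- have D x : is_derive x w (fun x => f x + g x) ('D_w f x + 'D_w g x).
    by apply: is_deriveD1; apply: derivableP; [exact: df|exact: dg].
  by rewrite (derive_fun D); exact: comp_sum.
Qed.

End smooth_composition.

(** The identity assumed on [L] says that it is affine with [c = L 0]; this covers the projections,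
    with [c = 0], and the translations in time. The derivative along [w] is then the one along
    [L w - c]. *)
Lemma smooth_linear (W W' : normedModType R) (L : W -> W') (f : W' -> R) (c : W') :
  continuous L -> (forall (h : R) w x, L (h *: w + x) = h *: (L w - c) + L x) ->
  smooth f -> smooth (fun x => f (L x)).
Proof.
move=> cL LL sf; apply: (@smooth_coind _ (fun k => exists f,
  smooth f /\ k = fun x => f (L x))); last by exists f.
move=> _ [{sf} g [sg ->]].
have D x w : is_derive x w (fun x => g (L x)) ('D_(L w - c) g (L x)).
  apply/is_derive_line.
  have /is_derive_line := smooth_is_derive (L x) (L w - c) sg.
  by under eq_fun do rewrite -LL.
split => [x|x w|w].
- by apply: continuous_comp; [exact: cL|exact: smooth_continuous].
- by have [] := D x w.
- exists (fun y => 'D_(L w - c) g y); split; first exact: smooth_derive.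
  exact: derive_fun.
Qed.

End smooth_closure.

(** * Flat functions, the building blocks of the cutoffs *)

Section flat_functions.
Context (R : realType).
Implicit Types (p q : {poly R}) (x y : R).

Definition flat p x : R := if 0 < x then p.[x^-1] * expR (- x^-1) else 0.

Lemma flat_le0 p x : x <= 0 -> flat p x = 0.
Proof. by rewrite /flat ltNge => ->. Qed.

Lemma flat_gt0 p x : 0 < x -> flat p x = p.[x^-1] * expR (- x^-1).
Proof. by rewrite /flat => ->. Qed.

Lemma flatMX p x : flat p x = x * flat (p * 'X) x.
Proof.
have [x0|x0] := leP x 0; first by rewrite !flat_le0// mulr0.
by rewrite !flat_gt0// hornerM hornerX; field; rewrite gt_eqF.
Qed.

Lemma flatZ (a : R) p x : flat (a *: p) x = a * flat p x.
Proof.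
have [x0|x0] := leP x 0; first by rewrite !flat_le0// mulr0.
by rewrite !flat_gt0// hornerZ mulrA.
Qed.

Lemma exp_decay (k : nat) y : 0 <= y -> y ^+ k * expR (- y) <= k`!%:R.
Proof.
move=> y0; rewrite expRN ler_pdivrMr ?expR_gt0//; case: k => [|k].
  by rewrite expr0 fact0 mul1r -[X in X <= _](expR0 R) ler_expR.
have := expR_ge1Dxn k y0 => H.
rewrite mulrC -ler_pdivrMr ?ltr0n ?fact_gt0//; apply: le_trans H.
by rewrite lerDr.
Qed.

Lemma flat_bounded p : exists2 C : R, 0 <= C & forall x, `|flat p x| <= C.
Proof.
exists (\sum_(i < size p) `|p`_i| * i`!%:R).
  by apply: sumr_ge0 => i _; rewrite mulr_ge0.
move=> x; have [x0|x0] := leP x 0.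
  by rewrite flat_le0// normr0; apply: sumr_ge0 => i _; rewrite mulr_ge0.
rewrite flat_gt0// horner_coef mulr_suml; apply: (le_trans (ler_norm_sum _ _ _)).
apply: ler_sum => i _; rewrite -mulrA normrM ler_wpM2l//.
have y0 : 0 <= x^-1 by rewrite invr_ge0 ltW.
by rewrite ger0_norm ?exp_decay// mulr_ge0 ?exprn_ge0 ?expR_ge0.
Qed.

(** Two factors [x] are traded for two factors ['X] in the polynomial, and the remaining flat
    function is bounded. *)
Lemma flat_quadratic p : exists2 C : R, 0 <= C & forall x, `|flat p x| <= C * x ^+ 2.
Proof.
have [C C0 H] := flat_bounded (p * 'X * 'X); exists C => // x.
rewrite flatMX (flatMX (p * 'X)) mulrA -expr2 normrM mulrC.
by rewrite [X in _ * X]ger0_norm ?sqr_ge0// ler_wpM2r ?sqr_ge0.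
Qed.

Lemma is_derive_flat p x :
  is_derive x (1 : R) (flat p) (flat ((p - p^`()) * 'X * 'X) x).
Proof.
have [x0|x0|x0] := ltgtP x 0.
- rewrite flat_le0 ?ltW//; apply: (near_eq_is_derive (f := cst 0)) => //.
  near=> y; rewrite flat_le0// ltW//; near: y; exact: lt_nbhsl.
- apply: (near_eq_is_derive (f := fun y => p.[y^-1] * expR (- y^-1))).
    by near=> y; rewrite flat_gt0//; near: y; exact: lt_nbhsr.
  rewrite flat_gt0// !hornerM hornerX hornerD hornerN.
  have dV : is_derive x (1 : R) (fun y : R => y^-1) (- x ^- 2).
    have := @is_deriveV R id x 1 1; rewrite /GRing.scale/= mulr1; apply => //.
    by rewrite gt_eqF.
  have dp : is_derive x (1 : R) (fun y : R => p.[y^-1]) (p^`().[x^-1] * (- x ^- 2)).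
    exact: (@is_derive_comp1 R R (horner p) (fun y => y^-1)).
  have dN : is_derive x (1 : R) (fun y : R => - y^-1) (- - x ^- 2) by exact: is_deriveN.
  have de : is_derive x (1 : R) (fun y : R => expR (- y^-1)) (expR (- x^-1) * (- - x ^- 2)).
    exact: (@is_derive_comp1 R R expR (fun y => - y^-1)).
  have := is_deriveM1 dp de; rewrite (_ : _ + _ = (p.[x^-1] - (p^`()).[x^-1]) / x / x * expR (- x^-1))//.
  rewrite !opprK; field; by rewrite gt_eqF.
(* At the origin the difference quotient is at most [C * |h|] by the quadratic bound. *)
- rewrite x0 flat_le0//; have [C C0 HC] := flat_quadratic p.
  suff H : (fun h : R => h^-1 *: ((flat p \o shift 0) (h *: (1 : R)) - flat p 0)) @ (0 : R)^' --> (0 : R).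
    by apply: DeriveDef; [apply/cvg_ex; exists 0; exact: H|exact: cvg_lim H].
  apply/cvgr0Pnorm_lt => /= e e0.
  near=> h; rewrite /= addr0 (flat_le0 p (lexx 0)) subr0 normrM normfV /GRing.scale/= mulr1.
  have h0 : h != 0 by near: h; exact: nbhs_dnbhs_neq.
  have hp : 0 < `|h| by rewrite normr_gt0.
  rewrite mulrC ltr_pdivrMr//; apply: (le_lt_trans (HC h)).
  rewrite -real_normK ?num_real// expr2 mulrA ltr_pM2r//.
  apply: (@le_lt_trans _ _ ((C + 1) * `|h|)); first by rewrite ler_wpM2r// lerDl.
  rewrite mulrC -ltr_pdivlMr ?ltr_wpDl//.
  by near: h; apply: dnbhs0_lt; rewrite divr_gt0// ltr_wpDl.
Unshelve. all: by end_near. Qed.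

Lemma smooth_flat p : smooth (flat p).
Proof.
apply: (@smooth_coind R R (fun f => exists p, f = flat p)); last by exists p.
move=> _ [{}p ->]; have D x w := is_derive_dir1 w (is_derive_flat p x).
split => [x|x w|w].
- apply: differentiable_continuous; apply/derivable1_diffP.
  by have [] := is_derive_flat p x.
- by have [] := D x w.
- exists (w *: ((p - p^`()) * 'X * 'X)); rewrite (derive_fun (D^~ w)).
  by apply/funext => x; rewrite flatZ mulrC.
Qed.

(** At infinity [x^-1] tends to 0, so the exponential tends to 1 and the polynomial to its constant
    term: 1 for [flat 1], 0 for [flat 'X]. *)
Lemma flat_cvg p (u : nat -> R) : (forall n, 0 < u n) ->
  (u n)^-1 @[n --> \oo] --> (0 : R) -> flat p (u n) @[n --> \oo] --> p.[0].
Proof.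
move=> u0 ui; rewrite (_ : (fun n => _) = fun n => p.[(u n)^-1] * expR (- (u n)^-1)); last first.
  by apply/funext => n; rewrite flat_gt0.
have c0 : {for (0 : R), continuous (horner p)}.
  apply: differentiable_continuous; apply/derivable1_diffP.
  by have [] := is_derive_poly p (0 : R).
have e0 : expR (- (u n)^-1) @[n --> \oo] --> (1 : R).
  have := cvg_comp _ _ (cvgN ui) (@continuous_expR R _).
  by rewrite oppr0 expR0; exact.
by have := cvgM (cvg_comp _ _ ui c0) e0; rewrite mulr1; exact.
Qed.

Lemma flat1_ge0 x : 0 <= flat 1 x.
Proof. by rewrite /flat; case: ifP => //; rewrite hornerC mul1r expR_ge0. Qed.

Lemma flat1_le1 x : flat 1 x <= 1.
Proof.
rewrite /flat; case: ifP => // x0; rewrite hornerC mul1r -[X in _ <= X](expR0 R) ler_expR.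
by rewrite oppr_le0 invr_ge0 ltW.
Qed.

End flat_functions.

(** * Cutoffs in time *)

Section time_cutoff.
Context (R : realType).

Lemma smooth_functional (W : normedModType R) (l : W -> R) :
  continuous l -> (forall (h : R) w x, l (h *: w + x) = h * l w + l x) -> smooth l.
Proof.
move=> cl ll; apply: (@smooth_coind R W (fun k => k = l \/ exists a, k = cst a)); last by left.
have D x w : is_derive x w l (l w).
  apply/is_derive_line; rewrite (_ : (fun h : R => _) = fun h => h * l w + l x); last first.
    by apply/funext => h.
  have := is_deriveD1 (is_deriveM1 (is_derive_id (0 : R) (1 : R))
    (is_derive_cst (l w) (0 : R) (1 : R))) (is_derive_cst (l x) (0 : R) (1 : R)).
  by rewrite mul1r mul0r !addr0.
move=> _ [->|[a ->]]; split => [x|x w|w].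
- exact: cl.
- by have [] := D x w.
- right; exists (l w); exact: derive_fun.
- exact: cst_continuous.
- exact: derivable_cst.
- right; exists 0; apply: derive_fun => x; exact: is_derive_cst.
Qed.

Lemma smooth_affine (a b : R) : smooth (fun s : R => a * s + b).
Proof.
apply: smooth_add; last exact: smooth_cst.
apply: smooth_mul; first exact: smooth_cst.
by apply: smooth_functional => // x; exact: cvg_id.
Qed.

Lemma is_derive_affine (a b s : R) : is_derive s (1 : R) (fun s : R => a * s + b) a.
Proof.
have := is_deriveD1 (is_deriveM1 (is_derive_cst a s (1 : R)) (is_derive_id s (1 : R)))
  (is_derive_cst b s (1 : R)).
by rewrite mul0r add0r mulr1 addr0.
Qed.

(* As n grows, time_cutoff T n tends to max(T - s, 0) on s >= 0 with derivative
   -1 before T, while its support stays in [-1, T]. *)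
Definition time_cutoff (T : R) (n : nat) (s : R) : R :=
  flat 1 (n.+1%:R * s + n.+1%:R) *
  ((-1 * s + T) * flat 1 (- n.+1%:R * s + n.+1%:R * T)).

(** The derivative of [time_cutoff T n]. Differentiating the right factor produces a coefficient
    [n.+1%:R], which the factor [T - s] absorbs through [flatMX], leaving [flat 'X]; at [s >= 0] the
    one in front of the left factor is absorbed likewise, at the price of a division by [s + 1].
    Hence bounds uniform in [n]. *)
Let dcut (T : R) n s : R :=
  (n.+1%:R * flat ('X * 'X) (n.+1%:R * s + n.+1%:R)) *
    ((-1 * s + T) * flat 1 (- n.+1%:R * s + n.+1%:R * T)) -
  flat 1 (n.+1%:R * s + n.+1%:R) *
    (flat 1 (- n.+1%:R * s + n.+1%:R * T) + flat 'X (- n.+1%:R * s + n.+1%:R * T)).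

Lemma smooth_time_cutoff T n : smooth (time_cutoff T n).
Proof.
apply: smooth_mul.
  exact: (smooth_comp (smooth_flat 1) (smooth_affine _ _)).
apply: smooth_mul; first exact: smooth_affine.
exact: (smooth_comp (smooth_flat 1) (smooth_affine _ _)).
Qed.

Let is_derive_time_cutoff T n s : is_derive s (1 : R) (time_cutoff T n) (dcut T n s).
Proof.
have D1 : is_derive s (1 : R) (fun s => flat 1 (n.+1%:R * s + n.+1%:R))
    (flat ('X * 'X) (n.+1%:R * s + n.+1%:R) * n.+1%:R).
  apply: (@is_derive_comp1 R R (flat 1) (fun s => n.+1%:R * s + n.+1%:R)).
    have := is_derive_flat 1 (n.+1%:R * s + n.+1%:R).
    by rewrite -polyC1 derivC subr0 polyC1 mul1r.
  exact: is_derive_affine.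
have D2 : is_derive s (1 : R) (fun s => flat 1 (- n.+1%:R * s + n.+1%:R * T))
    (flat ('X * 'X) (- n.+1%:R * s + n.+1%:R * T) * - n.+1%:R).
  apply: (@is_derive_comp1 R R (flat 1) (fun s => - n.+1%:R * s + n.+1%:R * T)).
    have := is_derive_flat 1 (- n.+1%:R * s + n.+1%:R * T).
    by rewrite -polyC1 derivC subr0 polyC1 mul1r.
  exact: is_derive_affine.
have := is_deriveM1 D1 (is_deriveM1 (is_derive_affine (-1) T s) D2).
rewrite (_ : _ + _ = dcut T n s)// /dcut (flatMX 'X); ring.
Qed.

Lemma derive_time_cutoff_ge T n s : T <= s ->
  time_cutoff T n s = 0 /\ 'D_1 (time_cutoff T n) s = 0.
Proof.
move=> Ts; have H : - n.+1%:R * s + n.+1%:R * T <= 0 :> R.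
  by rewrite mulNr addrC subr_le0 ler_wpM2l.
have := is_derive_time_cutoff T n s; rewrite /dcut !(flat_le0 _ H) => D.
by rewrite derive_val /time_cutoff (flat_le0 _ H) addr0 !mulr0 subr0.
Qed.

Lemma time_cutoff_support T n s : time_cutoff T n s != 0 -> -1 <= s <= T.
Proof.
move=> H; rewrite !leNgt; apply/andP; split; apply: contra H => H.
  rewrite /time_cutoff flat_le0 ?mul0r// -[X in _ + X]mulr1 -mulrDr.
  by rewrite mulr_ge0_le0//; lra.
by rewrite (derive_time_cutoff_ge n (ltW H)).1.
Qed.

Let shifted_pos n s : 0 <= s -> 0 < n.+1%:R * s + n.+1%:R :> R.
Proof. by move=> s0; rewrite ltr_wpDl// mulr_ge0. Qed.

Let dcutE T n s : 0 <= s -> dcut T n s =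
  (flat 'X (n.+1%:R * s + n.+1%:R) / (s + 1)) *
    ((-1 * s + T) * flat 1 (- n.+1%:R * s + n.+1%:R * T)) -
  flat 1 (n.+1%:R * s + n.+1%:R) *
    (flat 1 (- n.+1%:R * s + n.+1%:R * T) + flat 'X (- n.+1%:R * s + n.+1%:R * T)).
Proof.
move=> s0; rewrite /dcut (flatMX 'X (n.+1%:R * s + n.+1%:R)).
congr (_ * _ - _); field; rewrite gt_eqF//; lra.
Qed.

Lemma time_cutoff_bounded T : 0 < T -> exists2 C : R, 0 <= C & forall n s, 0 <= s ->
  `|time_cutoff T n s| <= C /\ `|'D_1 (time_cutoff T n) s| <= C.
Proof.
move=> T0; have [C C0 HC] := flat_bounded ('X : {poly R}).
have f1 (y : R) : `|flat 1 y| <= 1 by rewrite ger0_norm ?flat1_ge0 ?flat1_le1.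
(* [C] bounds [flat 'X]. The three summands bound the derivative of the left factor, that of the
   right factor, and the cutoff itself. *)
exists (C * T + (1 + C) + T).
  by rewrite !addr_ge0// ?mulr_ge0// ltW.
move=> n s s0.
have B : `|(-1 * s + T) * flat 1 (- n.+1%:R * s + n.+1%:R * T)| <= T.
  have [Ts|sT] := leP T s.
    have H : - n.+1%:R * s + n.+1%:R * T <= 0 :> R.
      by rewrite mulNr addrC subr_le0 ler_wpM2l.
    by rewrite (flat_le0 _ H) mulr0 normr0 ltW.
  rewrite normrM -[X in _ <= X]mulr1 ler_pM// ger0_norm; lra.
split.
  rewrite /time_cutoff normrM (@le_trans _ _ (1 * T))//; first by rewrite ler_pM.
  by rewrite mul1r lerDr !addr_ge0// mulr_ge0// ltW.
have D := is_derive_time_cutoff T n s; rewrite derive_val dcutE//.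
apply: le_trans (ler_normB _ _) _.
rewrite -[X in X <= _]addr0; apply: lerD; last exact: ltW.
apply: lerD.
  rewrite normrM ler_pM// normrM -[X in _ <= X]mulr1 ler_pM//.
  by rewrite normfV ger0_norm ?invf_le1; lra.
rewrite normrM -[X in _ <= X]mul1r ler_pM//.
by apply: le_trans (ler_normD _ _) _; rewrite lerD.
Qed.

(** Before [T] all arguments of the flat functions tend to infinity, and only the product of the two
    limits of [flat 1] survives. At [T] and later the cutoffs are flat, so the limit is 0 at [T]
    itself. *)
Lemma time_cutoff_cvg T s : 0 <= s ->
  'D_1 (time_cutoff T n) s @[n --> \oo] --> (if s < T then -1 else 0 : R).
Proof.
move=> s0; rewrite (_ : (fun n => _) = fun n => dcut T n s); last first.
  by apply/funext => n; have D := is_derive_time_cutoff T n s; rewrite derive_val.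
case: ifPn => [sT|]; last first.
  rewrite -leNgt => Ts; rewrite (_ : (fun n => _) = cst 0); first exact: cvg_cst.
  apply/funext => n; have D := is_derive_time_cutoff T n s.
  by have [_] := derive_time_cutoff_ge n Ts; rewrite derive_val.
rewrite (funext (fun n => dcutE T n s0)).
have inv_cvg (a : R) (u : nat -> R) : 0 < a -> (forall n, u n = n.+1%:R * a) ->
    (u n)^-1 @[n --> \oo] --> (0 : R).
  move=> a0 uE; rewrite (_ : (fun n => _) = fun n => n.+1%:R^-1 * a^-1); last first.
    by apply/funext => n; rewrite uE invfM.
  rewrite -(mul0r (a^-1 : R)); apply: cvgMl; exact: cvg_harmonic.
have c1 p : flat p (n.+1%:R * s + n.+1%:R) @[n --> \oo] --> p.[0].
  apply: flat_cvg => [n|]; first exact: shifted_pos.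
  by apply: (inv_cvg (s + 1)) => [|n]; [lra|rewrite mulrDr mulr1].
have c2 p : flat p (- n.+1%:R * s + n.+1%:R * T) @[n --> \oo] --> p.[0].
  apply: flat_cvg => [n|]; first by rewrite mulNr addrC -mulrBr mulr_gt0// subr_gt0.
  by apply: (inv_cvg (T - s)) => [|n]; [lra|rewrite mulNr addrC -mulrBr].
have := cvgB (cvgM (cvgM (c1 'X) (cvg_cst (s + 1)^-1)) (cvgM (cvg_cst (-1 * s + T)) (c2 1)))
  (cvgM (c1 1) (cvgD (c2 1) (c2 'X))).
rewrite hornerX hornerC mul0r mul0r sub0r addr0 mulr1; exact.
Qed.

End time_cutoff.

(** * Cutoffs in position and in velocity *)

Section space_cutoff.
Context (R : realType) (d : nat).
Local Notation E := 'rV[R]_d.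

Lemma smooth_coor (i : 'I_d) : smooth (fun x : E => x 0 i).
Proof.
apply: smooth_functional => [|h w x]; first exact: coord_continuous.
by rewrite !mxE.
Qed.

Lemma is_derive_dot (x w : E) : is_derive x w (fun x : E => dot x x) (2 * dot x w).
Proof.
apply/is_derive_line; rewrite (_ : (fun h : R => _) = fun h =>
    (h * h) * dot w w + (2 * dot x w * h + dot x x)); last first.
  apply/funext => h; rewrite dot_addl !dot_addr !dot_scalel !dot_scaler (dotC w x); ring.
have := is_deriveD1 (is_deriveM1 (is_deriveM1 (is_derive_id (0 : R) (1 : R))
  (is_derive_id (0 : R) (1 : R))) (is_derive_cst (dot w w) (0 : R) (1 : R)))
  (is_derive_affine (2 * dot x w) (dot x x) 0).
by rewrite !mulr0 mul0r !addr0 mul0r add0r.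
Qed.

(** The standard bump on the ball of radius [n + 1], divided by its value at the origin so that it
    tends to 1. On a torus the constant 1 is already a test function. *)
Definition space_cutoff (S : base_space R) (n : nat) (x : E) : R :=
  if S is Euclidean then flat 1 (- n.+1%:R ^- 2 * dot x x + 1) / flat 1 1 else 1.

Let flat11 : 0 < flat 1 1 :> R.
Proof. by rewrite flat_gt0// hornerC mul1r expR_gt0. Qed.

Let is_derive_cutoff n (x w : E) : is_derive x w (space_cutoff Euclidean n)
  (flat ('X * 'X) (- n.+1%:R ^- 2 * dot x x + 1) * (- n.+1%:R ^- 2 * (2 * dot x w))
   / flat 1 1).
Proof.
have D1 : is_derive x w (fun x => - n.+1%:R ^- 2 * dot x x + 1) (- n.+1%:R ^- 2 * (2 * dot x w)).
  have := @is_derive_comp1 R _ (fun s => - n.+1%:R ^- 2 * s + 1) (fun x => dot x x) x w _ _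
    (is_derive_affine (- n.+1%:R ^- 2) 1 _) (is_derive_dot x w).
  exact.
have D2 := @is_derive_comp1 R _ (flat 1) (fun x => - n.+1%:R ^- 2 * dot x x + 1) x w _ _
  (is_derive_flat 1 _) D1.
have := is_deriveM1 D2 (is_derive_cst (flat 1 1)^-1 x w).
by rewrite mulr0 addr0 -polyC1 derivC subr0 polyC1 mul1r.
Qed.

Lemma smooth_space_cutoff S n : smooth (space_cutoff S n).
Proof.
case: S => [|L]; last exact: smooth_cst.
apply: smooth_mul; last exact: smooth_cst.
apply: (smooth_comp (smooth_flat 1) (u := fun x : E => - n.+1%:R ^- 2 * dot x x + 1)).
apply: smooth_add; last exact: smooth_cst.
apply: smooth_mul; first exact: smooth_cst.
by apply: smooth_sum => i; apply: smooth_mul; exact: smooth_coor.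
Qed.

Let inside n (x : E) : 0 < - n.+1%:R ^- 2 * dot x x + 1 -> enorm x <= n.+1%:R.
Proof.
move=> H; rewrite -(ler_pXn2r (ltn0Sn 1)) ?nnegrE ?enorm_ge0// enorm_sqr.
move: H; rewrite mulNr addrC subr_gt0 mulrC ltr_pdivrMr ?exprn_gt0// mul1r.
exact: ltW.
Qed.

Lemma space_cutoff_support S n x :
  space_cutoff S n x != 0 -> in_ball S n.+1%:R x.
Proof.
case: S => [|L]//= H; apply: inside; rewrite ltNge; apply: contra H => H.
by rewrite flat_le0// mul0r.
Qed.

(** The chain rule gives a factor [2 * x_i / (n + 1) ^ 2], and [|x_i| <= n + 1] wherever the flat
    factor is not zero: the gradient is of order [1 / (n + 1)]. *)
Lemma space_cutoff_bounded S : exists2 C : R, 0 <= C & forall n x,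
  `|space_cutoff S n x| <= C /\
  forall i, `|grad (space_cutoff S n) x 0 i| <= C / n.+1%:R.
Proof.
case: S => [|L].
  have [B B0 HB] := flat_bounded ('X * 'X : {poly R}).
  exists ((1 + 2 * B) / flat 1 1).
    by rewrite divr_ge0 ?ltW//; lra.
  move=> n x; split.
    rewrite normrM normfV (ger0_norm (ltW flat11)) ler_wpM2r ?invr_ge0 ?(ltW flat11)//.
    by rewrite ger0_norm ?flat1_ge0// (le_trans (flat1_le1 _))//; lra.
  move=> i; rewrite mxE; have D := is_derive_cutoff n x (delta_mx 0 i); rewrite derive_val.
  have dE : dot x (delta_mx 0 i) = x 0 i.
    rewrite /dot (bigD1 i)//= big1 ?addr0 ?mxE ?eqxx ?mulr1// => j ji.
    by rewrite mxE eqxx (negbTE ji) mulr0.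
  rewrite dE normrM normfV (ger0_norm (ltW flat11)) [X in _ <= X]mulrAC.
  rewrite ler_wpM2r ?invr_ge0 ?(ltW flat11)//.
  have N0 : 0 < n.+1%:R :> R by [].
  have [H|H] := leP (- n.+1%:R ^- 2 * dot x x + 1) 0.
    by rewrite flat_le0// mul0r normr0 divr_ge0//; lra.
  rewrite normrM normrM normrN normfV normrX (ger0_norm (ltW N0)) normrM (ger0_norm (ler0n R 2)).
  apply: (@le_trans _ _ (B * (n.+1%:R ^- 2 * (2 * n.+1%:R)))).
    rewrite ler_pM// ?mulr_ge0 ?invr_ge0 ?exprn_ge0 ?ler0n//.
    rewrite ler_wpM2l ?invr_ge0 ?exprn_ge0 ?ler0n// ler_wpM2l//.
    exact: le_trans (coor_le_enorm _ _) (inside H).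
  rewrite (_ : B * _ = 2 * B / n.+1%:R); last by field; rewrite addrC natr1 gt_eqF.
  by rewrite ler_wpM2r ?invr_ge0 ?ler0n//; lra.
exists 1 => // n x; split; first by rewrite normr1.
move=> i; rewrite mxE (_ : 'D__ _ _ = 0) ?normr0 ?divr_ge0//.
have D := is_derive_cst (1 : R) x (delta_mx 0 i : E).
exact: derive_val.
Qed.

Lemma space_cutoff_cvg S x : space_cutoff S n x @[n --> \oo] --> (1 : R).
Proof.
case: S => [|L]; last exact: cvg_cst.
rewrite /space_cutoff; have c1 : {for (1 : R), continuous (flat 1 : R -> R)}.
  exact: (smooth_continuous (smooth_flat 1)).
have c2 : (- n.+1%:R ^- 2 * dot x x + 1) @[n --> \oo] --> (1 : R).
  rewrite (_ : (fun n => _) = fun n => - (harmonic n * harmonic n) * dot x x + 1); last first.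
    by apply/funext => n; rewrite /harmonic/= expr2 invfM.
  have h := @cvg_harmonic R.
  have := cvgD (cvgM (cvgN (cvgM h h)) (cvg_cst (dot x x))) (cvg_cst (1 : R)).
  by rewrite mul0r oppr0 mul0r add0r; exact.
have := cvgM (cvg_comp _ _ c2 c1) (cvg_cst (flat 1 1)^-1).
by rewrite divff ?gt_eqF//; exact.
Qed.

End space_cutoff.

(** * Uniform bounds on test functions and their derivatives *)

Section continuous_on_boxes.
Context (R : realType) (d : nat).
Local Notation E := 'rV[R]_d.
Local Notation Z := (R * (E * E))%type.

Lemma compact_row_box (l u : R) : compact [set x : E | forall i, l <= x 0 i <= u].
Proof.
have := @rV_compact R d (fun=> `[l, u]%classic) (fun=> @segment_compact R l u).
congr compact; apply/seteqP; split=> x /= H i; have := H i; rewrite ?in_itv//.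
Qed.

Lemma continuous_bounded_on (T : topologicalType) (f : T -> R) (K : set T) :
  continuous f -> compact K -> exists2 C : R, 0 <= C & forall x, K x -> `|f x| <= C.
Proof.
move=> cf cK; have /compact_bounded[M [_ HM]] : compact (f @` K).
  by apply: continuous_compact => //; exact: continuous_subspaceT.
exists (`|M| + 1); first by rewrite addr_ge0.
move=> x Kx; apply: HM; last by exists x.
by rewrite (le_lt_trans (ler_norm M))// ltrDl.
Qed.

(** The coordinates are treated one at a time, each being moved by the integral number of periods
    [floor (y_i / L)]. The cube is taken closed so as to be compact. *)
Lemma reduce_period (L : R) (g : E -> R) : 0 < L ->
  (forall i x, g (x + L *: delta_mx 0 i) = g x) ->
  forall x, exists y, g y = g x /\ forall i, 0 <= y 0 i <= L.
Proof.
move=> L0 gL.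
have gN (n : nat) i x : g (x + (n%:R * L) *: delta_mx 0 i) = g x.
  elim: n => [|n IH]; first by rewrite mul0r scale0r addr0.
  by rewrite -natr1 mulrDl mul1r scalerDl addrA gL.
have gZ (k : int) i x : g (x + (k%:~R * L) *: delta_mx 0 i) = g x.
  case: k => n; first by rewrite -pmulrn gN.
  rewrite NegzE mulrNz mulNr scaleNr.
  by rewrite -[in RHS](subrK ((n.+1%:R * L) *: delta_mx 0 i) x) gN.
move=> x; suff [y [gy Hy]] : exists y, g y = g x /\
    forall i, i \in enum 'I_d -> 0 <= y 0 i <= L.
  by exists y; split => // i; apply: Hy; rewrite mem_enum.
elim: (enum 'I_d) => [|i s [y [gy Hy]]]; first by exists x.
pose k := Num.floor (y 0 i / L).
exists (y + ((- k)%:~R * L) *: delta_mx 0 i); split; first by rewrite gZ.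
move=> j; rewrite inE !mxE eqxx /=; case: eqVneq => [->{j} _|ji /= /Hy]; last first.
  by rewrite mulr0 addr0.
rewrite mulr1 mulrNz mulNr.
have /andP[h1 h2] := floor_itv (y 0 i / L).
move: h1 h2; rewrite -/k ler_pdivlMr// ltr_pdivrMr// intrD1 mulrDl mul1r => h1 h2.
by apply/andP; split; lra.
Qed.

(** A common form of bounded support and periodicity which directional derivatives preserve. The
    support is confined to a box rather than a ball, so that each condition bears on a single
    continuous coordinate. Here [p] projects on the factor concerned and [e] embeds its
    directions. *)
Definition confined (S : base_space R) (r : R) (p : Z -> E) (e : E -> Z) (f : Z -> R) :=
  if S is Torus L then forall i q, f (q + e (L%:num *: delta_mx 0 i)) = f q
  else forall i q, f q != 0 -> - r <= p q 0 i <= r.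

Definition xpart (q : Z) : E := q.2.1.
Definition vpart (q : Z) : E := q.2.2.
Definition xdir (x : E) : Z := (0, (x, 0)).
Definition vdir (v : E) : Z := (0, (0, v)).

Definition confined_txv X V (a b r : R) (f : Z -> R) :=
  [/\ forall q, f q != 0 -> a <= q.1 <= b,
      confined X r xpart xdir f & confined V r vpart vdir f].

Lemma confined_reduce S r f (p : Z -> E) e (ins : E -> Z) x :
  (forall y, p (ins y) = y) ->
  (forall y z, ins y + e z = ins (y + z)) ->
  confined S r p e f -> f (ins x) != 0 ->
  exists y, f (ins y) = f (ins x) /\
    forall i, (if S is Torus L then 0 else - r) <= y 0 i <= (if S is Torus L then L%:num else r).
Proof.
move=> pi ie; case: S => [|L] H f0.
  by exists x; split => // i; have := H i _ f0; rewrite pi.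
have [y [fy Hy]] := @reduce_period L%:num (f \o ins) (gt0 L) (fun i x => etrans
  (congr1 f (esym (ie _ _))) (H i (ins x))) x.
by exists y.
Qed.

(** Periodic variables are brought back to one period, position before velocity; the others already
    range in a box. Continuity on the resulting compact set gives the bound. *)
Lemma confined_bounded X V a b r f : continuous f -> confined_txv X V a b r f ->
  exists2 C : R, 0 <= C & forall q, `|f q| <= C.
Proof.
move=> cf [ft fX fV].
pose lo (S : base_space R) : R := if S is Torus L then 0 else - r.
pose hi (S : base_space R) : R := if S is Torus L then L%:num else r.
pose K := `[a, b]%classic `*` ([set x : E | forall i, lo X <= x 0 i <= hi X] `*`
  [set x : E | forall i, lo V <= x 0 i <= hi V]).
have cK : compact K.
  apply: compact_setX; first exact: segment_compact.
  by apply: compact_setX; exact: compact_row_box.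
have [C C0 HC] := continuous_bounded_on cf cK.
exists C => // -[s [x v]]; have [->|f0] := eqVneq (f (s, (x, v))) 0; first by rewrite normr0.
have [y [fy Hy]] := @confined_reduce X r f xpart xdir (fun x => (s, (x, v))) x
  (fun=> erefl) (fun y z => congr2 pair (addr0 s) (congr2 pair erefl (addr0 v))) fX f0.
rewrite -fy in f0 *.
have [w [fw Hw]] := @confined_reduce V r f vpart vdir (fun v => (s, (y, v))) v
  (fun=> erefl) (fun w z => congr2 pair (addr0 s) (congr2 pair (addr0 y) erefl)) fV f0.
rewrite -fw in f0 *; apply: HC; split => /=; first by rewrite in_itv/=; exact: (ft _ f0).
by split.
Qed.

(** The complement of the closed slab is open, so [f] vanishes near each of its points. *)
Lemma derive_support (W : normedModType R) (f l : W -> R) (a b : R) w :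
  continuous l -> (forall q, f q != 0 -> a <= l q <= b) ->
  forall q, 'D_w f q != 0 -> a <= l q <= b.
Proof.
move=> cl H q; apply: contraNT; rewrite negb_and -!ltNge => H'.
suff D : is_derive q w f 0 by rewrite derive_val.
apply: (near_eq_is_derive (f := cst 0)).
case/orP : H' => H'; near=> y; apply/esym/eqP; apply: contraTT isT => /H/andP[h1 h2].
- suff : l y < a by rewrite ltNge h1.
  by near: y; exact: (cl q _ (lt_nbhsl H')).
- suff : b < l y by rewrite ltNge h2.
  by near: y; exact: (cl q _ (lt_nbhsr H')).
Unshelve. all: by end_near. Qed.

Lemma derive_periodic (W : normedModType R) (f : W -> R) (c w : W) :
  (forall q, f (q + c) = f q) -> forall q, 'D_w f (q + c) = 'D_w f q.
Proof.
move=> H q; rewrite /derive.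
rewrite (_ : (fun h : R => h^-1 *: ((f \o shift (q + c)) (h *: w) - f (q + c))) =
  (fun h : R => h^-1 *: ((f \o shift q) (h *: w) - f q)))//.
by apply/funext => h /=; rewrite H addrA H.
Qed.

Lemma continuous_xcoor i : continuous (fun q : Z => xpart q 0 i).
Proof.
move=> [s [x v]].
have c1 : {for (s, (x, v)), continuous (fun p : Z => p.2)} by exact: cvg_snd.
have c2 : {for (x, v), continuous (fun p : E * E => p.1)} by exact: cvg_fst.
exact: (cvg_comp _ _ c1 (cvg_comp _ _ c2 (@coord_continuous _ _ _ 0 i x))).
Qed.

Lemma continuous_vcoor i : continuous (fun q : Z => vpart q 0 i).
Proof.
move=> [s [x v]].
have c1 : {for (s, (x, v)), continuous (fun p : Z => p.2)} by exact: cvg_snd.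
have c2 : {for (x, v), continuous (fun p : E * E => p.2)} by exact: cvg_snd.
exact: (cvg_comp _ _ c1 (cvg_comp _ _ c2 (@coord_continuous _ _ _ 0 i v))).
Qed.

Lemma continuous_time : continuous (fun q : Z => q.1).
Proof. by move=> [s z]; exact: cvg_fst. Qed.

Lemma confined_derive X V a b r f w :
  confined_txv X V a b r f -> confined_txv X V a b r (fun q => 'D_w f q).
Proof.
move=> [ft fX fV]; split.
- exact: derive_support continuous_time ft.
- case: X fX => [|L] H i q; last by apply: derive_periodic => p; exact: H.
  exact: (@derive_support _ f (fun q => xpart q 0 i) (- r) r w (@continuous_xcoor i) (H i) q).
- case: V fV => [|L] H i q; last by apply: derive_periodic => p; exact: H.
  exact: (@derive_support _ f (fun q => vpart q 0 i) (- r) r w (@continuous_vcoor i) (H i) q).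
Qed.

(** Partial derivatives are directional derivatives on the product space, to which the closure
    properties of [smooth] and of [confined] apply. *)
Lemma dtE f (p : Z) : smooth f -> dt f p = 'D_((1, (0, 0)) : Z) f p.
Proof.
move=> sf; have /is_derive_line D := smooth_is_derive p ((1, (0, 0)) : Z) sf.
apply/derive_val/is_derive_line; rewrite (_ : (fun h : R => _) =
  (fun h => f (h *: ((1, (0, 0)) : Z) + p)))//.
case: p {D} => s [x v]; apply/funext => h /=; congr (f (_, (_, _))).
  by rewrite -[RHS]/(h *: 0 + x) scaler0 add0r.
by rewrite -[RHS]/(h *: 0 + v) scaler0 add0r.
Qed.

Lemma grad_xE f (p : Z) i : smooth f -> grad_x f p 0 i = 'D_(xdir (delta_mx 0 i)) f p.
Proof.
move=> sf; have /is_derive_line D := smooth_is_derive p (xdir (delta_mx 0 i)) sf.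
rewrite mxE; apply/derive_val/is_derive_line; rewrite (_ : (fun h : R => _) =
  (fun h => f (h *: xdir (delta_mx 0 i) + p)))//.
case: p {D} => s [x v]; apply/funext => h /=; congr (f (_, (_, _))).
  by rewrite -[RHS]/(h *: 0 + s) scaler0 add0r.
by rewrite -[RHS]/(h *: 0 + v) scaler0 add0r.
Qed.

Lemma grad_vE f (p : Z) i : smooth f -> grad_v f p 0 i = 'D_(vdir (delta_mx 0 i)) f p.
Proof.
move=> sf; have /is_derive_line D := smooth_is_derive p (vdir (delta_mx 0 i)) sf.
rewrite mxE; apply/derive_val/is_derive_line; rewrite (_ : (fun h : R => _) =
  (fun h => f (h *: vdir (delta_mx 0 i) + p)))//.
case: p {D} => s [x v]; apply/funext => h /=; congr (f (_, (_, _))).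
  by rewrite -[RHS]/(h *: 0 + s) scaler0 add0r.
by rewrite -[RHS]/(h *: 0 + x) scaler0 add0r.
Qed.

Lemma in_ball_coor (r : R) (x : E) i : in_ball Euclidean r x -> - r <= x 0 i <= r.
Proof. by move=> /= xr; rewrite -ler_norml; exact: le_trans (coor_le_enorm _ _) xr. Qed.

Lemma test_fun_confined (J : interval R) (X V : base_space R) (f : Z -> R) : test_fun_txv J X V f ->
  exists a b r, `[a, b] `<=` [set` J] /\ confined_txv X V a b r f.
Proof.
move=> [sf pX pV [a [b [r [ab H]]]]]; exists a, b, r; split => //; split.
- by move=> [s [x v]] /H[].
- case: X pX H => [|L] pX H i [s [x v]].
    by move=> /H[_ + _]; exact: in_ball_coor.
  rewrite -[RHS](pX s v i x); apply: congr1.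
  exact: (congr2 pair (addr0 s) (congr2 pair erefl (addr0 v))).
- case: V pV H => [|L] pV H i [s [x v]].
    by move=> /H[_ _]; exact: in_ball_coor.
  rewrite -[RHS](pV s x i v); apply: congr1.
  exact: (congr2 pair (addr0 s) (congr2 pair (addr0 x) erefl)).
Qed.

Lemma smooth_measurable (f : Z -> R) : smooth f -> measurable_fun setT f.
Proof. by move=> sf; apply: continuous_measurable_txv; exact: smooth_continuous. Qed.

Lemma test_fun_bounds (J : interval R) (X V : base_space R) (f : Z -> R) : test_fun_txv J X V f ->
  exists a b C, [/\ `[a, b] `<=` [set` J], 0 <= C,
    [/\ measurable_fun setT f, measurable_fun setT (dt f),
       forall i, measurable_fun setT (fun p => grad_x f p 0 i) &
       forall i, measurable_fun setT (fun p => grad_v f p 0 i)],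
    (forall p, ~~ (a <= p.1 <= b) -> [/\ f p = 0, dt f p = 0,
       grad_x f p = 0 & grad_v f p = 0]) &
    forall p, [/\ `|f p| <= C, `|dt f p| <= C, forall i, `|grad_x f p 0 i| <= C &
       forall i, `|grad_v f p 0 i| <= C]].
Proof.
move=> tf; have [a [b [r [ab cf]]]] := test_fun_confined tf; have [sf _ _ _] := tf.
have bnd w : exists2 C : R, 0 <= C & forall q, `|'D_w f q| <= C.
  apply: confined_bounded (confined_derive w cf).
  exact: smooth_continuous (smooth_derive w sf).
have zero w p : ~~ (a <= p.1 <= b) -> 'D_w f p = 0.
  have [H _ _] := confined_derive w cf; move=> Hp.
  by apply/eqP; apply: contraNT Hp; exact: H.
have [C0 C00 H0] := confined_bounded (smooth_continuous sf) cf.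
have [C1 C10 H1] := bnd (1, (0, 0)).
(* One bound is selected for each coordinate direction, so that their sum can serve for all of
   them. *)
have [Cx Hx] := choice (fun i => let: ex_intro2 C h1 h2 := bnd (xdir (delta_mx 0 i)) in
  ex_intro (fun C => 0 <= C /\ forall q, `|'D_(xdir (delta_mx 0 i)) f q| <= C) C (conj h1 h2)).
have [Cv Hv] := choice (fun i => let: ex_intro2 C h1 h2 := bnd (vdir (delta_mx 0 i)) in
  ex_intro (fun C => 0 <= C /\ forall q, `|'D_(vdir (delta_mx 0 i)) f q| <= C) C (conj h1 h2)).
have sx : 0 <= \sum_i Cx i by apply: sumr_ge0 => i _; case: (Hx i).
have sv : 0 <= \sum_i Cv i by apply: sumr_ge0 => i _; case: (Hv i).
exists a, b, (C0 + C1 + \sum_i Cx i + \sum_i Cv i); split => //.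
- by rewrite !addr_ge0.
- split.
  + exact: smooth_measurable.
  + rewrite (_ : dt f = fun q => 'D_(1, (0, 0)) f q); last by apply/funext => q; exact: dtE.
    exact: smooth_measurable (smooth_derive _ sf).
  + move=> i; under eq_fun do rewrite grad_xE//.
    exact: smooth_measurable (smooth_derive _ sf).
  + move=> i; under eq_fun do rewrite grad_vE//.
    exact: smooth_measurable (smooth_derive _ sf).
- move=> p Hp; split.
  + by have [H _ _] := cf; apply/eqP; apply: contraNT Hp; exact: H.
  + by rewrite dtE// zero.
  + by apply/rowP => i; rewrite grad_xE// zero// mxE.
  + by apply/rowP => i; rewrite grad_vE// zero// mxE.
- move=> p; split.
  + by apply: le_trans (H0 p) _; lra.
  + by rewrite dtE//; apply: le_trans (H1 p) _; lra.
  + move=> i; rewrite grad_xE//; apply: le_trans ((Hx i).2 p) _.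
    suff : Cx i <= \sum_i Cx i by lra.
    by rewrite (bigD1 i)//= lerDl; apply: sumr_ge0 => j _; case: (Hx j).
  + move=> i; rewrite grad_vE//; apply: le_trans ((Hv i).2 p) _.
    suff : Cv i <= \sum_i Cv i by lra.
    by rewrite (bigD1 i)//= lerDl; apply: sumr_ge0 => j _; case: (Hv j).
Qed.

End continuous_on_boxes.

(** * Integrals of derivatives over boxes *)

Section integral_of_derivative.
Context (R : realType).
Local Notation leb := (@lebesgue_measure R).
Local Notation lebE := (lebesgue_row R).

Definition half_open_box d (l u : R) : set 'rV[R]_d := [set x | forall i, l <= x 0 i < u].

Lemma measurable_half_open_box d l u : measurable (@half_open_box d l u).
Proof.
rewrite (_ : half_open_box l u = \bigcap_(i in [set: 'I_d])
    ((fun x : 'rV[R]_d => x 0 i) @^-1` `[l, u[%classic)); last first.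
  by apply/seteqP; split=> x /= H i; rewrite ?in_itv/=; have := H i; rewrite ?in_itv/=; auto.
apply: fin_bigcap_measurable; first exact: finite_finset.
move=> i _; rewrite -[X in measurable X]setTI.
by apply: measurable_coor => //; exact: measurable_itv.
Qed.

Lemma consrow_half_open_box d l u :
  @consrow R d @^-1` half_open_box l u = `[l, u[%classic `*` half_open_box l u.
Proof.
apply/seteqP; split=> -[s y] /=.
  move=> H; split; first by have := H ord0; rewrite consrow0 in_itv.
  by move=> i; have := H (lift ord0 i); rewrite consrow_lift.
rewrite in_itv/= => -[Hs Hy] i; case: (unliftP ord0 i) => [j|] ->.
  by rewrite consrow_lift.
by rewrite consrow0.
Qed.

Lemma lebesgue_half_open_box_fin d l u : (lebE d (half_open_box l u) < +oo)%E.
Proof.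
elim: d => [|d IH].
  by rewrite /= diracE; case: (_ \in _); rewrite ltry.
rewrite /= /cons_lebesgue/= /pushforward consrow_half_open_box.
rewrite product_measure1E//=; last exact: measurable_half_open_box.
rewrite lte_mul_pinfty//.
  by rewrite ge0_fin_numE// lebesgue_measure_itv/= lte_fin; case: ifP; rewrite ?ltry.
Qed.

Lemma consrow_shift0 d (h s : R) (y : 'rV[R]_d) :
  consrow (h + s, y) = h *: delta_mx 0 ord0 + consrow (s, y).
Proof.
apply/rowP => i; rewrite !mxE /=; case: (unliftP ord0 i) => [j|] ->.
  by rewrite mulr0 add0r.
by rewrite eqxx mulr1.
Qed.

Lemma consrow_shift_lift d (h s : R) (y : 'rV[R]_d) j :
  consrow (s, h *: delta_mx 0 j + y) = h *: delta_mx 0 (lift ord0 j) + consrow (s, y).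
Proof.
apply/rowP => i; rewrite !mxE /=; case: (unliftP ord0 i) => [k|] ->.
  by rewrite !mxE /= (inj_eq lift_inj).
by rewrite mulr0 add0r.
Qed.

Lemma continuous_consrow d : continuous (@consrow R d).
Proof.
move=> p; apply/cvg_ballP => e e0; near=> q.
have : ball p e q by near: q; exact: (@nbhsx_ballx R (R * ('rV[R]_d))%type p e e0).
move=> [b1 [_ b2]].
split => // i j; rewrite !mxE; case: unliftP => [k|] _; first exact: b2.
exact: b1.
Unshelve. all: by end_near. Qed.

(** Induction on the dimension, following the construction of Lebesgue measure by adding a first
    coordinate. Equality of [f] on opposite faces covers at once periodic functions and functions
    that vanish near the boundary. *)
Lemma integral_derive_box d (l u : R) (f : 'rV[R]_d -> R) (i : 'I_d) : l < u ->
  (forall x, derivable f x (delta_mx 0 i)) ->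
  continuous (fun x => 'D_(delta_mx 0 i) f x) ->
  (forall x : 'rV[R]_d, x 0 i = l -> f (x + (u - l) *: delta_mx 0 i) = f x) ->
  (\int[lebE d]_(x in half_open_box l u) ('D_(delta_mx 0 i) f x)%:E = 0)%E.
Proof.
move=> lu; elim: d f i => [|d IH] f i; first by case: i.
move=> df cD per.
pose g (x : 'rV[R]_d.+1) := 'D_(delta_mx 0 i) f x.
pose A := `[l, u[%classic `*` @half_open_box d l u.
have mg : measurable_fun setT g by exact: continuous_measurable_row.
have mgc : measurable_fun setT (g \o @consrow R d).
  exact: (measurableT_comp mg (@measurable_consrow R d)).
have mB : measurable (@half_open_box d l u) by exact: measurable_half_open_box.
have mA : measurable (A : set (measurableTypeR R * 'rV[R]_d)) by exact: measurableX.
have [C C0 HC] := continuous_bounded_on cD (@compact_row_box R d.+1 l u).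
have ig : (leb \x lebE d)%E.-integrable A (EFin \o (g \o @consrow R d)).
  apply: measurable_bounded_integrable => //.
  - by have := lebesgue_half_open_box_fin d.+1 l u; rewrite /= /cons_lebesgue/= /pushforward
      consrow_half_open_box.
  - exact: measurable_funS mgc.
  - exists C; split; first by rewrite num_real.
    move=> M CM [s y] As /=; apply: le_trans (ltW CM); apply: HC => j.
    suff : half_open_box l u (consrow (s, y)) by move=> /(_ j)/andP[-> /ltW ->].
    by have : (@consrow R d @^-1` half_open_box l u) (s, y) by rewrite consrow_half_open_box.
rewrite /= /cons_lebesgue integral_pushforward//; last 4 first.
- exact: measurable_consrow.
- exact/measurable_EFinP.
- by rewrite consrow_half_open_box.
- exact: measurable_half_open_box.
rewrite consrow_half_open_box -/A integral_mkcond.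
pose G := (EFin \o (g \o @consrow R d)) \_ A.
have iG : (leb \x lebE d)%E.-integrable setT G by exact: (proj1 (integrable_mkcond _ mA) ig).
rewrite -/G; case: (unliftP ord0 i) => [j|] ij.
  (* The direction is not the first one: with the first coordinate frozen, the slice falls under the
     induction hypothesis. *)
  rewrite -(@integral12_prod_meas1 _ _ (measurableTypeR R) _ R leb (lebE d) G iG).
  apply: integral0_eq => s _; rewrite /fubini_F.
  rewrite (_ : (fun y => _) = (fun y => (G (s, y)))) //.
  have [sI|sI] := boolP (s \in `[l, u[%classic); last first.
    apply: integral0_eq => y _; rewrite /G patchE ifF//.
    by apply/negbTE; apply: contra sI => /set_mem[sA _]; apply/mem_set; exact: sA.
  have dj y : is_derive y (delta_mx 0 j) (fun y => f (consrow (s, y))) (g (consrow (s, y))).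
    apply/is_derive_line; under eq_fun do rewrite consrow_shift_lift.
    by rewrite -ij; exact: (proj1 (is_derive_line f _ _ _) (derivableP (df _))).
  transitivity (\int[lebE d]_(y in half_open_box l u)
      ('D_(delta_mx 0 j) (fun y => f (consrow (s, y))) y)%:E)%E.
    rewrite [RHS]integral_mkcond; apply: eq_integral => y _; rewrite /G !patchE.
    have -> : ((s, y) \in A) = (y \in half_open_box l u).
      by apply/idP/idP => [/set_mem[]//= _|] yB; apply/mem_set; [|split => //=; exact/set_mem].
    by case: ifPn => // _; have D := dj y; rewrite derive_val.
  apply: IH => [y||y yl].
  - by have [] := dj y.
  - rewrite (derive_fun dj) => y.
    apply: (@continuous_comp _ _ _ (fun y => consrow (s, y)) g); last exact: cD.
    apply: (@continuous_comp _ _ _ (fun y => (s, y)) (@consrow R d)); last exact: continuous_consrow.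
    exact: (@cvg_pair _ _ _ (nbhs y) (nbhs s) (nbhs y) _ _ _ (cst s) id (cvg_cst s) cvg_id).
  - rewrite [X in consrow (_, X)]addrC consrow_shift_lift addrC -ij per// ij consrow_lift//.
(* The direction is the first one: it is integrated first, by the fundamental theorem of
   calculus. *)
rewrite -(@integral21_prod_meas1 _ _ (measurableTypeR R) _ R leb (lebE d) G iG).
apply: integral0_eq => y _; rewrite /fubini_G.
have [yB|yB] := boolP (y \in half_open_box l u); last first.
  apply: integral0_eq => s _; rewrite /G patchE ifF//.
  by apply/negbTE; apply: contra yB => /set_mem[_ yA]; apply/mem_set; exact: yA.
have d0 s : is_derive s (1 : R) (fun s => f (consrow (s, y))) (g (consrow (s, y))).
  apply/is_derive_line; rewrite (_ : (fun h : R => _) =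
      (fun h => f (h *: delta_mx 0 i + consrow (s, y)))).
    exact: (proj1 (is_derive_line f _ _ _) (derivableP (df _))).
  by apply/funext => h; rewrite /GRing.scale/= mulr1 consrow_shift0 ij.
have cg : continuous (fun s : R => g (consrow (s, y))).
  move=> s; apply: (@continuous_comp _ _ _ (fun s => consrow (s, y)) g); last exact: cD.
  apply: (@continuous_comp _ _ _ (fun s => (s, y)) (@consrow R d)); last exact: continuous_consrow.
  exact: (@cvg_pair _ _ _ (nbhs s) (nbhs s) (nbhs y) _ _ _ id (cst y) cvg_id (cvg_cst y)).
transitivity (\int[leb]_(s in `[l, u[) (g (consrow (s, y)))%:E)%E.
  rewrite [RHS]integral_mkcond; apply: eq_integral => s _; rewrite /G !patchE.
  have -> : ((s, y) \in A) = (s \in `[l, u[%classic).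
    by apply/idP/idP => [/set_mem[]//= sI _|sI]; apply/mem_set => //; split => /=; exact/set_mem.
  by [].
rewrite integral_itv_bndo_bndc; last first.
  by apply: measurable_funTS; apply/measurable_EFinP; exact: continuous_measurable_fun.
have cf : continuous (fun s : R => f (consrow (s, y))).
  move=> s; apply: differentiable_continuous; apply/derivable1_diffP.
  by have [] := d0 s.
rewrite (@continuous_FTC2 _ _ (fun s => f (consrow (s, y))))//.
- suff -> : f (consrow (u, y)) = f (consrow (l, y)) by rewrite subee.
  rewrite -[in LHS](subrK l u) consrow_shift0 addrC -ij per//.
  by rewrite ij consrow0.
- exact: continuous_subspaceT.
- split.
  + by move=> s _; have [] := d0 s.
  + exact: cvg_at_right_filter (cf l).
  + exact: cvg_at_left_filter (cf u).
- by move=> s _; have D := d0 s; rewrite derive1E derive_val.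
Qed.

End integral_of_derivative.

(** * Test functions and weak gradients under a Gibbs measure *)

Section gibbs_test_functions.
Context (R : realType) (d : nat).
Local Notation E := 'rV[R]_d.
Local Notation lebE := (lebesgue_row R d).
Variable S : base_space R.

Lemma measurable_cell : measurable (@cell R d S).
Proof.
case: S => [|L]; first exact: measurableT.
exact: measurable_half_open_box.
Qed.

(** On a torus the box is the cell itself, and periodicity matches its faces. In Euclidean space it
    is a cube with the support of [f] in its interior, so that [f] vanishes on the faces. *)
Lemma test_fun_box (f : E -> R) : test_fun S f -> exists l u,
  [/\ l < u, @half_open_box R d l u `<=` cell S,
    forall x i, cell S x -> ~ @half_open_box R d l u x -> grad f x 0 i = 0 &
    forall i (x : E), x 0 i = l -> f (x + (u - l) *: delta_mx 0 i) = f x].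
Proof.
case: S => [|L] [sf pf [r Hr]]; last first.
  exists 0, L%:num; split => //=.
  by move=> i x _; rewrite subr0 pf.
have Hf (x : E) i : `|r| < `|x 0 i| -> f x = 0.
  move=> rx; apply/eqP; apply: contraTT rx => /Hr/= xr.
  by rewrite -leNgt (le_trans (coor_le_enorm x i))// (le_trans xr)// ler_norm.
have r1 : 0 < `|r| + 1 by rewrite ltr_wpDl.
(* The margin 1 keeps the faces away from the support; the absolute value is there because nothing
   makes [r] nonnegative. *)
exists (- (`|r| + 1)), (`|r| + 1); split => //=; first by lra.
- move=> x i _ /existsNP[j /negP Hj]; rewrite mxE.
  apply/eqP; apply: contraNT Hj => Dx.
  have := @derive_support _ _ f (fun x : E => x 0 j) (- `|r|) `|r| (delta_mx 0 i)
    (@coord_continuous _ _ _ 0 j) _ x Dx.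
  have H (y : E) : f y != 0 -> - `|r| <= y 0 j <= `|r|.
    by move=> fy; rewrite -ler_norml leNgt; apply: contra fy => /Hf ->.
  move=> /(_ H)/andP[/= h1 h2]; apply/andP; split.
    by apply: le_trans h1; rewrite lerN2 lerDl.
  by apply: le_lt_trans h2 _; rewrite ltrDl.
- move=> i x xi; rewrite (Hf x i); last first.
    by rewrite xi normrN (ger0_norm (ltW r1)) ltrDl.
  apply: (Hf _ i); rewrite !mxE !eqxx/= mulr1 xi opprK addKr.
  by rewrite (ger0_norm (ltW r1)) ltrDl.
Qed.

Lemma test_fun_grad_continuous (f : E -> R) i : test_fun S f ->
  continuous (fun x => grad f x 0 i).
Proof.
move=> [sf _ _]; rewrite (_ : (fun x => _) = fun x => 'D_(delta_mx 0 i) f x).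
  exact: smooth_continuous (smooth_derive _ sf).
by apply/funext => x; rewrite mxE.
Qed.

Lemma integral_grad_cell (f : E -> R) i : test_fun S f ->
  \int[lebE]_(x in cell S) grad f x 0 i = 0.
Proof.
move=> tf; have [l [u [lu sub out per]]] := test_fun_box tf; have [sf _ _] := tf.
rewrite /Rintegral (_ : integral _ _ _ = 0%E)//.
transitivity (\int[lebE]_(x in half_open_box l u) ('D_(delta_mx 0 i) f x)%:E)%E.
  rewrite integral_mkcond [RHS]integral_mkcond; apply: eq_integral => x _.
  rewrite !patchE; case: ifPn => xc; case: ifPn => xb //.
  - by rewrite mxE.
  - rewrite out//; first exact/set_mem.
    by move=> H; move/negP : xb; apply; exact/mem_set.
  - by exfalso; move/negP : xc; apply; apply/mem_set/sub; exact/set_mem.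
apply: integral_derive_box => //.
- by move=> x; exact: smooth_derivable.
- exact: smooth_continuous (smooth_derive _ sf).
- exact: per.
Qed.

Section gibbs.
Variables (psi : E -> R) (gamma : probability E R).
Hypothesis hgamma : gibbs_measure S psi gamma.
Hypothesis spsi : smooth psi.

(* Locally the Gibbs density is bounded below, so that L^1(gamma) functions are
   Lebesgue integrable on bounded subsets of the cell. *)
Lemma integral_box_gibbs l u (g : E -> R) : @half_open_box R d l u `<=` cell S ->
  gamma.-integrable setT (EFin \o g) ->
  (\int[lebE]_(x in half_open_box l u) `|(g x)%:E| < +oo)%E.
Proof.
move=> sub ig; have [C C0 HC] := continuous_bounded_on (smooth_continuous spsi)
  (@compact_row_box R d l u).
have mB : measurable (@half_open_box R d l u) by exact: measurable_half_open_box.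
(* [C] bounds [psi] in absolute value on the box, so the density is at least [expR (- C)] there and
   Lebesgue measure at most [expR C] times [gamma]. *)
pose K : {nonneg R} := NngNum (ltW (expR_gt0 C)).
apply: (@le_lt_trans _ _ (\int[mscale K gamma]_(x in half_open_box l u) `|(g x)%:E|)%E).
  apply: le_measure_integral => // A mA AB.
  rewrite /mscale/= [X in (_ <= _ * X)%E](hgamma mA) (setIidl (subset_trans AB sub)).
  have mpsi : measurable_fun A (fun x => (expR (- psi x))%:E).
    apply/measurable_EFinP/measurable_funTS; apply: continuous_measurable_row => x.
    apply: continuous_comp; last exact: continuous_expR.
    by apply: continuousN; exact: smooth_continuous.
  apply: (@le_trans _ _ ((expR C)%:E * \int[lebE]_(x in A) (expR (- C))%:E)%E).
    rewrite integral_cst// muleA -EFinM -expRD subrr expR0 mul1e//.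
  apply: lee_wpmul2l; first by rewrite lee_fin expR_ge0.
  apply: ge0_le_integral => //.
  move=> x /AB Bx; rewrite lee_fin ler_expR lerN2.
  apply: le_trans (ler_norm _) _; apply: HC => i.
  by have /andP[-> /ltW ->] := Bx i.
have mg : measurable_fun setT (EFin \o g) by exact: measurable_int ig.
have mga : measurable_fun setT (fun x => `|(g x)%:E|%E) by exact: measurableT_comp.
rewrite ge0_integral_mscale//=; last exact: measurable_funS mga.
rewrite lte_mul_pinfty//.
have /integrableP[_] := ig; apply: le_lt_trans.
exact: ge0_subset_integral.
Qed.

Lemma Lfun2_gibbs_integrable (g : E -> R) : g \in Lfun gamma 2%:E ->
  gamma.-integrable setT (EFin \o g).
Proof.
move=> g2; apply/Lfun1_integrable; apply: Lfun_subset12 g2.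
exact: fin_num_measure.
Qed.

Lemma integrable_mul_grad (f g : E -> R) i : test_fun S f -> g \in Lfun gamma 2%:E ->
  lebE.-integrable (cell S) (fun x => (g x * grad f x 0 i)%:E).
Proof.
move=> tf g2; have [l [u [lu sub out per]]] := test_fun_box tf; have [sf _ _] := tf.
have [C C0 HC] := continuous_bounded_on (test_fun_grad_continuous (i := i) tf) (@compact_row_box R d l u).
have mg := Lfun2_meas g2.
have mf : measurable_fun setT (fun x => grad f x 0 i).
  by apply: continuous_measurable_row; exact: test_fun_grad_continuous.
have mB : measurable (@half_open_box R d l u) by exact: measurable_half_open_box.
apply/integrableP; split.
  by apply/measurable_EFinP/measurable_funTS; exact: measurable_funM.
apply: (@le_lt_trans _ _ (\int[lebE]_(x in half_open_box l u) (C%:E * `|(g x)%:E|))%E).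
  rewrite integral_mkcond [leRHS]integral_mkcond.
  apply: le_integral_no_meas => x _; rewrite !patchE; first by case: ifPn.
  case: ifPn => xc; last by case: ifPn => // _; rewrite -EFinM lee_fin mulr_ge0.
  case: ifPn => xb.
    rewrite -EFinM lee_fin normrM mulrC ler_wpM2r//; apply: HC => j.
    by have /andP[-> /ltW ->] := set_mem xb j.
  rewrite out ?mulr0 ?abse0//; first exact/set_mem.
  by move=> H; move/negP : xb; apply; exact/mem_set.
have mga : measurable_fun (@half_open_box R d l u) (fun x => `|(g x)%:E|%E).
  by apply: measurableT_comp => //; apply/measurable_EFinP/measurable_funTS.
rewrite (ge0_integralZl lebE mB mga)//.
by rewrite lte_mul_pinfty// integral_box_gibbs//; exact: Lfun2_gibbs_integrable.
Qed.

Lemma integrable_grad (f : E -> R) i : test_fun S f ->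
  lebE.-integrable (cell S) (EFin \o (fun x => grad f x 0 i)).
Proof.
move=> tf; have := integrable_mul_grad i tf (Lfun_cst gamma 1 2).
by under eq_fun do rewrite mul1r.
Qed.

(** The derivative of a test function has zero integral over the cell, so a constant does not affect
    the weak gradient. It lets the Poincare inequality, stated for zero mean, be applied to any
    function minus its average. *)
Lemma weak_grad_subC (g : E -> R) G (c : R) : g \in Lfun gamma 2%:E ->
  weak_grad S g G -> weak_grad S (fun x => g x - c) G.
Proof.
move=> g2 wg f tf i; rewrite -(wg f tf i).
have c2 : cst c \in Lfun gamma 2%:E by exact: Lfun_cst.
have := RintegralB measurable_cell (integrable_mul_grad i tf g2) (integrable_mul_grad i tf c2).
under [X in X = _ -> _]eq_Rintegral do rewrite -mulrBl.
move=> ->; rewrite (RintegralZl c measurable_cell (integrable_grad i tf)).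
by rewrite integral_grad_cell// mulr0 subr0.
Qed.

Lemma weak_grad_cst (c : R) : weak_grad S (cst c) (cst (0 : E)).
Proof.
move=> f tf i.
rewrite [X in _ = - X](_ : _ = 0); last first.
  by under eq_Rintegral do rewrite mxE mul0r; rewrite Rintegral_cst ?mul0r//; exact: measurable_cell.
rewrite oppr0 (RintegralZl c measurable_cell (integrable_grad i tf)).
by rewrite integral_grad_cell// mulr0.
Qed.

Lemma grad_bounded_L2 (L : R) : grad_phi_bounded S psi gamma L ->
  (\int[gamma]_x (dot (grad psi x) (grad psi x))%:E < +oo)%E.
Proof.
move=> HL; have H : H1 S gamma (cst 1) (cst (0 : E)).
  split; [exact: Lfun_cst|by move=> i; under eq_fun do rewrite mxE; exact: Lfun_cst|exact: weak_grad_cst].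
have n1 : (H1norm gamma (cst 1%R) (cst (0%R : E)) < +oo)%E.
  rewrite /H1norm L2norm_sqr L2vnorm_sqr.
  under eq_integral do rewrite /= expr1n.
  rewrite integral_cst// [X in (_ * X + _)%E](@probability_setT _ _ _ gamma) mule1 integral0_eq ?adde0.
    by rewrite -ge0_fin_numE ?sqrte_ge0// sqrte_fin_num.
  by move=> x _; rewrite /dot big1// => i _; rewrite mxE mul0r.
have HH : (L2vnorm gamma (grad psi) < +oo)%E.
  have := HL _ _ H; under eq_fun do rewrite scale1r.
  move/le_lt_trans; apply; have [L0|L0] := leP 0 L.
    by rewrite lte_mul_pinfty// lee_fin.
  apply: (@le_lt_trans _ _ 0%E); last exact: ltry.
  by apply: mule_le0_ge0; [rewrite lee_fin ltW|exact: sqrte_ge0].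
rewrite -L2vnorm_sqr expe2 lte_mul_pinfty ?Lnorm_ge0//.
by rewrite ge0_fin_numE ?Lnorm_ge0.
Qed.

(** The square is at most 1 plus the fourth power, and [gamma] has mass 1. *)
Lemma grad_psi_L2 :
  (\int[gamma]_x (enorm (grad psi x) ^+ 4)%:E < +oo)%E ->
  (\int[gamma]_x (dot (grad psi x) (grad psi x))%:E < +oo)%E.
Proof.
move=> H; apply: (@le_lt_trans _ _ (\int[gamma]_x (1 + (enorm (grad psi x) ^+ 4)%:E))%E).
  apply: le_integral_no_meas => x _; first by rewrite lee_fin dot_ge0.
  rewrite -EFinD lee_fin -enorm_sqr.
  have := sqr_ge0 (enorm (grad psi x) ^+ 2 - 1); rewrite sqrrB expr1n mulr1 -exprM/=.
  have := sqr_ge0 (enorm (grad psi x)); lra.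
have mG i : measurable_fun setT (fun x => grad psi x 0 i).
  apply: continuous_measurable_row.
  rewrite (_ : (fun x => _) = fun x => 'D_(delta_mx 0 i) psi x).
    exact: smooth_continuous (smooth_derive _ spsi).
  by apply/funext => x; rewrite mxE.
rewrite ge0_integralD//.
- by rewrite integral_cst// [X in (_ * X + _)%E](@probability_setT _ _ _ gamma) mule1 lte_add_pinfty// ltry.
- by move=> x _; rewrite lee_fin exprn_ge0// enorm_ge0.
- apply/measurable_EFinP; rewrite (_ : (fun x => _) = fun x => dot (grad psi x) (grad psi x) ^+ 2).
    by apply: measurable_funX; exact: measurable_dot.
  by apply/funext => x; rewrite -enorm_sqr -exprM.
Qed.

End gibbs.
End gibbs_test_functions.

(** * The diffusion term as an element of the dual of H^1(gamma) *)

Section dual_norm.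
Context (R : realType) (d : nat).
Local Notation E := 'rV[R]_d.

Lemma abs_dot_le (u v : E) : `|dot u v| <= enorm u * enorm v.
Proof.
rewrite -(ler_pXn2r (ltn0Sn 1)) ?nnegrE ?mulr_ge0 ?enorm_ge0//.
by rewrite real_normK ?num_real// exprMn !enorm_sqr dot_cauchy.
Qed.

Lemma measurable_enorm d0 (T : measurableType d0) (G : T -> E) :
  (forall i, measurable_fun setT (fun x => G x 0 i)) ->
  measurable_fun setT (fun x => enorm (G x)).
Proof.
move=> mG; apply: (measurableT_comp (f := @Num.sqrt R)).
  by apply: continuous_measurable_fun; exact: sqrt_continuous.
exact: measurable_dot.
Qed.

Lemma integrable_dot d0 (T : measurableType d0) (m : {measure set T -> \bar R}) (G F : T -> E) :
  L2vec m G -> L2vec m F -> m.-integrable setT (EFin \o (fun x => dot (G x) (F x))).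
Proof.
move=> G2 F2; rewrite (_ : _ \o _ = fun x => \sum_(i < d) (G x 0 i * F x 0 i)%:E)%E; last first.
  by apply/funext => x; rewrite /= sumEFin.
apply: integrable_sum => // i _; apply/Lfun1_integrable.
exact: Lfun2_mul_Lfun1.
Qed.

Lemma abs_fine_le (x : \bar R) : (`|fine x|%:E <= `|x|)%E.
Proof. by case: x => [r||] //=; rewrite normr0 leey. Qed.

Variables (V : base_space R) (gamma : probability E R).

(** Cauchy-Schwarz for vectors, then Hoelder with both exponents 2. No integrability is required, as
    [fine] sends an infinite integral to 0. *)
Lemma abs_integral_dot_le (G F : E -> E) :
  (forall i, measurable_fun setT (fun x => G x 0 i)) ->
  (forall i, measurable_fun setT (fun x => F x 0 i)) ->
  (`|\int[gamma]_v dot (G v) (F v)|%:E <= L2vnorm gamma G * L2vnorm gamma F)%E.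
Proof.
move=> mG mF; apply: le_trans (abs_fine_le _) _.
have md : measurable_fun setT (fun v => dot (G v) (F v)) by exact: measurable_dot.
have md' : measurable_fun setT (EFin \o (fun v => dot (G v) (F v))).
  exact/measurable_EFinP.
apply: le_trans (le_abse_integral gamma measurableT md') _.
have half : 2^-1 + 2^-1 = 1 :> R by rewrite -div1r -splitr.
apply: le_trans (hoelder gamma (measurable_enorm mG) (measurable_enorm mF)
  (ltr0Sn R 1) (ltr0Sn R 1) half).
rewrite Lnorm1; apply: le_integral_no_meas => v _ //=.
by rewrite lee_fin normrM !(ger0_norm (enorm_ge0 _)) abs_dot_le.
Qed.

(** The functional [- xi grad_v^* grad_v h] written in weak form, [G1] being the velocity gradient
    of [h] and [Gv] that of the function it is applied to. *)
Definition diffusion_form (xi : R) (G1 : E -> E) (_ : E -> R) (Gv : E -> E) : R :=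
  - xi * \int[gamma]_v dot (G1 v) (Gv v).

Variables (xi : R) (G1 : E -> E).
Hypothesis xi0 : 0 <= xi.
Hypothesis mG1 : forall i, measurable_fun setT (fun v => G1 v 0 i).

Lemma Hm1norm_diffusion :
  (Hm1norm V gamma (diffusion_form xi G1) ^+ 2 <=
   (xi ^+ 2)%:E * \int[gamma]_v (dot (G1 v) (G1 v))%:E)%E.
Proof.
rewrite -L2vnorm_sqr.
rewrite (_ : (_ * _ = (xi%:E * L2vnorm gamma G1) ^+ 2)%E); last first.
  by rewrite !expe2 muleACA -EFinM.
set N := Hm1norm _ _ _.
have N_le : (N <= xi%:E * L2vnorm gamma G1)%E.
  apply/ereal_supP => _ [g [Gv [[g2 Gv2 _] H1le ->]]].
  rewrite /diffusion_form normrM normrN (ger0_norm xi0) EFinM; apply: lee_wpmul2l; first by rewrite lee_fin.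
  have [mGv _] := (L2vecP gamma Gv).1 Gv2.
  apply: le_trans (abs_integral_dot_le mG1 mGv) _.
  rewrite -[leRHS]mule1; apply: lee_wpmul2l; first exact: Lnorm_ge0.
  have : (L2vnorm gamma Gv ^+ 2 <= 1 ^+ 2)%E.
    apply: (@le_trans _ _ (H1norm gamma g Gv ^+ 2)%E).
      rewrite /H1norm sqr_sqrte; last by rewrite adde_ge0// expe_ge0// Lnorm_ge0.
      by rewrite leeDr// expe_ge0// Lnorm_ge0.
    by rewrite lee_sqr// sqrte_ge0.
  by apply: lee_sqrE.
rewrite lee_sqr//; last by rewrite mule_ge0 ?lee_fin// Lnorm_ge0.
(* Squaring the bound needs the supremum to be nonnegative, which the zero function provides. *)
have z2 : (fun _ : E => 0 : R) \in Lfun gamma 2%:E by exact: Lfun_cst.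
apply: ereal_sup_ubound; exists (fun=> 0), (fun=> 0); split.
- split => //; first by move=> i; under eq_fun do rewrite mxE.
  by move=> f _ i; under eq_Rintegral do rewrite mul0r;
    under [in RHS]eq_Rintegral do rewrite mxE mul0r; rewrite /Rintegral integral0 oppr0.
- rewrite /H1norm L2norm_sqr L2vnorm_sqr !integral0_eq.
  + by rewrite adde0 sqrte0 lee01.
  + by move=> x _; rewrite /dot big1// => i _; rewrite mxE mul0r.
  + by move=> x _; rewrite expr0n.
- rewrite /diffusion_form /Rintegral integral0_eq ?mulr0 ?normr0// => x _.
  by rewrite /dot big1// => i _; rewrite mxE mulr0.
Qed.

Lemma in_Hm1_diffusion : (\int[gamma]_v (dot (G1 v) (G1 v))%:E < +oo)%E ->
  in_Hm1 V gamma (diffusion_form xi G1).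
Proof.
move=> Gfin; have G12 : L2vec gamma G1 by apply/L2vecP.
split.
  move=> a g Ga g' Gb [_ Ga2 _] [_ Gb2 _].
  rewrite /diffusion_form; under eq_Rintegral do rewrite dot_addr dot_scaler.
  have ia := integrable_dot G12 Ga2; have ib := integrable_dot G12 Gb2.
  rewrite RintegralD//; last exact: (integrableZl measurableT a ia).
  by rewrite RintegralZl// mulrDr mulrCA.
set N := Hm1norm _ _ _.
have : (N ^+ 2 < +oo)%E.
  by apply: le_lt_trans Hm1norm_diffusion _; rewrite lte_mul_pinfty// lee_fin sqr_ge0.
by case: N => [r _||]//; rewrite ltry.
Qed.

End dual_norm.

(** * A dominating function, integrable on bounded time windows *)

Section energy_weight.
Context (R : realType) (d : nat).
Local Notation E := 'rV[R]_d.
Local Notation leb := (@lebesgue_measure R).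

Lemma ge0_integrable d0 (T : measurableType d0) (m : {measure set T -> \bar R})
    (D : set T) (f : T -> R) : measurable_fun setT f -> (forall x, 0 <= f x) ->
  (\int[m]_(x in D) (f x)%:E < +oo)%E -> m.-integrable D (EFin \o f).
Proof.
move=> mf f0 fi; apply/integrableP; split; first exact/measurable_EFinP/measurable_funTS.
by under eq_integral do rewrite gee0_abs ?lee_fin//.
Qed.

Lemma smooth_grad_measurable (f : E -> R) i : smooth f ->
  measurable_fun setT (fun x => grad f x 0 i).
Proof.
move=> sf; apply: continuous_measurable_row.
rewrite (_ : (fun x => _) = fun x => 'D_(delta_mx 0 i) f x).
  exact: smooth_continuous (smooth_derive _ sf).
by apply/funext => x; rewrite mxE.
Qed.

Variables (phi psi : E -> R) (mu gamma : probability E R).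
Hypotheses (sphi : smooth phi) (spsi : smooth psi).
Hypothesis gphi : (\int[mu]_x (dot (grad phi x) (grad phi x))%:E < +oo)%E.
Hypothesis gpsi : (\int[gamma]_v (dot (grad psi v) (grad psi v))%:E < +oo)%E.

Local Notation Txv := (ThetaXV mu gamma).
Local Notation P := (leb \x Txv)%E.

Lemma integral_Theta_v (f : E -> \bar R) : measurable_fun setT f -> (forall v, 0 <= f v)%E ->
  (\int[Txv]_z f z.2 = \int[gamma]_v f v)%E.
Proof.
move=> mf f0; rewrite [LHS](@fubini_tonelli1 _ _ E E R mu gamma (fun z => f z.2))//.
  rewrite /fubini_F/= (_ : (fun x => _) = cst (\int[gamma]_v f v)%E)//.
  by rewrite integral_cst// [X in (_ * X)%E](@probability_setT _ _ _ mu) mule1.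
exact: (measurableT_comp mf measurable_snd).
Qed.

Lemma integral_Theta_x (f : E -> \bar R) : measurable_fun setT f -> (forall v, 0 <= f v)%E ->
  (\int[Txv]_z f z.1 = \int[mu]_v f v)%E.
Proof.
move=> mf f0; rewrite [LHS](@fubini_tonelli1 _ _ E E R mu gamma (fun z => f z.1))//.
  rewrite /fubini_F/=; apply: eq_integral => x _.
  by rewrite integral_cst// [X in (_ * X)%E](@probability_setT _ _ _ gamma) mule1.
exact: (measurableT_comp mf measurable_fst).
Qed.

Variables (h : R * (E * E) -> R) (G : R * (E * E) -> E).
Hypothesis mh : measurable_fun setT h.
Hypothesis mG : measurable_fun setT G.
Variable M : R.
Hypothesis hM : {ae leb, forall t, 0 <= t -> (L2norm Txv (fun z => h (t, z)) <= M%:E)%E}.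
Hypothesis GL2 : (\int[leb]_(t in `[0%R, +oo[) L2vnorm Txv (fun z => G (t, z)) ^+ 2 < +oo)%E.

(** The integrands of the weak formulation are, up to bounded test functions, [h], [G] or products
    of [h] with a gradient of [phi] or [psi]; each is bounded by a multiple of this sum of
    squares. *)
Definition weight (p : R * (E * E)) : R :=
  1 + h p ^+ 2 + dot (grad psi p.2.2) (grad psi p.2.2)
  + dot (grad phi p.2.1) (grad phi p.2.1) + dot (G p) (G p).

Let mGi i : measurable_fun setT (fun p => G p 0 i).
Proof. exact: measurable_row. Qed.

Let mpsi : measurable_fun setT (fun v : E => (dot (grad psi v) (grad psi v))%:E).
Proof. by apply/measurable_EFinP; apply: measurable_dot => i; exact: smooth_grad_measurable. Qed.

Let mphi : measurable_fun setT (fun v : E => (dot (grad phi v) (grad phi v))%:E).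
Proof. by apply/measurable_EFinP; apply: measurable_dot => i; exact: smooth_grad_measurable. Qed.

Let itv_fin (a b : R) : (leb `[a, b]%classic < +oo)%E.
Proof. by rewrite lebesgue_measure_itv/= lte_fin; case: ifP; rewrite ?ltry. Qed.

Let itv0 (a b : R) : 0 <= a -> `[a, b]%classic `<=` `[0%R, +oo[%classic.
Proof.
by move=> a0 x /=; rewrite !in_itv/= andbT => /andP[ax _]; exact: le_trans ax.
Qed.

Lemma integral_strip_h2 a b : 0 <= a ->
  (\int[P]_(p in `[a, b]%classic `*` setT) (h p ^+ 2)%:E < +oo)%E.
Proof.
move=> a0; have mh2 : measurable_fun setT (fun p => (h p ^+ 2)%:E).
  by apply/measurable_EFinP; exact: measurable_funX.
rewrite (ge0_integral_strip Txv)//; last by move=> p; rewrite lee_fin sqr_ge0.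
apply: (@le_lt_trans _ _ (\int[leb]_(s in `[a, b]) (cst (M ^+ 2)%:E s))%E); last first.
  rewrite integral_cst//; apply: lte_mul_pinfty => //; last exact: itv_fin.
  by rewrite lee_fin sqr_ge0.
apply: ae_ge0_le_integral => //.
- by move=> s _; apply: integral_ge0 => z _; rewrite lee_fin sqr_ge0.
- apply: measurable_funTS.
  exact: (@measurable_partial_integral _ _ (measurableTypeR R) _ R Txv (fun p => (h p ^+ 2)%:E)).
- by move=> s _; rewrite lee_fin sqr_ge0.
- case: hM => N [mN N0 HN]; exists N; split => //; apply: subset_trans HN.
  apply: subsetC => s /= Hs sab.
  have s0 : 0 <= s by have := itv0 a0 sab; rewrite /= in_itv/= andbT.
  rewrite -L2norm_sqr EFin_expe; have H := Hs s0.
  have M0 : (0 <= M%:E)%E by exact: le_trans (Lnorm_ge0 _ _ _) H.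
  by rewrite lee_sqr// Lnorm_ge0.
Qed.

Lemma integral_strip_G2 a b : 0 <= a ->
  (\int[P]_(p in `[a, b]%classic `*` setT) (dot (G p) (G p))%:E < +oo)%E.
Proof.
move=> a0; have mG2 : measurable_fun setT (fun p => (dot (G p) (G p))%:E).
  by apply/measurable_EFinP; exact: measurable_dot.
rewrite (ge0_integral_strip Txv)//; last by move=> p; rewrite lee_fin dot_ge0.
apply: le_lt_trans GL2; under [leRHS]eq_integral do rewrite L2vnorm_sqr.
apply: ge0_subset_integral => //.
- apply: measurable_funTS.
  exact: (@measurable_partial_integral _ _ (measurableTypeR R) _ R Txv (fun p => (dot (G p) (G p))%:E)).
- by move=> s _; apply: integral_ge0 => z _; rewrite lee_fin dot_ge0.
- exact: itv0.
Qed.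

Lemma integral_strip_z (f : E * E -> \bar R) a b : measurable_fun setT f ->
  (forall z, 0 <= f z)%E -> (\int[Txv]_z f z < +oo)%E ->
  (\int[P]_(p in `[a, b]%classic `*` setT) f p.2 < +oo)%E.
Proof.
move=> mf f0 fi; rewrite (@ge0_integral_strip _ _ R Txv _ (fun p => f p.2))//.
  rewrite (_ : integral _ _ _ = \int[leb]_(s in `[a, b]) (cst (\int[Txv]_z f z) s))%E//.
  rewrite integral_cst//; apply: lte_mul_pinfty; last exact: itv_fin.
    exact: integral_ge0.
  by rewrite ge0_fin_numE//; exact: integral_ge0.
exact: (measurableT_comp mf measurable_snd).
Qed.

Lemma integrable_weight a b : 0 <= a ->
  P.-integrable (`[a, b]%classic `*` setT) (EFin \o weight).
Proof.
move=> a0.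
have mS : measurable (`[a, b]%classic `*` setT : set (measurableTypeR R * (E * E))).
  exact: measurable_strip.
have i1 : P.-integrable (`[a, b]%classic `*` setT) (EFin \o (fun=> 1)).
  apply: ge0_integrable => //.
  apply: (@integral_strip_z (cst 1%E)) => //.
  by rewrite integral_cst// [X in (_ * X)%E](@probability_setT _ _ _ Txv) mule1 ltry.
have i2 : P.-integrable (`[a, b]%classic `*` setT) (EFin \o (fun p => h p ^+ 2)).
  apply: ge0_integrable; [exact: measurable_funX|by move=> p; rewrite sqr_ge0|].
  exact: integral_strip_h2.
have i3 : P.-integrable (`[a, b]%classic `*` setT)
    (EFin \o (fun p => dot (grad psi p.2.2) (grad psi p.2.2))).
  apply: ge0_integrable; [|by move=> p; exact: dot_ge0|].
    apply: (measurableT_comp (proj1 (measurable_EFinP _ _) mpsi)).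
    exact: measurableT_comp measurable_snd measurable_snd.
  apply: (@integral_strip_z (fun z => (dot (grad psi z.2) (grad psi z.2))%:E)).
  - exact: (measurableT_comp mpsi measurable_snd).
  - by move=> z; rewrite lee_fin dot_ge0.
  - by rewrite (@integral_Theta_v (fun v => (dot (grad psi v) (grad psi v))%:E)) => // v;
      rewrite lee_fin dot_ge0.
have i4 : P.-integrable (`[a, b]%classic `*` setT)
    (EFin \o (fun p => dot (grad phi p.2.1) (grad phi p.2.1))).
  apply: ge0_integrable; [|by move=> p; exact: dot_ge0|].
    apply: (measurableT_comp (proj1 (measurable_EFinP _ _) mphi)).
    exact: measurableT_comp measurable_fst measurable_snd.
  apply: (@integral_strip_z (fun z => (dot (grad phi z.1) (grad phi z.1))%:E)).
  - exact: (measurableT_comp mphi measurable_fst).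
  - by move=> z; rewrite lee_fin dot_ge0.
  - by rewrite (@integral_Theta_x (fun v => (dot (grad phi v) (grad phi v))%:E)) => // v;
      rewrite lee_fin dot_ge0.
have i5 : P.-integrable (`[a, b]%classic `*` setT) (EFin \o (fun p => dot (G p) (G p))).
  apply: ge0_integrable; [exact: measurable_dot|by move=> p; exact: dot_ge0|].
  exact: integral_strip_G2.
exact: (integrableD mS (integrableD mS (integrableD mS (integrableD mS i1 i2) i3) i4) i5).
Qed.

End energy_weight.

(** * Iterated integrals of real functions of any sign *)

Section iterated_real.
Context d1 d2 d3 (T1 : measurableType d1) (T2 : measurableType d2)
  (T3 : measurableType d3) (R : realType).
Variables (m1 : probability T1 R) (m2 : probability T2 R) (m3 : probability T3 R).

Let m12 : probability (T1 * T2)%type R := (m1 \x m2)%E.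
Let m23 : probability (T2 * T3)%type R := (m2 \x m3)%E.

Let passoc (q : (T1 * T2) * T3) : T1 * (T2 * T3) := (q.1.1, (q.1.2, q.2)).

Let ge0_passoc (k : T1 * (T2 * T3) -> \bar R) :
  measurable_fun setT k -> (forall p, 0 <= k p)%E ->
  (\int[(m12 \x m3)%E]_q k (passoc q) = 1%:E * \int[(m1 \x m23)%E]_p k p)%E.
Proof.
move=> mk k0; rewrite mul1e [RHS](ge0_integral_prodA m1 m2 m3 mk k0).
have mk' : measurable_fun setT (k \o passoc).
  by apply: (measurableT_comp mk); exact: measurable_prodA.
rewrite [LHS](@fubini_tonelli1 _ _ (T1 * T2)%type T3 R m12 m3 (k \o passoc))//.
by move=> q; exact: k0.
Qed.

(** The inner integral is truncated to a real by [fine], which changes it only on a null set, since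
    by Fubini it is finite almost everywhere. *)
Lemma Rintegral_prodA (f : T1 * (T2 * T3) -> R) :
  measurable_fun setT f -> (m1 \x m23)%E.-integrable setT (EFin \o f) ->
  m12.-integrable setT (EFin \o (fun p => \int[m3]_v f (p.1, (p.2, v)))) /\
  \int[m12]_p \int[m3]_v f (p.1, (p.2, v)) = \int[(m1 \x m23)%E]_p f p.
Proof.
move=> mf fi; have mf' : measurable_fun setT (EFin \o f) by exact/measurable_EFinP.
pose g := EFin \o (f \o passoc).
have mg : measurable_fun setT g.
  by apply: (measurableT_comp mf'); exact: measurable_prodA.
have gi : (m12 \x m3)%E.-integrable setT g.
  apply/integrableP; split => //.
  have := @ge0_passoc (fun p => `|(f p)%:E|%E).
  rewrite mul1e => -> //; first by case/integrableP : fi.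
  exact: measurableT_comp.
have gE : (\int[(m12 \x m3)%E]_q g q = \int[(m1 \x m23)%E]_p (f p)%:E)%E.
  have := @integral_transfer _ _ R _ _ (m12 \x m3)%E (m1 \x m23)%E setT setT 1 passoc
    (EFin \o f) mf' ge0_passoc fi measurableT.
  by rewrite mul1e.
have Fi := @integrable_fubini_F _ _ (T1 * T2)%type T3 R m12 m3 g gi.
have FE := @integral12_prod_meas1 _ _ (T1 * T2)%type T3 R m12 m3 g gi.
have mF := measurable_int _ Fi.
have mr : measurable_fun setT (EFin \o (fun p : T1 * T2 => \int[m3]_v f (p.1, (p.2, v)))).
  apply/measurable_EFinP.
  by apply: (@measurable_partial_Rintegral _ _ (T1 * T2)%type T3 R m3 (f \o passoc));
    apply: (measurableT_comp mf); exact: measurable_prodA.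
have ae : ae_eq m12 setT (fubini_F m3 g) (EFin \o (fun p => \int[m3]_v f (p.1, (p.2, v)))).
  have [N [mN N0 HN]] := integrable_ae measurableT Fi; exists N; split => //.
  apply: subset_trans HN; apply: subsetC => p /= Hp _.
  by rewrite /Rintegral fineK//; exact: Hp.
split.
  apply/integrableP; split => //; have /integrableP[_] := Fi; apply: le_lt_trans.
  rewrite (ae_eq_integral (fun p => `|fubini_F m3 g p|)%E)//.
  - exact: measurableT_comp.
  - exact: measurableT_comp.
  - have [N [mN N0 HN]] := ae; exists N; split => //.
    apply: subset_trans HN; apply: subsetC => p /= Hp _.
    by rewrite Hp.
rewrite {1}/Rintegral [in RHS]/Rintegral -gE -FE; congr fine.
exact/esym/ae_eq_integral.
Qed.

End iterated_real.

(** * Pointwise bounds by the weight *)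

Section domination.
Context (R : realType) (d : nat).
Local Notation E := 'rV[R]_d.

Lemma dot_coor_bound (u : E) (C : R) : 0 <= C -> (forall i, `|u 0 i| <= C) ->
  enorm u <= d.+1%:R * C.
Proof.
move=> C0 H; rewrite -(ler_pXn2r (ltn0Sn 1)) ?nnegrE ?mulr_ge0 ?enorm_ge0//.
rewrite enorm_sqr; apply: (@le_trans _ _ (\sum_(i < d) C ^+ 2)).
  apply: ler_sum => i _; rewrite -expr2 -real_normK ?num_real//.
  by rewrite ler_pXn2r ?nnegrE.
rewrite sumr_const card_ord exprMn -[X in X <= _]mulr_natl ler_wpM2r ?sqr_ge0//.
by rewrite -natrX ler_nat (leq_trans (leqnSn d))// leq_pmulr.
Qed.

Variables (phi psi : E -> R) (h : R * (E * E) -> R) (G : R * (E * E) -> E).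
Local Notation W := (weight phi psi h G).

Lemma flux_le_weight (a : R) (gx gv : E) (p : R * (E * E)) (c : R) : 0 <= c ->
  `|a| <= c -> enorm gx <= c -> enorm gv <= c ->
  `|h p * (a + (dot (grad psi p.2.2) gx - dot (grad phi p.2.1) gv))| <= 2 * c * W p.
Proof.
move=> c0 ac xc vc; rewrite normrM.
have dx : `|dot (grad psi p.2.2) gx| <= enorm (grad psi p.2.2) * c.
  by apply: le_trans (abs_dot_le _ _) _; rewrite ler_wpM2l// enorm_ge0.
have dv : `|dot (grad phi p.2.1) gv| <= enorm (grad phi p.2.1) * c.
  by apply: le_trans (abs_dot_le _ _) _; rewrite ler_wpM2l// enorm_ge0.
apply: (@le_trans _ _ (`|h p| * (c + (enorm (grad psi p.2.2) * c + enorm (grad phi p.2.1) * c)))).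
  rewrite ler_wpM2l//; apply: le_trans (ler_normD _ _) _; apply: lerD => //.
  by apply: le_trans (ler_normB _ _) _; exact: lerD.
rewrite /weight -!enorm_sqr -[h p ^+ 2]real_normK ?num_real//.
have e0 := sqr_ge0 (enorm (G p)).
move: (enorm _) (enorm (grad phi _)) `|h p| (enorm (G p) ^+ 2) e0 => x y k e e0.
(* The cross terms [k], [k * x] and [k * y] are completed into squares, which displays the
   difference as nonnegative. *)
rewrite -subr_ge0 (_ : _ - _ = c * (((1 - k) ^+ 2 + (k - x) ^+ 2 + (k - y) ^+ 2) / 2
  + (k ^+ 2 + 3 * x ^+ 2 + 3 * y ^+ 2 + 3) / 2 + 2 * e)); last by field.
apply: mulr_ge0 => //.
have := sqr_ge0 (1 - k); have := sqr_ge0 (k - x); have := sqr_ge0 (k - y).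
have := sqr_ge0 k; have := sqr_ge0 x; have := sqr_ge0 y; lra.
Qed.

Lemma diffusion_le_weight (gv : E) (p : R * (E * E)) (c : R) : 0 <= c ->
  enorm gv <= c -> `|dot (G p) gv| <= c * W p.
Proof.
move=> c0 vc; apply: le_trans (abs_dot_le _ _) _.
apply: (@le_trans _ _ (enorm (G p) * c)); first by rewrite ler_wpM2l// enorm_ge0.
rewrite mulrC ler_wpM2l// /weight -!enorm_sqr.
have := sqr_ge0 (h p); have := sqr_ge0 (enorm (grad psi p.2.2)).
have := sqr_ge0 (enorm (grad phi p.2.1)); have := sqr_ge0 (enorm (G p) - 1).
rewrite sqrrB expr1n mulr1; have := enorm_ge0 (G p); have := sqr_ge0 (enorm (G p)); lra.
Qed.

End domination.

(** * A translated solution belongs to H^1_kin *)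

Section kinetic_solution.
Context (R : realType) (d : nat).
Local Notation E := 'rV[R]_d.
Local Notation leb := (@lebesgue_measure R).
Variables (X V : base_space R) (phi psi : E -> R) (mu gamma : probability E R).
Hypotheses (sphi : smooth phi) (spsi : smooth psi).
Hypothesis gphi : (\int[mu]_x (dot (grad phi x) (grad phi x))%:E < +oo)%E.
Hypothesis gpsi : (\int[gamma]_v (dot (grad psi v) (grad psi v))%:E < +oo)%E.
Local Notation Txv := (ThetaXV mu gamma).
Local Notation P := (leb \x Txv)%E.

Variables (xi : R) (h0 : E * E -> R) (h : R * (E * E) -> R) (G : R * (E * E) -> E).
Hypothesis xi0 : 0 < xi.
Hypothesis mh : measurable_fun setT h.
Hypothesis mG : measurable_fun setT G.
Variable M : R.
Hypothesis hM : {ae leb, forall t, 0 <= t -> (L2norm Txv (fun z => h (t, z)) <= M%:E)%E}.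
Hypothesis GL2 : (\int[leb]_(t in `[0%R, +oo[) L2vnorm Txv (fun z => G (t, z)) ^+ 2 < +oo)%E.
Local Notation W := (weight phi psi h G).

Definition flux (f : R * (E * E) -> R) p : R := h p * (dt f p + transport phi psi f p).
Definition dissipation (f : R * (E * E) -> R) p : R := dot (G p) (grad_v f p).

Hypothesis weak : forall f, test_fun_txv `]-oo, +oo[ X V f ->
  \int[P]_(p in `[0%R, +oo[ `*` setT) (flux f p - xi * dissipation f p)
  + \int[Txv]_z (h0 z * f (0, z)) = 0.

Let mGi i : measurable_fun setT (fun p => G p 0 i).
Proof. exact: measurable_row. Qed.

Lemma test_flux (J : interval R) f : test_fun_txv J X V f -> exists a b c,
  [/\ `[a, b] `<=` [set` J], 0 <= c,
    measurable_fun setT (flux f) /\ measurable_fun setT (dissipation f),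
    (forall p, ~~ (a <= p.1 <= b) -> [/\ f p = 0, flux f p = 0 & dissipation f p = 0]) &
    forall p, [/\ `|f p| <= c, `|flux f p| <= 2 * c * W p & `|dissipation f p| <= c * W p]].
Proof.
move=> tf; have [a [b [C [ab C0 [mf mt mx mv] out bnd]]]] := test_fun_bounds tf.
exists a, b, (d.+1%:R * C); have c0 : 0 <= d.+1%:R * C by rewrite mulr_ge0.
have Cc : C <= d.+1%:R * C by rewrite -[X in X <= _]mul1r ler_wpM2r// ler1n.
split => //.
- split; last exact: measurable_dot.
  apply: measurable_funM => //; apply: measurable_funD => //.
  apply: measurable_funB; apply: measurable_dot => i.
  + apply: (measurableT_comp (smooth_grad_measurable i spsi)).
    exact: measurableT_comp measurable_snd measurable_snd.
  + exact: mx.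
  + apply: (measurableT_comp (smooth_grad_measurable i sphi)).
    exact: measurableT_comp measurable_fst measurable_snd.
  + exact: mv.
- move=> p /out[f0 t0 x0 v0]; split => //.
    rewrite /flux t0 /transport x0 v0 /dot !big1 ?subr0 ?addr0 ?mulr0// => i _;
    by rewrite [X in _ * X]mxE mulr0.
  by rewrite /dissipation v0 /dot big1// => i _; rewrite [X in _ * X]mxE mulr0.
- move=> p; have [Hf Ht Hx Hv] := bnd p; split.
  + exact: le_trans Cc.
  + apply: flux_le_weight => //; first exact: le_trans Cc.
      exact: dot_coor_bound.
    exact: dot_coor_bound.
  + by apply: diffusion_le_weight => //; exact: dot_coor_bound.
Qed.

Lemma integrable_le_weight a b c (f : R * (E * E) -> R) : 0 <= a -> measurable_fun setT f ->
  (forall p, `|f p| <= c * W p) ->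
  P.-integrable (`[a, b]%classic `*` setT) (EFin \o f).
Proof.
move=> a0 mf H.
have mS : measurable (`[a, b]%classic `*` setT : set (measurableTypeR R * (E * E))).
  exact: measurable_strip.
apply: le_integrable (integrableZl mS c (integrable_weight sphi spsi gphi gpsi mh mG hM GL2 b a0)) => //.
  by apply/measurable_EFinP; exact: measurable_funTS.
move=> p _; rewrite /= lee_fin; apply: le_trans (H p) _; exact: ler_norm.
Qed.

Lemma Rintegral_support d0 (T : measurableType d0) (m : {measure set T -> \bar R})
    (D D' : set T) (f : T -> R) : D `<=` D' ->
  (forall x, D' x -> ~ D x -> f x = 0) -> \int[m]_(x in D') f x = \int[m]_(x in D) f x.
Proof.
move=> DD' H; rewrite Rintegral_mkcond [RHS]Rintegral_mkcond.
apply: eq_Rintegral => x _; rewrite !patchE; case: ifPn => xD'; case: ifPn => xD //.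
- by apply: H; [exact/set_mem|move=> Dx; move/negP : xD; apply; exact/mem_set].
- by exfalso; move/negP : xD'; apply; apply/mem_set/DD'; exact/set_mem.
Qed.

Variables (tau : R) (tau0 : 0 < tau) (t : R).
Hypothesis t0 : 0 <= t.
Hypothesis wG : {ae (leb \x mu)%E, forall p, 0 <= p.1 -> weak_grad V
  (fun v => h (p.1, (p.2, v))) (fun v => G (p.1, (p.2, v)))}.

(** The solution is composed with [time_shift], which brings the window [[t, t + tau]] to
    [[0, tau]]; test functions on []0, tau[] are composed with the inverse [time_unshift], and so
    become test functions for the equation. *)
Definition time_shift (p : R * (E * E)) : R * (E * E) := (p.1 + t, p.2).
Definition time_unshift (p : R * (E * E)) : R * (E * E) := (p.1 - t, p.2).

Lemma measurable_time_shift : measurable_fun setT time_shift.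
Proof.
apply: measurable_fun_pair => //.
by apply: measurable_funD => //; exact: measurable_fst.
Qed.

Lemma test_fun_unshift f : test_fun_txv `]0, tau[ X V f ->
  test_fun_txv `]-oo, +oo[ X V (f \o time_unshift).
Proof.
move=> [sf pX pV [a [b [r [_ H]]]]]; split.
- apply: (@smooth_linear R _ _ time_unshift f ((- t, 0) : R * (E * E))) => //.
    move=> [s z]; apply: (@cvg_pair _ _ _ (nbhs (s, z)) (nbhs (s - t)) (nbhs z)).
      by apply: cvgB; [exact: cvg_fst|exact: cvg_cst].
    exact: cvg_snd.
  move=> k [w1 w2] [x1 x2]; congr (_, _).
    rewrite /time_unshift/= opprK addrNK addrA; reflexivity.
  by rewrite /= subr0.
- by move=> s v; exact: (pX (s - t) v).
- by move=> s x; exact: (pV (s - t) x).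
- exists (a + t), (b + t), r; split => // s x v fs.
  have [/andP[h1 h2] hx hv] := H (s - t) x v fs; split => //.
  by apply/andP; split; lra.
Qed.

Lemma dt_unshift f p : dt (f \o time_unshift) p = dt f (time_unshift p).
Proof.
rewrite /dt /derive.
rewrite (_ : (fun k : R => k^-1 *: (((fun s : R => (f \o time_unshift) (s, p.2)) \o shift p.1) (k *: (1 : R)) -
    (f \o time_unshift) (p.1, p.2))) =
  (fun k : R => k^-1 *: (((fun s : R => f (s, (time_unshift p).2)) \o shift (time_unshift p).1) (k *: (1 : R)) -
    f ((time_unshift p).1, (time_unshift p).2))))//.
by apply/funext => k /=; rewrite /time_unshift/= addrA.
Qed.

Local Notation UT := (uniform_prob tau0 \x Txv)%E.
Local Notation strip := (`[t, t + tau]%classic `*` [set: E * E]).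

Let Gs (p : R * E) (v : E) : E := G (time_shift (p.1, (p.2, v))).

Let mGs i : measurable_fun setT (fun p => G (time_shift p) 0 i).
Proof. exact: (measurableT_comp (mGi i) measurable_time_shift). Qed.

Let mGsv p i : measurable_fun setT (fun v => Gs p v 0 i).
Proof.
by apply: (measurableT_comp (mGs i)); exact: measurable_fun_pair.
Qed.

Let mG2 : measurable_fun setT (fun p => (dot (G p) (G p))%:E).
Proof. by apply/measurable_EFinP; exact: measurable_dot. Qed.

Lemma integral_shift_G2 :
  (\int[UT]_p (dot (G (time_shift p)) (G (time_shift p)))%:E =
   (tau^-1)%:E * \int[P]_(p in strip) (dot (G p) (G p))%:E)%E.
Proof.
rewrite -(@ge0_integral_uniform_prod _ _ R Txv t tau tau0 (fun p => (dot (G p) (G p))%:E))//.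
by move=> p; rewrite lee_fin dot_ge0.
Qed.

Lemma integral_shift_G2_iter :
  (\int[Umu mu tau0]_p \int[gamma]_v (dot (Gs p v) (Gs p v))%:E =
   (tau^-1)%:E * \int[P]_(p in strip) (dot (G p) (G p))%:E)%E.
Proof.
rewrite -integral_shift_G2; apply/esym.
apply: (@ge0_integral_prodA _ _ _ (measurableTypeR R) E E R (uniform_prob tau0) mu gamma
  (fun p => (dot (G (time_shift p)) (G (time_shift p)))%:E)).
  by apply/measurable_EFinP; exact: measurable_dot.
by move=> p; rewrite lee_fin dot_ge0.
Qed.

Lemma shift_G2_fin :
  ((tau^-1)%:E * \int[P]_(p in strip) (dot (G p) (G p))%:E < +oo)%E.
Proof.
rewrite lte_mul_pinfty//; first by rewrite lee_fin invr_ge0 ltW.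
exact: (integral_strip_G2 mG GL2 _ t0).
Qed.

Lemma Lfun_shift : h \o time_shift \in Lfun UT 2%:E.
Proof.
apply/Lfun2P; split; first exact: (measurableT_comp mh measurable_time_shift).
have := @ge0_integral_uniform_prod _ _ R Txv t tau tau0 (fun p => (h p ^+ 2)%:E).
move=> /= ->.
- rewrite lte_mul_pinfty//; first by rewrite lee_fin invr_ge0 ltW.
  exact: (integral_strip_h2 mh hM _ t0).
- by apply/measurable_EFinP; exact: measurable_funX.
- by move=> p; rewrite lee_fin sqr_ge0.
Qed.

Lemma Hm1norm_shift_le :
  (\int[Umu mu tau0]_p Hm1norm V gamma (diffusion_form gamma xi (Gs p)) ^+ 2 <=
   (xi ^+ 2)%:E * ((tau^-1)%:E * \int[P]_(p in strip) (dot (G p) (G p))%:E))%E.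
Proof.
rewrite -integral_shift_G2_iter -ge0_integralZl//.
- apply: le_integral_no_meas => p _; first exact: sqre_ge0.
  exact: Hm1norm_diffusion (ltW xi0) (mGsv p).
- apply: (@measurable_partial_integral _ _ (measurableTypeR R * E)%type E R gamma
    (fun q => (dot (G (time_shift (q.1.1, (q.1.2, q.2)))) (G (time_shift (q.1.1, (q.1.2, q.2)))))%:E)).
  apply: (measurableT_comp (f := fun p => (dot (G (time_shift p)) (G (time_shift p)))%:E)).
    by apply/measurable_EFinP; exact: measurable_dot.
  exact: measurable_prodA.
- by move=> p _; apply: integral_ge0 => v _; rewrite lee_fin dot_ge0.
- by rewrite lee_fin sqr_ge0.
Qed.

Lemma time_shiftK p : time_unshift (time_shift p) = p.
Proof. by case: p => s z; rewrite /time_unshift/= addrK. Qed.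

Lemma flux_unshift f p :
  flux (f \o time_unshift) (time_shift p) = h (time_shift p) * (dt f p + transport phi psi f p).
Proof.
rewrite /flux dt_unshift.
have -> : transport phi psi (f \o time_unshift) (time_shift p) =
  transport phi psi f (time_unshift (time_shift p)) by [].
by rewrite time_shiftK.
Qed.

Lemma dissipation_unshift f p :
  dissipation (f \o time_unshift) (time_shift p) = dot (G (time_shift p)) (grad_v f p).
Proof.
rewrite /dissipation.
have -> : grad_v (f \o time_unshift) (time_shift p) =
  grad_v f (time_unshift (time_shift p)) by [].
by rewrite time_shiftK.
Qed.

Lemma integrable_shift (k : R * (E * E) -> R) : measurable_fun setT k ->
  P.-integrable strip (EFin \o k) -> UT.-integrable setT (EFin \o (k \o time_shift)).
Proof.
move=> mk ki; apply/integrableP; split.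
  by apply/measurable_EFinP; exact: (measurableT_comp mk measurable_time_shift).
have mk' : measurable_fun setT (fun p => `|(k p)%:E|%E).
  by apply/measurable_EFinP; exact: measurableT_comp.
have := @ge0_integral_uniform_prod _ _ R Txv t tau tau0 _ mk' (fun=> abse_ge0 _).
move=> /= ->.
rewrite lte_mul_pinfty//; first by rewrite lee_fin invr_ge0 ltW.
by case/integrableP : ki.
Qed.

(** The translated test function is supported in []t, t + tau[] in time. As [t >= 0], it vanishes at
    time 0 and the initial datum drops out, while the half-line reduces to the window. *)
Lemma weak_identity_strip f : test_fun_txv `]0, tau[ X V f ->
  \int[P]_(p in strip) flux (f \o time_unshift) p =
  xi * \int[P]_(p in strip) dissipation (f \o time_unshift) p.
Proof.
move=> tf; have tfs := test_fun_unshift tf; have W0 := weak tfs.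
have [a' [b' [c [_ c0 [mI mD] _ bnd]]]] := test_flux tfs.
have [a [b [C [ab _ _ out _]]]] := test_fun_bounds tf.
have zero p : ~ strip p -> flux (f \o time_unshift) p = 0 /\ dissipation (f \o time_unshift) p = 0.
  move=> np; have /out[_ z1 z2 z3] : ~~ (a <= (time_unshift p).1 <= b).
    apply/negP => H; apply: np; split => //=.
    have := ab (p.1 - t); rewrite /= !in_itv/= => /(_ H)/andP[h1 h2].
    by apply/andP; split; lra.
  rewrite /flux dt_unshift z1 /dissipation /transport.
  have -> : grad_x (f \o time_unshift) p = 0 by exact: z2.
  have -> : grad_v (f \o time_unshift) p = 0 by exact: z3.
  rewrite /dot !big1 ?subr0 ?addr0 ?mulr0// => i _; by rewrite [X in _ * X]mxE mulr0.
have mS : measurable (strip : set (measurableTypeR R * (E * E))) by exact: measurable_strip.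
have fi : P.-integrable strip (EFin \o flux (f \o time_unshift)).
  by apply: (integrable_le_weight _ t0 mI (c := 2 * c)) => p; case: (bnd p).
have di : P.-integrable strip (EFin \o dissipation (f \o time_unshift)).
  by apply: (integrable_le_weight _ t0 mD (c := c)) => p; case: (bnd p).
move: W0; rewrite [X in _ + X](_ : _ = 0); last first.
  rewrite (_ : (fun z => _) = cst 0); first by rewrite Rintegral_cst// mul0r.
  apply/funext => z /=; have /out[-> _ _ _] : ~~ (a <= (time_unshift (0, z)).1 <= b).
    apply/negP => H; have := ab (0 - t); rewrite /= !in_itv/= => /(_ H)/andP[h1 _].
    by move: h1; rewrite sub0r oppr_gt0 ltNge t0.
  by rewrite mulr0.
rewrite addr0 (@Rintegral_support _ _ P strip).
- rewrite RintegralB//; last exact: (integrableZl mS xi di).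
  by rewrite RintegralZl// => /eqP; rewrite subr_eq0 => /eqP.
- move=> [s z] [/= + _]; rewrite !in_itv/= => /andP[ts _]; split => //=.
  by rewrite ?in_itv/= ?andbT (le_trans t0).
- by move=> p _ /zero[-> ->]; rewrite mulr0 subr0.
Qed.

(** After translation both sides are [tau^-1] times integrals over the window, and these agree by
    the weak formulation. *)
Lemma diffusion_identity f : test_fun_txv `]0, tau[ X V f ->
  \int[Umu mu tau0]_p diffusion_form gamma xi (Gs p)
    (fun v => f (p.1, (p.2, v))) (fun v => grad_v f (p.1, (p.2, v))) =
  - (\int[UT]_p ((h \o time_shift) p * (dt f p + transport phi psi f p))).
Proof.
move=> tf; have tfs := test_fun_unshift tf.
have [a' [b' [c [_ c0 [mI mD] _ bnd]]]] := test_flux tfs.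
have fi : P.-integrable strip (EFin \o flux (f \o time_unshift)).
  by apply: (integrable_le_weight _ t0 mI (c := 2 * c)) => p; case: (bnd p).
have di : P.-integrable strip (EFin \o dissipation (f \o time_unshift)).
  by apply: (integrable_le_weight _ t0 mD (c := c)) => p; case: (bnd p).
have mDs := measurableT_comp mD measurable_time_shift.
have [pi pE] := @Rintegral_prodA _ _ _ (measurableTypeR R) E E R (uniform_prob tau0) mu gamma
  (dissipation (f \o time_unshift) \o time_shift) mDs (integrable_shift mD di).
transitivity (- xi * \int[UT]_p dissipation (f \o time_unshift) (time_shift p)).
  have pZ := RintegralZl (- xi) measurableT pi.
  rewrite -[X in _ * X]pE -[RHS]pZ; apply: eq_Rintegral => p _.
  rewrite /diffusion_form.
  have -> : (fun v => dot (Gs p v) (grad_v f (p.1, (p.2, v)))) =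
      (fun v => (dissipation (f \o time_unshift) \o time_shift) (p.1, (p.2, v))).
    by apply/funext => v; rewrite -(dissipation_unshift f (p.1, (p.2, v))).
  reflexivity.
rewrite (integral_uniform_prod tau0 mD di) mulNr; congr (- _).
transitivity (\int[UT]_p flux (f \o time_unshift) (time_shift p)).
  by rewrite (integral_uniform_prod tau0 mI fi) weak_identity_strip// mulrCA.
by apply: eq_Rintegral => p _; exact: flux_unshift.
Qed.

Lemma H1kin_solution : H1kin X V phi psi mu gamma tau0 (h \o time_shift)
  (fun p => diffusion_form gamma xi (Gs p)).
Proof.
split.
- exact: Lfun_shift.
- exists (G \o time_shift); split.
    apply/L2vecP; split; first exact: mGs.
    by rewrite integral_shift_G2; exact: shift_G2_fin.
  exact: (ae_uniform_prod (Q := fun p => weak_grad V (fun v => h (p.1, (p.2, v)))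
    (fun v => G (p.1, (p.2, v)))) tau0 t0 wG).
- split.
    have mq : measurable_fun setT (fun p => \int[gamma]_v (dot (Gs p v) (Gs p v))%:E)%E.
      apply: (@measurable_partial_integral _ _ (measurableTypeR R * E)%type E R gamma
        (fun q => (dot (G (time_shift (q.1.1, (q.1.2, q.2)))) (G (time_shift (q.1.1, (q.1.2, q.2)))))%:E)).
      apply: (measurableT_comp (f := fun p => (dot (G (time_shift p)) (G (time_shift p)))%:E)).
        by apply/measurable_EFinP; exact: measurable_dot.
      exact: measurable_prodA.
    (* Being integrable, the squared velocity norm of [G] is finite at almost every time and
       position, and there the diffusion form is a bounded functional. *)
    have qi : (Umu mu tau0).-integrable setT (fun p => \int[gamma]_v (dot (Gs p v) (Gs p v))%:E)%E.
      apply/integrableP; split => //.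
      have q0 p : (0 <= \int[gamma]_v (dot (Gs p v) (Gs p v))%:E)%E.
        by apply: integral_ge0 => v _; rewrite lee_fin dot_ge0.
      under eq_integral do rewrite (gee0_abs (q0 _)).
      by rewrite integral_shift_G2_iter; exact: shift_G2_fin.
    have [N [mN N0 HN]] := integrable_ae measurableT qi; exists N; split => //.
    apply: subset_trans HN; apply: subsetC => p /= Hp.
    apply: in_Hm1_diffusion; [exact: ltW|exact: mGsv|].
    have := Hp I; rewrite ge0_fin_numE//.
    by apply: integral_ge0 => v _; rewrite lee_fin dot_ge0.
  move=> g Gv [_ Gv2 _]; have [mGv _] := (L2vecP gamma Gv).1 Gv2.
  apply: measurable_funM => //.
  apply: (@measurable_partial_Rintegral _ _ (measurableTypeR R * E)%type E R gamma
    (fun q => dot (G (time_shift (q.1.1, (q.1.2, q.2)))) (Gv q.2))).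
  apply: measurable_dot => i; last exact: (measurableT_comp (mGv i) measurable_snd).
  exact: (measurableT_comp (mGs i) (@measurable_prodA _ _ _ (measurableTypeR R) E E)).
- apply: le_lt_trans Hm1norm_shift_le _; rewrite lte_mul_pinfty//.
  + by rewrite lee_fin sqr_ge0.
  + exact: shift_G2_fin.
- exact: diffusion_identity.
Qed.

End kinetic_solution.

(** * Products of cutoffs as test functions *)

Section cutoff_function.
Context (R : realType) (d : nat).
Local Notation E := 'rV[R]_d.
Variables (X V : base_space R) (T : R).

Definition cutoff (n : nat) (p : R * (E * E)) : R :=
  time_cutoff T n p.1 * (space_cutoff X n p.2.1 * space_cutoff V n p.2.2).

Lemma smooth_cutoff n : smooth (cutoff n).
Proof.
apply: smooth_mul; last apply: smooth_mul.
- apply: (@smooth_linear R _ _ (fun p : R * (E * E) => p.1) (time_cutoff T n) 0).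
  + exact: continuous_time.
  + by move=> k [w1 w2] [x1 x2] /=; rewrite subr0.
  + exact: smooth_time_cutoff.
- apply: (@smooth_linear R _ _ (fun p : R * (E * E) => p.2.1) (space_cutoff X n) 0).
  + move=> [s [x v]].
    have c1 : {for (s, (x, v)), continuous (fun p : R * (E * E) => p.2)} by exact: cvg_snd.
    have c2 : {for (x, v), continuous (fun p : E * E => p.1)} by exact: cvg_fst.
    exact: (cvg_comp _ _ c1 c2).
  + by move=> k [w1 w2] [x1 x2] /=; rewrite subr0.
  + exact: smooth_space_cutoff.
- apply: (@smooth_linear R _ _ (fun p : R * (E * E) => p.2.2) (space_cutoff V n) 0).
  + move=> [s [x v]].
    have c1 : {for (s, (x, v)), continuous (fun p : R * (E * E) => p.2)} by exact: cvg_snd.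
    have c2 : {for (x, v), continuous (fun p : E * E => p.2)} by exact: cvg_snd.
    exact: (cvg_comp _ _ c1 c2).
  + by move=> k [w1 w2] [x1 x2] /=; rewrite subr0.
  + exact: smooth_space_cutoff.
Qed.

Lemma test_fun_cutoff n : test_fun_txv `]-oo, +oo[ X V (cutoff n).
Proof.
split; first exact: smooth_cutoff.
- by move=> t v; rewrite /cutoff; case: X.
- by move=> t x; rewrite /cutoff; case: V.
- exists (-1), T, n.+1%:R; split => // t x v; rewrite /cutoff mulf_eq0 negb_or/= => /andP[ta].
  rewrite mulf_eq0 negb_or => /andP[xa va]; split.
  + exact: time_cutoff_support ta.
  + exact: space_cutoff_support xa.
  + exact: space_cutoff_support va.
Qed.

Lemma is_derive_scale (W : normedModType R) (f : W -> R) (a l : R) x w :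
  is_derive x w f l -> is_derive x w (fun y => a * f y) (a * l).
Proof.
move=> D; have := is_deriveM1 (is_derive_cst a x w) D.
by rewrite mul0r add0r.
Qed.

Lemma dt_cutoff n p : dt (cutoff n) p =
  'D_1 (time_cutoff T n) p.1 * (space_cutoff X n p.2.1 * space_cutoff V n p.2.2).
Proof.
have E1 : (fun s => cutoff n (s, p.2)) =
    (fun s => (space_cutoff X n p.2.1 * space_cutoff V n p.2.2) * time_cutoff T n s).
  by apply/funext => s; rewrite /cutoff/= mulrC.
have D := is_derive_scale (space_cutoff X n p.2.1 * space_cutoff V n p.2.2)
  (smooth_is_derive p.1 1 (smooth_time_cutoff T n)).
by rewrite /dt E1 derive_val mulrC.
Qed.

Lemma grad_x_cutoff n p : grad_x (cutoff n) p =
  (time_cutoff T n p.1 * space_cutoff V n p.2.2) *: grad (space_cutoff X n) p.2.1.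
Proof.
have E1 : (fun y => cutoff n (p.1, (y, p.2.2))) =
    (fun y => (time_cutoff T n p.1 * space_cutoff V n p.2.2) * space_cutoff X n y).
  by apply/funext => y; rewrite /cutoff/= [X in _ * X]mulrC mulrA.
rewrite /grad_x E1; apply/rowP => i; rewrite !mxE.
have D := is_derive_scale (time_cutoff T n p.1 * space_cutoff V n p.2.2)
  (smooth_is_derive p.2.1 (delta_mx 0 i) (smooth_space_cutoff X n)).
by rewrite derive_val.
Qed.

Lemma grad_v_cutoff n p : grad_v (cutoff n) p =
  (time_cutoff T n p.1 * space_cutoff X n p.2.1) *: grad (space_cutoff V n) p.2.2.
Proof.
have E1 : (fun w => cutoff n (p.1, (p.2.1, w))) =
    (fun w => (time_cutoff T n p.1 * space_cutoff X n p.2.1) * space_cutoff V n w).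
  by apply/funext => y; rewrite /cutoff/= mulrA.
rewrite /grad_v E1; apply/rowP => i; rewrite !mxE.
have D := is_derive_scale (time_cutoff T n p.1 * space_cutoff X n p.2.1)
  (smooth_is_derive p.2.2 (delta_mx 0 i) (smooth_space_cutoff V n)).
by rewrite derive_val.
Qed.

Hypothesis T0 : 0 < T.

(** A derivative in position or velocity gains a factor [1 / (n + 1)], which removes the transport
    and diffusion terms in the limit; the time derivative stays merely bounded. *)
Lemma cutoff_bounds : exists2 c : R, 0 <= c & forall n p, 0 <= p.1 ->
  [/\ `|cutoff n p| <= c, `|dt (cutoff n) p| <= c,
    enorm (grad_x (cutoff n) p) <= c / n.+1%:R &
    enorm (grad_v (cutoff n) p) <= c / n.+1%:R].
Proof.
have [Ct Ct0 Ht] := time_cutoff_bounded T0.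
have [Cx Cx0 Hx] := @space_cutoff_bounded R d X.
have [Cv Cv0 Hv] := @space_cutoff_bounded R d V.
have c0 : 0 <= Ct * (Cx * Cv) by rewrite !mulr_ge0.
have Cc : Ct * (Cx * Cv) <= d.+1%:R * (Ct * (Cx * Cv)).
  by rewrite -[X in X <= _]mul1r ler_wpM2r// ler1n.
exists (d.+1%:R * (Ct * (Cx * Cv))); first by rewrite mulr_ge0.
move=> n p p0; have [t1 t2] := Ht n _ p0.
have [x1 x2] := Hx n p.2.1; have [v1 v2] := Hv n p.2.2; split.
- apply: le_trans Cc; rewrite normrM ler_pM//.
  by rewrite normrM ler_pM.
- apply: le_trans Cc; rewrite dt_cutoff normrM ler_pM//.
  by rewrite normrM ler_pM.
- rewrite grad_x_cutoff -mulrA; apply: dot_coor_bound; first by rewrite divr_ge0.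
  move=> i; rewrite mxE normrM (_ : _ / _ = (Ct * Cv) * (Cx / n.+1%:R)); last first.
    by rewrite [Cx * Cv]mulrC !mulrA.
  by rewrite ler_pM// normrM ler_pM.
- rewrite grad_v_cutoff -mulrA; apply: dot_coor_bound; first by rewrite divr_ge0.
  move=> i; rewrite mxE normrM (_ : _ / _ = (Ct * Cx) * (Cv / n.+1%:R)); last first.
    by rewrite !mulrA.
  by rewrite ler_pM// normrM ler_pM.
Qed.

Lemma cvg0_le_harmonic (u : nat -> R) (K : R) :
  (forall n, `|u n| <= K / n.+1%:R) -> u n @[n --> \oo] --> (0 : R).
Proof.
move=> H; have K0 : (K * harmonic n : R) @[n --> \oo] --> (0 : R).
  by have := cvgM (cvg_cst K) (@cvg_harmonic R); rewrite mulr0; exact.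
apply: (@squeeze_cvgr _ _ _ _ (fun n => - (K * harmonic n)) (fun n => K * harmonic n)) => //.
- by near=> n; rewrite -ler_norml; exact: H.
- by have := cvgN K0; rewrite oppr0; exact.
Unshelve. all: by end_near. Qed.

End cutoff_function.

Lemma Rintegral_dominated_cvg d (T : measurableType d) (R : realType)
    (m : {measure set T -> \bar R}) (D : set T) (f_ : nat -> T -> R) (f g : T -> R) :
  measurable D -> (forall n, measurable_fun setT (f_ n)) -> measurable_fun D f ->
  (forall x, D x -> f_ n x @[n --> \oo] --> f x) ->
  m.-integrable D (EFin \o g) -> (forall n x, D x -> `|f_ n x| <= g x) ->
  \int[m]_(x in D) f_ n x @[n --> \oo] --> \int[m]_(x in D) f x.
Proof.
move=> mD mf_ mf cf ig dom.
have cf' x : D x -> (f_ n x)%:E @[n --> \oo] --> (f x)%:E.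
  by move=> Dx; apply: cvg_EFin; [exact: nearW|exact: cf].
have [fi _ H] := @dominated_convergence _ _ _ m D mD (fun n x => (f_ n x)%:E)
  (EFin \o f) (EFin \o g) (fun n => proj2 (measurable_EFinP _ _) (measurable_funTS (mf_ n)))
  (proj2 (measurable_EFinP _ _) mf)
  (aeW m cf') ig
  (aeW m (fun x n Dx => dom n x Dx)).
apply: fine_cvg; rewrite fineK; first exact: H.
exact: (integrable_fin_num mD fi).
Qed.

(** * Conservation of mass *)

Section mass_conservation.
Context (R : realType) (d : nat).
Local Notation E := 'rV[R]_d.
Local Notation leb := (@lebesgue_measure R).
Variables (X V : base_space R) (phi psi : E -> R) (mu gamma : probability E R).
Hypotheses (sphi : smooth phi) (spsi : smooth psi).
Hypothesis gphi : (\int[mu]_x (dot (grad phi x) (grad phi x))%:E < +oo)%E.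
Hypothesis gpsi : (\int[gamma]_v (dot (grad psi v) (grad psi v))%:E < +oo)%E.
Local Notation Txv := (ThetaXV mu gamma).
Local Notation P := (leb \x Txv)%E.

Variables (xi : R) (h0 : E * E -> R) (h : R * (E * E) -> R) (G : R * (E * E) -> E).
Hypothesis xi0 : 0 < xi.
Hypothesis mh : measurable_fun setT h.
Hypothesis mG : measurable_fun setT G.
Variable M : R.
Hypothesis hM : {ae leb, forall t, 0 <= t -> (L2norm Txv (fun z => h (t, z)) <= M%:E)%E}.
Hypothesis GL2 : (\int[leb]_(t in `[0%R, +oo[) L2vnorm Txv (fun z => G (t, z)) ^+ 2 < +oo)%E.
Hypothesis weak : forall f, test_fun_txv `]-oo, +oo[ X V f ->
  \int[P]_(p in `[0%R, +oo[ `*` setT) (flux phi psi h f p - xi * dissipation G f p)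
  + \int[Txv]_z (h0 z * f (0, z)) = 0.
Hypothesis h02 : h0 \in Lfun Txv 2%:E.
Hypothesis h0mean : \int[Txv]_z h0 z = 0.

Lemma integrable_strip_h a b : 0 <= a ->
  P.-integrable (`[a, b]%classic `*` setT) (EFin \o h).
Proof.
move=> a0; apply: (integrable_le_weight sphi spsi gphi gpsi mh mG hM GL2 b a0 mh (c := 1)) => p.
rewrite mul1r /weight.
have := dot_ge0 (grad psi p.2.2); have := dot_ge0 (grad phi p.2.1); have := dot_ge0 (G p).
have : `|h p| <= 1 + h p ^+ 2.
  have := sqr_ge0 (`|h p| - 1); rewrite sqrrB expr1n mulr1 real_normK ?num_real//.
  have := sqr_ge0 (h p); lra.
lra.
Qed.

(** The space factors tend to 1 and [h0] has zero mean, so the integral without the time factor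
    tends to 0; the time factor at 0 need only be bounded. *)
Lemma initial_term_cvg (T : R) : 0 < T ->
  \int[Txv]_z (h0 z * cutoff X V T n (0, z)) @[n --> \oo] --> (0 : R).
Proof.
move=> T0; have [Ct Ct0 Ht] := time_cutoff_bounded T0.
have [Cx Cx0 Hx] := @space_cutoff_bounded R d X.
have [Cv Cv0 Hv] := @space_cutoff_bounded R d V.
have mh0 := Lfun2_meas h02.
have ih0 : Txv.-integrable setT (EFin \o h0).
  apply/Lfun1_integrable; apply: Lfun_subset12 h02; exact: fin_num_measure.
pose k n (z : E * E) := h0 z * (space_cutoff X n z.1 * space_cutoff V n z.2).
have ms (S : base_space R) n : measurable_fun setT (@space_cutoff R d S n).
  by apply: continuous_measurable_row; apply: smooth_continuous; exact: smooth_space_cutoff.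
have mk n : measurable_fun setT (k n).
  apply: measurable_funM => //; apply: measurable_funM.
    exact: (measurableT_comp (ms X n) measurable_fst).
  exact: (measurableT_comp (ms V n) measurable_snd).
have bk n z : `|k n z| <= Cx * Cv * `|h0 z|.
  have [x1 _] := Hx n z.1; have [v1 _] := Hv n z.2.
  by rewrite normrM mulrC ler_wpM2r// normrM ler_pM.
have ik : Txv.-integrable setT (EFin \o (fun z => Cx * Cv * `|h0 z|)).
  exact: (integrableZl measurableT (Cx * Cv) (integrable_norm ih0)).
have kc : \int[Txv]_z k n z @[n --> \oo] --> (0 : R).
  rewrite -h0mean; apply: (Rintegral_dominated_cvg (g := fun z => Cx * Cv * `|h0 z|)) => //.
  move=> z _; have := cvgM (cvg_cst (h0 z))
    (cvgM (space_cutoff_cvg X z.1) (space_cutoff_cvg V z.2)).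
  by rewrite !mulr1; exact.
have E1 n : \int[Txv]_z (h0 z * cutoff X V T n (0, z)) = time_cutoff T n 0 * \int[Txv]_z k n z.
  rewrite -RintegralZl//; last first.
    apply: le_integrable ik => //; first exact/measurable_EFinP.
    move=> z _; rewrite /= lee_fin; apply: le_trans (bk n z) _; exact: ler_norm.
  by apply: eq_Rintegral => z _; rewrite /k /cutoff/= mulrCA.
under eq_fun do rewrite E1.
have kc0 : (Ct * `|\int[Txv]_z k n z|) @[n --> \oo] --> (0 : R).
  have := cvgM (cvg_cst Ct) (cvg_norm kc).
  by rewrite normr0 mulr0; exact.
apply: (@squeeze_cvgr _ _ _ _ (fun n => - (Ct * `|\int[Txv]_z k n z|))
  (fun n => Ct * `|\int[Txv]_z k n z|)) => //.
- near=> n; rewrite -ler_norml normrM ler_wpM2r//.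
  by have [] := Ht n 0 (lexx 0).
- by have := cvgN kc0; rewrite oppr0; exact.
Unshelve. all: by end_near. Qed.

Lemma cutoff_vanish (T : R) n p : T <= p.1 ->
  flux phi psi h (cutoff X V T n) p = 0 /\ dissipation G (cutoff X V T n) p = 0.
Proof.
move=> Tp; have [t1 t2] := derive_time_cutoff_ge n Tp.
rewrite /flux /dissipation /transport dt_cutoff grad_x_cutoff grad_v_cutoff t1 t2.
rewrite !mul0r !scale0r /dot !big1 ?subr0 ?addr0 ?mulr0// => i _;
  by rewrite [X in _ * X]mxE mulr0.
Qed.

Lemma cutoff_flux_cvg (T : R) p : 0 < T -> 0 <= p.1 ->
  flux phi psi h (cutoff X V T n) p - xi * dissipation G (cutoff X V T n) p
    @[n --> \oo] --> h p * (if p.1 < T then -1 else 0).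
Proof.
move=> T0 p0; have [c c0 H] := cutoff_bounds d X V T0.
have dt_cvg : dt (cutoff X V T n) p @[n --> \oo] --> (if p.1 < T then -1 else 0 : R).
  under eq_fun do rewrite dt_cutoff.
  have := cvgM (@time_cutoff_cvg R T p.1 p0)
    (cvgM (space_cutoff_cvg X p.2.1) (space_cutoff_cvg V p.2.2)).
  by rewrite !mulr1; exact.
have dot0 (u : E) (g : nat -> E) : (forall n, enorm (g n) <= c / n.+1%:R) ->
    dot u (g n) @[n --> \oo] --> (0 : R).
  move=> Hg; apply: (cvg0_le_harmonic (K := enorm u * c)) => n.
  by apply: le_trans (abs_dot_le _ _) _; rewrite -mulrA ler_wpM2l// enorm_ge0.
have cx := dot0 (grad psi p.2.2) (fun n => grad_x (cutoff X V T n) p)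
  (fun n => let: And4 _ _ h3 _ := H n p p0 in h3).
have cv := dot0 (grad phi p.2.1) (fun n => grad_v (cutoff X V T n) p)
  (fun n => let: And4 _ _ _ h4 := H n p p0 in h4).
have cg := dot0 (G p) (fun n => grad_v (cutoff X V T n) p)
  (fun n => let: And4 _ _ _ h4 := H n p p0 in h4).
have := cvgB (cvgM (cvg_cst (h p)) (cvgD dt_cvg (cvgB cx cv))) (cvgM (cvg_cst xi) cg).
by rewrite subr0 addr0 mulr0 subr0; exact.
Qed.

(** Limit of the weak formulation tested with the cutoffs: on [[0, T[] the integrand tends to [- h],
    with a multiple of [weight] as dominating function, and the initial term tends to 0. *)
Lemma mass_half_open (T : R) : 0 < T ->
  \int[P]_(p in `[0%R, T[%classic `*` setT) h p = 0.
Proof.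
move=> T0; have [c c0 H] := cutoff_bounds d X V T0.
pose I n p := flux phi psi h (cutoff X V T n) p - xi * dissipation G (cutoff X V T n) p.
pose l p : R := h p * (if p.1 < T then -1 else 0).
have mS : measurable (`[0%R, T]%classic `*` setT : set (measurableTypeR R * (E * E))).
  exact: measurable_strip.
have mI n : measurable_fun setT (I n).
  have [_ [_ [_ [_ _ [m1 m2] _ _]]]] :=
    test_flux sphi spsi mh mG (@test_fun_cutoff R d X V T n).
  by apply: measurable_funB => //; exact: measurable_funM.
have lim : \int[P]_(p in `[0%R, T]%classic `*` setT) I n p @[n --> \oo] -->
    \int[P]_(p in `[0%R, T]%classic `*` setT) l p.
  apply: (@Rintegral_dominated_cvg _ _ R P _ I l
    (fun p => (2 * c + xi * c) * weight phi psi h G p) mS mI).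
  - apply: measurable_funTS; apply: measurable_funM => //.
    apply: measurable_fun_if => //; apply: measurable_fun_ltr => //; exact: measurable_fst.
  - move=> p [/= p0 _]; apply: cutoff_flux_cvg => //.
    by move: p0; rewrite in_itv/= => /andP[].
  - exact: (integrableZl mS _ (integrable_weight sphi spsi gphi gpsi mh mG hM GL2 T (lexx 0))).
  - move=> n p [/= + _]; rewrite in_itv/= => /andP[p0 _]; have [_ h2 h3 h4] := H n p p0.
    have cn : c / n.+1%:R <= c by rewrite ler_pdivrMr// ler_peMr// ler1n.
    rewrite [leRHS]mulrDl; apply: le_trans (ler_normB _ _) _; apply: lerD.
      by apply: flux_le_weight => //; exact: le_trans cn.
    rewrite normrM (ger0_norm (ltW xi0)) -mulrA ler_wpM2l ?(ltW xi0)//.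
    by apply: diffusion_le_weight => //; exact: le_trans cn.
(* From [T] on the cutoff and its derivatives vanish, so the half-line of the weak formulation
   reduces to [[0, T]]. *)
have I0 n : \int[P]_(p in `[0%R, T]%classic `*` setT) I n p =
    - \int[Txv]_z (h0 z * cutoff X V T n (0, z)).
  have /eqP := weak (@test_fun_cutoff R d X V T n); rewrite addr_eq0 => /eqP <-.
  apply/esym/Rintegral_support.
    by move=> [s z] [/= + _]; rewrite !in_itv/= andbT => /andP[].
  move=> [s z] [/= s0 _] ns; have Ts : T <= s.
    rewrite leNgt; apply/negP => sT; apply: ns; split => //=.
    by move: s0; rewrite !in_itv/= andbT => ->; exact: ltW.
  by have [-> ->] := @cutoff_vanish T n (s, z) Ts; rewrite mulr0 subr0.
have l0 : \int[P]_(p in `[0%R, T]%classic `*` setT) l p = 0.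
  have lim0 : - (\int[Txv]_z (h0 z * cutoff X V T n (0, z))) @[n --> \oo] --> (0 : R).
    by have := cvgN (initial_term_cvg T0); rewrite oppr0; exact.
  move: lim; rewrite (funext I0) => lim.
  by rewrite -(cvg_lim (@Rhausdorff R) lim) (cvg_lim (@Rhausdorff R) lim0).
have : \int[P]_(p in `[0%R, T[%classic `*` setT) (-1 * h p) = 0.
  rewrite -[RHS]l0 [RHS](@Rintegral_support _ _ _ P (`[0%R, T[%classic `*` setT)).
  - apply: eq_Rintegral => p /set_mem[/= + _]; rewrite in_itv/= /l => /andP[_ ->].
    by rewrite mulrC.
  - by move=> [s z] [/= + _]; rewrite !in_itv/= => /andP[-> /ltW ->].
  - move=> [s z] [/= + _] ns; rewrite in_itv/= /l => /andP[s0 _]; rewrite ifF ?mulr0//.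
    by apply/negbTE; apply/negP => sT; apply: ns; split => //=; rewrite in_itv/= s0.
rewrite RintegralZl.
- by move/eqP; rewrite mulN1r oppr_eq0 => /eqP.
- exact: measurable_strip.
- apply: integrableS (integrable_strip_h T (lexx 0)) => //; first exact: measurable_strip.
  by move=> [s z] [/= + _]; rewrite !in_itv/= => /andP[-> /ltW ->].
Qed.

(** The half-open window is the difference of two half-open intervals starting at 0, and the closing
    endpoint is a null set. *)
Lemma mass_strip (t tau : R) : 0 <= t -> 0 < tau ->
  \int[P]_(p in `[t, t + tau]%classic `*` setT) h p = 0.
Proof.
move=> t0 tau0; have tT : t < t + tau by rewrite ltrDl.
have T0 : 0 < t + tau by exact: le_lt_trans tT.
have XU (A B : set R) : A `*` [set: E * E] `|` B `*` setT = (A `|` B) `*` setT.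
  apply/seteqP; split => -[s z] /=; first by move=> [[As _]|[Bs _]]; split => //; [left|right].
  by move=> [[As|Bs] _]; [left|right].
have mst (i : interval R) : measurable ([set` i] `*` setT : set (measurableTypeR R * (E * E))).
  by apply: measurable_strip; exact: measurable_itv.
have iT := integrable_strip_h (t + tau) (lexx 0).
have sub (i : interval R) : [set` i] `<=` `[0, t + tau]%classic ->
    P.-integrable ([set` i] `*` setT) (EFin \o h).
  move=> ij; apply: integrableS iT; [exact: mst|exact: mst|].
  by move=> [s z] [/= /ij].
have h1 : \int[P]_(p in `[0, t[%classic `*` setT) h p = 0.
  move: t0; rewrite le_eqVlt => /predU1P[<-|]; last exact: mass_half_open.
  rewrite (_ : _ `*` _ = set0) ?Rintegral_set0//.
  by apply/seteqP; split => // -[s z] [/=]; rewrite in_itv/=; case: ltgtP.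
have h2 : \int[P]_(p in `[t, t + tau[%classic `*` setT) h p = 0.
  have := mass_half_open T0.
  rewrite (_ : `[0, t + tau[%classic `*` setT =
    (`[0, t[%classic `*` setT) `|` (`[t, t + tau[%classic `*` setT)); last first.
    rewrite XU; congr (_ `*` _); apply/seteqP; split => s /=; rewrite !in_itv/=.
      by move=> /andP[s0 sT]; have [st|ts] := ltP s t; [left|right]; rewrite ?s0 ?sT.
    by move=> [/andP[-> st]|/andP[ts ->]]; [exact: lt_trans tT|rewrite andbT (le_trans t0)].
  rewrite Rintegral_setU.
  - by rewrite h1 add0r.
  - exact: mst.
  - exact: mst.
  - rewrite XU; apply: integrableS iT.
    + by apply: measurable_strip; exact: measurable_itv.
    + by apply: measurable_strip; apply: measurableU; exact: measurable_itv.
    + move=> [s z] [/= + _]; rewrite !in_itv/= => -[/andP[-> st]|/andP[ts sT]].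
        by split => //; apply: ltW; exact: lt_trans tT.
      by split => //; rewrite (le_trans t0)//= ltW.
  - apply/disj_setPS => -[s z] [[/= + _] [/= + _]]; rewrite !in_itv/=.
    by move=> /andP[_ st] /andP[ts _]; move: st; rewrite ltNge ts.
rewrite (_ : `[t, t + tau]%classic `*` setT =
    (`[t, t + tau[%classic `*` setT) `|` ([set t + tau] `*` setT)); last first.
  rewrite XU; congr (_ `*` _); apply/seteqP; split => s /=; rewrite !in_itv/=.
    by move=> /andP[-> ]; rewrite le_eqVlt => /predU1P[->|->]; [right|left].
  by move=> [/andP[-> /ltW]//|->]; rewrite lexx ltW.
have N0 : P ([set t + tau] `*` setT) = 0%E.
  rewrite [LHS](@product_measure1E _ _ (measurableTypeR R) _ R leb Txv)//.
  by rewrite [X in (X * _)%E]lebesgue_measure_set1 mul0e.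
have mN : measurable ([set t + tau] `*` setT : set (measurableTypeR R * (E * E))).
  by apply: measurable_strip.
rewrite Rintegral_setU.
- rewrite h2 add0r /Rintegral null_set_integral//.
  by apply: measurable_funTS; exact/measurable_EFinP.
- exact: mst.
- exact: mN.
- rewrite XU; apply: integrableS iT.
  + by apply: measurable_strip; exact: measurable_itv.
  + by apply: measurable_strip; apply: measurableU => //; exact: measurable_itv.
  + move=> [s z] [/= + _]; rewrite !in_itv/= => -[/andP[ts sT]|->].
      by split => //; rewrite (le_trans t0)//= ltW.
    by split => //; rewrite lexx ltW.
- apply/disj_setPS => -[s z] [[/= + _] [/= + _]]; rewrite !in_itv/=.
  by move=> /andP[_ sT] sE; move: sT; rewrite sE ltxx.
Qed.

End mass_conservation.

(** * Gronwall's lemma for window integrals *)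

Section gronwall.
Context (R : realType).
Local Notation leb := (@lebesgue_measure R).

Lemma Rintegral_itv_sub (f : R -> R) (a s u : R) : a <= s -> s <= u ->
  leb.-integrable `[a, u] (EFin \o f) ->
  \int[leb]_(x in `[a, u]) f x - \int[leb]_(x in `[a, s]) f x = \int[leb]_(x in `[s, u]) f x.
Proof.
move=> as_ su fi.
rewrite Rintegral_itvB//.
apply: Rintegral_itv_obnd_cbnd; apply: integrableS fi => //.
by move=> x /=; rewrite !in_itv/= => /andP[/ltW sx ->]; rewrite (le_trans as_).
Qed.

Lemma continuous_primitive (f : R -> R) (a x : R) : a < x ->
  (forall u, leb.-integrable `[a, u] (EFin \o f)) ->
  {for x, continuous (fun y => \int[leb]_(s in `[a, y]) f s)}.
Proof.
move=> ax fi; have ax1 : a < x + 1 by rewrite (lt_trans ax)// ltrDl.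
have /(continuous_within_itvP _ ax1)[H _ _] := parameterized_integral_continuous (ltW ax1) (fi (x + 1)).
by apply: H; rewrite in_itv/=; apply/andP; split => //; rewrite ltrDl ltr01.
Qed.

(* Primitives start at -1 rather than 0 so that the functions below are
   differentiable at t = 0. *)
Variables (f : R -> R) (N0 beta kappa tau : R).
Hypothesis fint : forall u : R, leb.-integrable `[-1, u] (EFin \o f).
Hypotheses (tau0 : 0 < tau) (kappa0 : 0 < kappa).

Let I (x : R) := \int[leb]_(s in `[-1, x]) f s.
Let n (x : R) := N0 - beta * I x.
Let K (x : R) := \int[leb]_(s in `[-1, x]) n s.
Let H (x : R) := K (x + tau) - K x.

Let cn (x : R) : -1 < x -> {for x, continuous n}.
Proof.
move=> x1; apply: continuousB; first exact: cvg_cst.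
by apply: continuousM; [exact: cvg_cst|exact: continuous_primitive].
Qed.

Lemma integrable_decay (u : R) : leb.-integrable `[-1, u] (EFin \o n).
Proof.
wlog u1 : u / -1 < u => [Hu|].
  have [/Hu//|u1] := ltP (-1) u.
  apply: (integrableS _ _ _ (Hu 0 _)) => //.
  by apply: subset_itvl; rewrite bnd_simp (le_trans u1)// lerN10.
apply: continuous_compact_integrable; first exact: segment_compact.
have cI := parameterized_integral_continuous (ltW u1) (fint u).
move=> x; apply: cvgB; first exact: cvg_cst.
by apply: cvgM; [exact: cvg_cst|exact: cI].
Qed.

Let dK (x : R) : -1 < x -> is_derive x (1 : R) K (n x).
Proof.
move=> x1; have xx : x < x + 1 by rewrite ltrDl.
have [d <-] := continuous_FTC1_closed xx (integrable_decay (x + 1)) x1 (cn x1).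
by rewrite derive1E; exact: derivableP.
Qed.

Let dH (x : R) : -1 < x -> is_derive x (1 : R) H (n (x + tau) - n x).
Proof.
move=> x1; have xt : -1 < x + tau by rewrite (lt_trans x1)// ltrDl.
apply: is_deriveB; last exact: dK.
have := @is_derive_comp1 R R K (fun s => 1 * s + tau) x 1 1 (n (x + tau)).
rewrite mul1r mulr1 => /(_ (dK xt) (is_derive_affine _ _ _)).
by rewrite (_ : K \o _ = fun s => K (s + tau))//; apply/funext => s /=; rewrite mul1r.
Qed.

(** With [c = beta / kappa], the derivative of [H] is [- beta * (I (x + tau) - I x)], at most
    [- c * H x] by assumption, so [expR (c * x) * H x] is nonincreasing. *)
Lemma gronwall_window :
  (forall t : R, 0 <= t -> H t <= kappa * (I (t + tau) - I t)) -> 0 <= beta ->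
  forall t : R, 0 <= t -> H t <= expR (- (beta / kappa * t)) * H 0.
Proof.
move=> key b0 t t0; pose c := beta / kappa.
(* The [+ 0] only gives the exponent the form expected by [is_derive_affine]. *)
pose g (x : R) := expR (c * x + 0) * H x.
have dg (x : R) : -1 < x -> is_derive x (1 : R) g
    ((expR (c * x + 0) * c) * H x + expR (c * x + 0) * (n (x + tau) - n x)).
  move=> x1; apply: is_deriveM1; last exact: dH.
  apply: (@is_derive_comp1 R R expR (fun s => c * s + 0)); exact: is_derive_affine.
have lt1 (x : R) : 0 <= x -> -1 < x by apply: lt_le_trans; rewrite oppr_lt0.
have := @ler0_derive1_nincr R g 0 t.
have h1 (x : R) : x \in `]0, t[ -> derivable g x 1.
  by rewrite in_itv/= => /andP[/ltW/lt1/dg[]].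
have h2 (x : R) : x \in `]0, t[ -> g^`()%classic x <= 0.
  rewrite in_itv/= => /andP[/ltW x0 _]; have D := dg _ (lt1 _ x0).
  rewrite derive1E derive_val -mulrA -mulrDr; apply: mulr_ge0_le0; first exact: expR_ge0.
  have h : c * H x <= c * (kappa * (I (x + tau) - I x)).
    by rewrite ler_wpM2l ?key// divr_ge0// ltW.
  have -> : n (x + tau) - n x = - (c * (kappa * (I (x + tau) - I x))).
    by rewrite /n /c; field; rewrite gt_eqF.
  by rewrite subr_le0.
have h3 : {within `[0, t], continuous g}.
  apply: derivable_within_continuous => x; rewrite in_itv/= => /andP[/lt1/dg[]] //.
move=> /(_ h1 h2 h3 0 t (lexx 0) t0 (lexx t)); rewrite /g mulr0 !addr0 expR0 mul1r.
by rewrite expRN ler_pdivlMl ?expR_gt0.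
Qed.

End gronwall.

(** Integrals over windows do not see null sets of times, so [N] may be replaced by the continuous
    function that the energy identity gives almost everywhere, and [D] by a finite function. *)
Lemma window_decay (R : realType) (D N : R -> \bar R) (N0 beta kappa tau : R) :
  0 < tau -> 0 < kappa -> 0 <= beta ->
  measurable_fun setT D -> (forall s, 0 <= D s)%E ->
  (\int[@lebesgue_measure R]_(s in `[0%R, +oo[) D s < +oo)%E ->
  measurable_fun setT N ->
  {ae @lebesgue_measure R, forall s : R, 0 <= s ->
    (N s = N0%:E - beta%:E * \int[@lebesgue_measure R]_(r in `[0%R, s]) D r)%E} ->
  (forall t : R, 0 <= t ->
    (\int[@lebesgue_measure R]_(s in `[t, (t + tau)%R]) N s <=
     kappa%:E * \int[@lebesgue_measure R]_(s in `[t, (t + tau)%R]) D s)%E) ->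
  forall t : R, 0 <= t ->
  (\int[@lebesgue_measure R]_(s in `[t, (t + tau)%R]) N s <=
   (expR (- (beta / kappa * t))%R)%:E *
   \int[@lebesgue_measure R]_(s in `[0%R, (0 + tau)%R]) N s)%E.
Proof.
move=> tau0 kappa0 b0 mD D0 Dfin mN NE key t t0.
set leb := @lebesgue_measure R.
(* [fine] sends the possible infinite values of [D], taken on a null set of nonnegative times, to 0;
   the extension by 0 to negative times makes primitives from -1 and from 0 agree at nonnegative
   times. *)
pose f (s : R) := if 0 <= s then fine (D s) else 0.
have f0 (s : R) : 0 <= f s by rewrite /f; case: ifP => // _; exact: fine_ge0.
have mf : measurable_fun setT f.
  apply: measurable_fun_ifT => //; first exact: measurable_fun_ler.
  exact: (measurableT_comp (@fine_measurable R setT measurableT) mD).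
have fint : leb.-integrable setT (EFin \o f).
  apply/integrableP; split; first exact/measurable_EFinP.
  apply: le_lt_trans Dfin; rewrite [leRHS]integral_mkcond.
  apply: ge0_le_integral => //.
  - by apply: measurableT_comp => //; exact/measurable_EFinP.
  - by apply/(measurable_restrictT D (measurable_itv _)); exact: measurable_funTS.
  move=> x _; rewrite /= ger0_norm// /f patchE mem_setE in_itv/= andbT.
  by case: ifP => // _; have := D0 x; case: (D x) => //=.
have Dae : {ae leb, forall s, `[0, +oo[%classic s -> D s = (f s)%:E}.
  have Di : leb.-integrable `[0, +oo[ D.
    apply/integrableP; split; first exact: measurable_funTS.
    by under eq_integral do rewrite gee0_abs//.
  have mI : measurable (`[0%R, +oo[%classic : set (measurableTypeR R)) by [].
  have [A [mA A0 HA]] := integrable_ae mI Di.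
  exists A; split => //; apply: subset_trans HA; apply: subsetC => s /= H s0.
  have := H s0; move: s0; rewrite /f in_itv/= andbT => -> /fineK ->//.
have mfE : measurable_fun setT (EFin \o f) by exact/measurable_EFinP.
have DE (A : set (measurableTypeR R)) : measurable A -> A `<=` [set` `[0%R, +oo[] ->
    (\int[leb]_(s in A) D s)%E = (\int[leb]_(s in A) f s)%:E.
  move=> mA A0; rewrite /Rintegral fineK; last first.
    by apply: integrable_fin_num => //; exact: integrableS fint.
  apply: ae_eq_integral => //; try exact: measurable_funTS.
  have [B [mB B0 HB]] := Dae.
  exists B; split => //; apply: subset_trans HB; apply: subsetC => s /= H /A0; exact: H.
pose I (x : R) := \int[leb]_(s in `[-1, x]) f s.
have fi u : leb.-integrable `[-1, u] (EFin \o f) by exact: integrableS fint.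
have IE (u : R) : 0 <= u -> (\int[leb]_(s in `[0%R, u]) D s)%E = (I u)%:E.
  move=> u0; rewrite DE//; last by move=> s /=; rewrite !in_itv/= andbT => /andP[].
  congr EFin; apply/esym/Rintegral_support.
    by move=> s /=; rewrite !in_itv/= => /andP[s0 ->]; rewrite (le_trans _ s0)// lerN10.
  move=> s /=; rewrite !in_itv/= => /andP[_ ->] /negP; rewrite andbT /f => /negbTE ->//.
have m1 (s : R) : 0 <= s -> -1 <= s by apply: le_trans; exact: lerN10.
have IB (s : R) : 0 <= s -> (\int[leb]_(r in `[s, (s + tau)%R]) D r)%E = (I (s + tau) - I s)%:E.
  move=> s0; rewrite /I Rintegral_itv_sub ?lerDl ?(ltW tau0) ?m1// DE// => r /=.
  by rewrite !in_itv/= andbT => /andP[/(le_trans s0)].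
pose n (x : R) := N0 - beta * I x.
have NI (s : R) : 0 <= s -> (\int[leb]_(r in `[s, (s + tau)%R]) N r)%E =
    (\int[leb]_(r in `[-1, s + tau]) n r - \int[leb]_(r in `[-1, s]) n r)%:E.
  move=> s0; have ni := @integrable_decay _ f N0 beta fi.
  have ni' : leb.-integrable `[s, s + tau] (EFin \o n).
    apply: integrableS (ni (s + tau)) => // r /=; rewrite !in_itv/= => /andP[sr ->].
    by rewrite m1// (le_trans s0).
  rewrite Rintegral_itv_sub ?lerDl ?(ltW tau0) ?m1//; last exact: ni.
  rewrite /Rintegral fineK; last exact: integrable_fin_num.
  apply: ae_eq_integral => //; [exact: measurable_funTS|exact: measurable_int ni'|].
  have [B [mB B0 HB]] := NE.
  exists B; split => //; apply: subset_trans HB; apply: subsetC => r /= H.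
  rewrite in_itv/= => /andP[/(le_trans s0) r0 _]; rewrite H// IE//.
rewrite !NI// -EFinM lee_fin.
apply: (gronwall_window _ tau0 kappa0) => //.
by move=> s s0; have := key _ s0; rewrite NI// IB// -EFinM lee_fin.
Qed.

(** * Variance and the Poincare inequality *)

Section variance.
Context d (T : measurableType d) (R : realType).
Variable m : probability T R.

Lemma Lfun2_integrable (g : T -> R) : g \in Lfun m 2%:E -> m.-integrable setT (EFin \o g).
Proof.
by move=> g2; apply/Lfun1_integrable; apply: (@Lfun_subset12 _ _ _ m) => //; exact: fin_num_measure.
Qed.

Lemma variance_split (g : T -> R) : g \in Lfun m 2%:E ->
  (\int[m]_x (g x ^+ 2)%:E =
   \int[m]_x ((g x - \int[m]_y g y) ^+ 2)%:E + ((\int[m]_y g y) ^+ 2)%:E)%E.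
Proof.
move=> g2; have /Lfun2P[mg gfin] := g2; have gi := Lfun2_integrable g2.
set c := \int[m]_y g y.
have g2i : m.-integrable setT (fun x => (g x ^+ 2)%:E).
  apply: (ge0_integrable (f := fun x => g x ^+ 2)) => //; first exact: measurable_funX.
  by move=> x; exact: sqr_ge0.
have ci : m.-integrable setT (cst (c ^+ 2)%:E) by exact: finite_measure_integrable_cst.
have E x : ((g x - c) ^+ 2)%:E = ((g x ^+ 2)%:E + (- (2 * c)%:E * (g x)%:E) + (c ^+ 2)%:E)%E.
  by rewrite -EFinN -EFinM -!EFinD; congr EFin; ring.
have li : m.-integrable setT (fun x => (- (2 * c)%:E * (g x)%:E)%E).
  by rewrite -EFinN; exact: integrableZl.
under [in RHS]eq_integral do rewrite E.
rewrite integralD//; last exact: integrableD.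
rewrite integralD// -EFinN integralZl// integral_cst// [X in ((c ^+ 2)%:E * X)%E]probability_setT mule1.
have -> : (\int[m]_x (g x)%:E)%E = c%:E.
  by rewrite /c /Rintegral fineK//; exact: integrable_fin_num.
rewrite -EFinM -addeA -addeA -!EFinD.
by rewrite (_ : - (2 * c) * c + (c ^+ 2 + c ^+ 2) = 0) ?adde0//; ring.
Qed.

End variance.

Section poincare.
Context (R : realType) (d : nat).
Local Notation E := 'rV[R]_d.
Variables (V : base_space R) (psi : E -> R) (gamma : probability E R) (c : R).
Hypothesis hgamma : gibbs_measure V psi gamma.
Hypothesis spsi : smooth psi.
Hypothesis c0 : 0 < c.
Hypothesis poincare : poincare_inequality V gamma c.

(** If [G] is not square integrable the right-hand side is infinite, as [c^-1 > 0]. Otherwise the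
    Poincare inequality applies to [g] minus its mean, which has the same weak gradient. *)
Lemma poincare_variance (g : E -> R) (G : E -> E) :
  g \in Lfun gamma 2%:E -> (forall i, measurable_fun setT (fun v => G v 0 i)) ->
  weak_grad V g G ->
  (\int[gamma]_v ((g v - \int[gamma]_w g w) ^+ 2)%:E <=
   (c^-1)%:E * \int[gamma]_v (dot (G v) (G v))%:E)%E.
Proof.
move=> g2 mG wG; have [Gfin|] := ltP (\int[gamma]_v (dot (G v) (G v))%:E)%E +oo%E; last first.
  by rewrite leye_eq => /eqP ->; rewrite gt0_muley ?leey// lte_fin invr_gt0.
set a := \int[gamma]_w g w.
have ga2 : (fun v => g v - a) \in Lfun gamma 2%:E.
  have /Lfun2P[mg gfin] := g2; apply/Lfun2P; split; first exact: measurable_funB.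
  by apply: le_lt_trans gfin; rewrite (variance_split g2) leeDl// lee_fin sqr_ge0.
have H : H1 V gamma (fun v => g v - a) G.
  by split; [|exact/L2vecP|exact: (weak_grad_subC hgamma spsi)].
have m0 : \int[gamma]_v (g v - a) = 0.
  rewrite RintegralB//; [|exact: Lfun2_integrable|exact: finite_measure_integrable_cst].
  by rewrite Rintegral_cst// [X in fine X]probability_setT mulr1 subrr.
have L := poincare H m0.
have L0 : (0 <= L2norm gamma (fun v => (g v - a)%R))%E by exact: Lnorm_ge0.
have := lee_pmul L0 L0 L L; rewrite -!expe2 L2norm_sqr.
move=> /le_trans; apply; rewrite expe2 muleACA -!expe2 L2vnorm_sqr -EFin_expe.
rewrite -powR_mulrn ?powR_ge0// -powRrM mulNr mulVf ?pnatr_eq0// powR_inv1//; exact: ltW.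
Qed.

End poincare.

(** * Coercivity on a time window *)

Section coercivity.
Context (R : realType) (d : nat).
Local Notation E := 'rV[R]_d.
Local Notation leb := (@lebesgue_measure R).
Variables (X V : base_space R) (phi psi : E -> R) (mu gamma : probability E R).
Hypothesis hgamma : gibbs_measure V psi gamma.
Hypotheses (sphi : smooth phi) (spsi : smooth psi).
Hypothesis gphi : (\int[mu]_x (dot (grad phi x) (grad phi x))%:E < +oo)%E.
Hypothesis gpsi : (\int[gamma]_v (dot (grad psi v) (grad psi v))%:E < +oo)%E.
Variables (tau : R) (tau0 : 0 < tau) (c C K : R).
Hypotheses (c0 : 0 < c) (C0 : 0 < C) (K0 : 0 <= K).
Hypothesis poincare : poincare_inequality V gamma c.
Hypothesis lions : forall g : R * E -> R, g \in Lfun (Umu mu tau0) 2%:E ->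
  (L2norm (Umu mu tau0) (fun p => (g p - \int[Umu mu tau0]_q g q)%R) ^+ 2
   <= C%:E * grad_tx_Hm1norm X phi mu tau0 g ^+ 2)%E.
Hypothesis averaging : averaging_inequality X V phi psi mu gamma tau0 K.
Local Notation Txv := (ThetaXV mu gamma).
Local Notation P := (leb \x Txv)%E.
Local Notation UT := (uniform_prob tau0 \x Txv)%E.
Local Notation U := (Umu mu tau0).

Variables (xi : R) (h0 : E * E -> R) (h : R * (E * E) -> R) (G : R * (E * E) -> E).
Hypothesis xi0 : 0 < xi.
Hypothesis mh : measurable_fun setT h.
Hypothesis mG : measurable_fun setT G.
Variable M : R.
Hypothesis hM : {ae leb, forall t, 0 <= t -> (L2norm Txv (fun z => h (t, z)) <= M%:E)%E}.
Hypothesis GL2 : (\int[leb]_(t in `[0%R, +oo[) L2vnorm Txv (fun z => G (t, z)) ^+ 2 < +oo)%E.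
Hypothesis weak : forall f, test_fun_txv `]-oo, +oo[ X V f ->
  \int[P]_(p in `[0%R, +oo[ `*` setT) (flux phi psi h f p - xi * dissipation G f p)
  + \int[Txv]_z (h0 z * f (0, z)) = 0.
Hypothesis wG : {ae (leb \x mu)%E, forall p, 0 <= p.1 -> weak_grad V
  (fun v => h (p.1, (p.2, v))) (fun v => G (p.1, (p.2, v)))}.
Hypothesis h02 : h0 \in Lfun Txv 2%:E.
Hypothesis h0mean : \int[Txv]_z h0 z = 0.
Variable t : R.
Hypothesis t0 : 0 <= t.
Local Notation strip := (`[t, t + tau]%classic `*` [set: E * E]).
Local Notation hs := (h \o time_shift t).

Let mhs : measurable_fun setT hs.
Proof. exact: (measurableT_comp mh (measurable_time_shift _)). Qed.

Let hs2 : hs \in Lfun UT 2%:E.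
Proof. exact: (Lfun_shift mh hM tau0 t0). Qed.

Let mhsv (p : R * E) : measurable_fun setT (fun v => hs (p.1, (p.2, v))).
Proof.
apply: (measurableT_comp mhs); apply: measurable_fun_pair => //.
Qed.

Let mGs : measurable_fun setT (G \o time_shift t).
Proof. exact: (measurableT_comp mG (measurable_time_shift _)). Qed.

Let mG2s : measurable_fun setT (fun p : R * E => \int[gamma]_v
  (dot (G (time_shift t (p.1, (p.2, v)))) (G (time_shift t (p.1, (p.2, v)))))%:E)%E.
Proof.
apply: (@measurable_partial_integral _ _ (measurableTypeR R * E)%type E R gamma
  (fun q => (dot (G (time_shift t (q.1.1, (q.1.2, q.2)))) (G (time_shift t (q.1.1, (q.1.2, q.2)))))%:E)).
apply/measurable_EFinP; apply: measurable_dot => i; apply: measurable_row;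
  by apply: (measurableT_comp mGs); exact: measurable_prodA.
Qed.

Let mGsv (p : R * E) i : measurable_fun setT (fun v => G (time_shift t (p.1, (p.2, v))) 0 i).
Proof.
apply: measurable_row; apply: (measurableT_comp mGs); apply: measurable_fun_pair => //.
Qed.

Let mavg : measurable_fun setT (vavg gamma hs).
Proof.
apply: (@measurable_partial_Rintegral _ _ (measurableTypeR R * E)%type E R gamma
  (fun q => hs (q.1.1, (q.1.2, q.2)))).
by apply: (measurableT_comp mhs); exact: measurable_prodA.
Qed.

Let shift_integral (k : R * (E * E) -> \bar R) : measurable_fun setT k -> (forall p, 0 <= k p)%E ->
  (\int[U]_p \int[gamma]_v k (p.1, (p.2, v)) = \int[UT]_p k p)%E.
Proof.
by move=> mk k0; rewrite (@ge0_integral_prodA _ _ _ (measurableTypeR R) E E R (uniform_prob tau0) mu gamma).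
Qed.

Let msq : measurable_fun setT (fun p : R * E => \int[gamma]_v (hs (p.1, (p.2, v)) ^+ 2)%:E)%E.
Proof.
apply: (@measurable_partial_integral _ _ (measurableTypeR R * E)%type E R gamma
  (fun q => (hs (q.1.1, (q.1.2, q.2)) ^+ 2)%:E)).
apply/measurable_EFinP/measurable_funX.
by apply: (measurableT_comp mhs); exact: measurable_prodA.
Qed.

Let mhs2 : measurable_fun setT (fun p : R * (E * E) => (hs p ^+ 2)%:E).
Proof. by apply/measurable_EFinP; exact: measurable_funX. Qed.

Let ae_L2 : {ae U, forall p, (fun v => hs (p.1, (p.2, v))) \in Lfun gamma 2%:E}.
Proof.
have /Lfun2P[_] := hs2; rewrite -(shift_integral mhs2); last by move=> p; rewrite lee_fin sqr_ge0.
have sq0 (p : R * E) : (0 <= \int[gamma]_v (hs (p.1, (p.2, v)) ^+ 2)%:E)%E.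
  by apply: integral_ge0 => v _; rewrite lee_fin sqr_ge0.
move=> fin; have Ui : U.-integrable setT (fun p : R * E => \int[gamma]_v (hs (p.1, (p.2, v)) ^+ 2)%:E)%E.
  apply/integrableP; split; first exact: msq.
  under eq_integral do rewrite (gee0_abs (sq0 _)).
  exact: fin.
have [N [mN N0 HN]] := integrable_ae measurableT Ui; exists N; split => //.
apply: subset_trans HN; apply: subsetC => p /= H; apply/Lfun2P; split; first exact: mhsv.
by have := H I; rewrite (ge0_fin_numE (sq0 _)).
Qed.

(** Squared norms on the translated window, under the probability law: [a] of [(Id - Pi) h], [b] of
    [Pi h], and [e] of the velocity gradient of [h]. *)
Let a := (\int[U]_p \int[gamma]_v ((hs (p.1, (p.2, v)) - vavg gamma hs p) ^+ 2)%:E)%E.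
Let b := (\int[U]_p ((vavg gamma hs p) ^+ 2)%:E)%E.
Let e := ((tau^-1)%:E * \int[P]_(p in strip) (dot (G p) (G p))%:E)%E.

Let mdev : measurable_fun setT (fun p : R * (E * E) => hs p - vavg gamma hs (p.1, p.2.1)).
Proof.
apply: measurable_funB => //; apply: (measurableT_comp mavg).
apply: measurable_fun_pair; first exact: measurable_fst.
exact: measurableT_comp measurable_fst measurable_snd.
Qed.

Let mdev2 : measurable_fun setT (fun p : R * (E * E) => ((hs p - vavg gamma hs (p.1, p.2.1)) ^+ 2)%:E).
Proof. by apply/measurable_EFinP; exact: measurable_funX. Qed.

Let mdevU : measurable_fun setT (fun p : R * E =>
  \int[gamma]_v ((hs (p.1, (p.2, v)) - vavg gamma hs p) ^+ 2)%:E)%E.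
Proof.
apply: (@measurable_partial_integral _ _ (measurableTypeR R * E)%type E R gamma
  (fun q => ((hs (q.1.1, (q.1.2, q.2)) - vavg gamma hs q.1) ^+ 2)%:E)).
by apply: (measurableT_comp mdev2); exact: measurable_prodA.
Qed.

Let aE : (L2norm UT (fun p => (hs p - vavg gamma hs (p.1, p.2.1))%R) ^+ 2 = a)%E.
Proof.
rewrite L2norm_sqr; apply/esym; apply: (shift_integral mdev2).
by move=> p; rewrite lee_fin sqr_ge0.
Qed.

(** Orthogonality of [Pi h] and [(Id - Pi) h], in the form of the variance formula for [gamma] at
    almost every time and position. *)
Let splitE : (\int[UT]_p (hs p ^+ 2)%:E = a + b)%E.
Proof.
rewrite -(shift_integral mhs2); last by move=> p; rewrite lee_fin sqr_ge0.
rewrite /a /b -ge0_integralD//.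
- apply: ae_eq_integral => //.
    by apply: emeasurable_funD => //; apply/measurable_EFinP; exact: measurable_funX.
  have [N [mN N0 HN]] := ae_L2; exists N; split => //.
  apply: subset_trans HN; apply: subsetC => p /= H _; exact: variance_split.
- by move=> p _; apply: integral_ge0 => v _; rewrite lee_fin sqr_ge0.
- by move=> p _; rewrite lee_fin sqr_ge0.
- by apply/measurable_EFinP; exact: measurable_funX.
Qed.

Let a_le : (a <= (c^-1)%:E * e)%E.
Proof.
rewrite /e -(integral_shift_G2_iter mu gamma mG tau0 t) -ge0_integralZl//.
- apply: ae_ge0_le_integral => //.
  + by move=> p _; apply: integral_ge0 => v _; rewrite lee_fin sqr_ge0.
  + by move=> p _; rewrite mule_ge0 ?lee_fin ?invr_ge0 ?(ltW c0)//; apply: integral_ge0 => v _; rewrite lee_fin dot_ge0.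
  + exact/measurable_funeM.
  have [N [mN N0 HN]] := ae_L2.
  have [N' [mN' N'0 HN']] := ae_uniform_prod tau0 t0 wG.
  exists (N `|` N'); split; [exact: measurableU|by rewrite null_set_setU|].
  move=> p nP; apply: contrapT => /not_orP[Np N'p]; apply: nP => _.
  apply: (@poincare_variance _ _ V psi gamma c hgamma spsi c0 poincare
    (fun v => hs (p.1, (p.2, v))) (fun v => G (time_shift t (p.1, (p.2, v))))).
  + by apply: contrapT => H; apply: Np; apply: HN.
  + exact: mGsv.
  + by apply: contrapT => H; apply: N'p; apply: HN'.
- by move=> p _; apply: integral_ge0 => v _; rewrite lee_fin dot_ge0.
- by rewrite lee_fin invr_ge0 ltW.
Qed.

Let b_fin : (b < +oo)%E.
Proof.
have /Lfun2P[_] := hs2; rewrite splitE; apply: le_lt_trans; rewrite leeDr//.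
by apply: integral_ge0 => p _; apply: integral_ge0 => v _; rewrite lee_fin sqr_ge0.
Qed.

Let avg2 : vavg gamma hs \in Lfun U 2%:E.
Proof. exact/Lfun2P. Qed.

Let avg_mean : \int[U]_p vavg gamma hs p = 0.
Proof.
have hsi := Lfun2_integrable hs2.
have [_ ->] := @Rintegral_prodA _ _ _ (measurableTypeR R) E E R (uniform_prob tau0) mu gamma hs mhs hsi.
have := integral_uniform_prod tau0 mh (integrable_strip_h sphi spsi gphi gpsi mh mG hM GL2 (t + tau) t0).
rewrite (mass_strip sphi spsi gphi gpsi xi0 mh mG hM GL2 weak h02 h0mean t0 tau0) mulr0; exact.
Qed.

Let b_le : (b <= C%:E * (K%:E * (a + (xi ^+ 2)%:E * e)))%E.
Proof.
have L : (b <= C%:E * grad_tx_Hm1norm X phi mu tau0 (vavg gamma hs) ^+ 2)%E.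
  by have := lions avg2; rewrite avg_mean L2norm_sqr; under eq_integral do rewrite subr0.
have A := averaging (H1kin_solution sphi spsi gphi gpsi xi0 mh mG hM GL2 weak tau0 t0 wG).
apply: le_trans L _; apply: lee_wpmul2l; first by rewrite lee_fin ltW.
apply: le_trans A _; apply: lee_wpmul2l; first by rewrite lee_fin.
rewrite aE leeD2l//.
exact: (Hm1norm_shift_le V mu gamma xi0 mG tau0 t).
Qed.

Lemma strip_coercivity : (\int[P]_(p in strip) (h p ^+ 2)%:E <=
  ((1 + C * K) * (c^-1 + xi ^+ 2))%:E * \int[P]_(p in strip) (dot (G p) (G p))%:E)%E.
Proof.
have e0 : (0 <= e)%E.
  by apply: mule_ge0; [rewrite lee_fin invr_ge0 ltW|apply: integral_ge0 => p _; rewrite lee_fin dot_ge0].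
have CK0 : 0 <= C * K by rewrite mulr_ge0// ltW.
have efin : (e < +oo)%E.
  by rewrite lte_mul_pinfty ?lee_fin ?invr_ge0 ?(ltW tau0)//; exact: (integral_strip_G2 mG GL2 _ t0).
have sE : (\int[UT]_p (hs p ^+ 2)%:E = (tau^-1)%:E * \int[P]_(p in strip) (h p ^+ 2)%:E)%E.
  apply: (@ge0_integral_uniform_prod _ _ R Txv t tau tau0 (fun p => (h p ^+ 2)%:E)).
    by apply/measurable_EFinP; exact: measurable_funX.
  by move=> p; rewrite lee_fin sqr_ge0.
have a0 : (0 <= a)%E.
  by apply: integral_ge0 => p _; apply: integral_ge0 => v _; rewrite lee_fin sqr_ge0.
have : (\int[UT]_p (hs p ^+ 2)%:E <= ((1 + C * K) * (c^-1 + xi ^+ 2))%:E * e)%E.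
  rewrite splitE; move: e0 efin a0 a_le b_le.
  have : (0 <= b)%E by apply: integral_ge0 => p _; rewrite lee_fin sqr_ge0.
  (* All three quantities are finite, so the rest is real arithmetic. Adding the term [xi ^+ 2 * q]
     to the bound on [a] as well lets [1 + C * K] be factored out. *)
  have := b_fin; move: (a) (b) (e) => [r| |] [s| |] [q| |]//.
  move=> _; rewrite -!EFinM -?EFinD -?EFinM !lee_fin => s0 q0 _ r0 rle sle.
  have CKle : C * (K * (r + xi ^+ 2 * q)) <= (C * K) * (c^-1 * q + xi ^+ 2 * q).
    by rewrite mulrA ler_wpM2l// lerD2r.
  have xq0 : 0 <= xi ^+ 2 * q by rewrite mulr_ge0// sqr_ge0.
  lra.
(* The normalisation [tau^-1] of the uniform law cancels. *)
rewrite sE /e muleCA lee_pmul2l// lte_fin invr_gt0//.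
Qed.
End coercivity.

Theorem theorem4 (R : realType) (d : nat) (X V : base_space R)
    (phi psi : 'rV[R]_d -> R) (mu gamma : probability 'rV[R]_d R)
    (hmu : gibbs_measure X phi mu) (hgamma : gibbs_measure V psi gamma)
    (tau : R) (tau0 : 0 < tau) (xi : R) (xi0 : 0 < xi)
    (CLions : R -> R) (h1 : position_hypotheses X phi mu CLions)
    (h2 : velocity_hypotheses V psi gamma)
    (h3 : hoermander_condition phi psi)
    (Lphi : R) (Lphi0 : 0 <= Lphi) (h4 : grad_phi_bounded X phi mu Lphi)
    (cpsi : R) (cpsi0 : 0 < cpsi) (h5 : poincare_inequality V gamma cpsi)
    (Kavg : R) (Kavg0 : 0 <= Kavg)
    (hKavg : averaging_inequality X V phi psi mu gamma tau0 Kavg) :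
  exists lambda : R,
    [/\ 0 < lambda,
        forall (h0 : 'rV[R]_d * 'rV[R]_d -> R)
               (h : R * ('rV[R]_d * 'rV[R]_d) -> R),
          h0 \in Lfun (ThetaXV mu gamma) 2%:E ->
          \int[ThetaXV mu gamma]_z h0 z = 0 ->
          VOU_solution X V phi psi mu gamma xi h0 h ->
          forall t : R, 0 <= t ->
            (Htau mu gamma tau h t
             <= (expR (- (2 * lambda * t)))%:E * Htau mu gamma tau h 0)%E &
        lambda >= 1 / (1 + CLions tau * Kavg) * (1 / (xi * cpsi) + xi)^-1].
Proof.
have [[sphi _] _ /(_ tau tau0)[C0 lions]] := h1.
have [[spsi _] _ psi4 _ _] := h2.
have gphi := grad_bounded_L2 hmu sphi h4.
have gpsi : (\int[gamma]_v (dot (grad psi v) (grad psi v))%:E < +oo)%E.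
  apply: (grad_psi_L2 spsi); apply: le_lt_trans psi4; rewrite leeDl//.
  by apply: integral_ge0 => v _; rewrite lee_fin; apply: sumr_ge0 => i _; apply: sumr_ge0 => j _; exact: sqr_ge0.
have CK0 : 0 < 1 + CLions tau * Kavg by rewrite ltr_wpDr// mulr_ge0// ltW.
have xc0 : 0 < 1 / (xi * cpsi) + xi by rewrite addr_gt0// divr_gt0// mulr_gt0.
(* The announced lower bound is itself an admissible [lambda]. *)
exists (1 / (1 + CLions tau * Kavg) * (1 / (xi * cpsi) + xi)^-1); split => //.
  by rewrite mulr_gt0 ?divr_gt0// invr_gt0.
move=> h0 h h02 h0mean [mh [[M hM] [G [mG wG GL2 weak energy]]]] t t0.
set Txv := ThetaXV mu gamma in hM GL2 energy *.
have /Lfun2P[_ h0fin] := h02.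
have mh2 : measurable_fun setT (fun p => (h p ^+ 2)%:E).
  by apply/measurable_EFinP; exact: measurable_funX.
have mG2 : measurable_fun setT (fun p => (dot (G p) (G p))%:E).
  by apply/measurable_EFinP; apply: measurable_dot => i; exact: measurable_row.
pose kappa := (1 + CLions tau * Kavg) * (cpsi^-1 + xi ^+ 2).
have kappa0 : 0 < kappa by rewrite mulr_gt0// addr_gt0 ?invr_gt0// exprn_gt0.
(* This rests on [1 / (xi * cpsi) + xi = (cpsi^-1 + xi ^+ 2) / xi]: the [xi] of the dissipation rate
   enters the last factor of the bound. *)
have rateE : 2 * xi / kappa = 2 * (1 / (1 + CLions tau * Kavg) * (1 / (xi * cpsi) + xi)^-1).
  rewrite /kappa (_ : 1 / (xi * cpsi) + xi = (cpsi^-1 + xi ^+ 2) / xi); last first.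
    by field; rewrite !gt_eqF.
  by field; rewrite !(gt_eqF xi0) !(gt_eqF cpsi0) !(gt_eqF CK0) gt_eqF// addr_gt0// mulr_gt0// exprn_gt0.
rewrite -rateE /Htau.
apply: (@window_decay R (fun s => L2vnorm Txv (fun z => G (s, z)) ^+ 2)%E
  (fun s => L2norm Txv (fun z => h (s, z)) ^+ 2)%E (fine (L2norm Txv h0 ^+ 2)%E)
  (2 * xi) kappa tau) => //.
- by rewrite mulr_ge0// ltW.
- under eq_fun do rewrite L2vnorm_sqr.
  exact: (@measurable_partial_integral _ _ (measurableTypeR R) (_ * _)%type R Txv _ mG2).
- by move=> s; rewrite sqre_ge0.
- under eq_fun do rewrite L2norm_sqr.
  exact: (@measurable_partial_integral _ _ (measurableTypeR R) (_ * _)%type R Txv _ mh2).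
(* The initial energy is finite because [h0] is square integrable, so taking its real part loses
   nothing. *)
- rewrite fineK; first exact: energy.
  by rewrite ge0_fin_numE ?sqre_ge0// L2norm_sqr; exact: h0fin.
- move=> s s0; under eq_integral do rewrite L2norm_sqr.
  under [in leRHS]eq_integral do rewrite L2vnorm_sqr.
  have mI : measurable (`[s, s + tau]%classic : set R) by [].
  have <- := @ge0_integral_strip _ _ R Txv _ (fun p => (h p ^+ 2)%:E) mI mh2.
    have <- := @ge0_integral_strip _ _ R Txv _ (fun p => (dot (G p) (G p))%:E) mI mG2.
      exact: (strip_coercivity hgamma sphi spsi gphi gpsi cpsi0 C0 Kavg0 h5 lions hKavg
        xi0 mh mG hM GL2 weak wG h02 h0mean s0).
    by move=> p; rewrite lee_fin dot_ge0.
  by move=> p; rewrite lee_fin sqr_ge0.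
Qed.
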